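(* For $k\in\mathbf N=\{1,2,3,\dots\}$ and $t>0$ let $$I_k(t)=\int_0^1\left|\zeta_1\left(\tfrac12+it,\alpha\right)\right|^{2k}\,d\alpha .$$ Then, with an implicit constant independent of $k$, $$\left|\zeta\left(\tfrac12+it\right)\right|\lesssim t^{1/(4k)}\,I_k(t)^{1/(2k)},\qquad k\in\mathbf N .$$ That is, there exist constants $C>0$ and $t_0>0$, independent of $k$, such that $|\zeta(\tfrac12+it)|\le C\,t^{1/(4k)}I_k(t)^{1/(2k)}$ for all $k\in\mathbf N$ and all $t\ge t_0$.
   Context: $\zeta$ is the Riemann zeta function. The modified Hurwitz zeta function is $\zeta_1(s,\alpha)=\sum_{n=1}^\infty (n+\alpha)^{-s}$ for $\Re s>1$ (here $\alpha\ge 0$), and by analytic continuation for $s\in\mathbf C$, $s\ne 1$. *)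

(* Defs.v *)
From Stdlib Require Import Reals.
From Coquelicot Require Import Coquelicot.

Open Scope R_scope.

(* x ^ (-s) = exp (- s ln x), the principal value; meaningful for x > 0 only. *)
Definition cpow_opp (x : R) (s : C) : C :=
  (Rpower x (- Re s) * cos (Im s * ln x),
   - (Rpower x (- Re s) * sin (Im s * ln x))).

Definition analytic_at (f : C -> C) (z0 : C) : Prop :=
  exists (r : posreal) (a : nat -> C),
    forall z : C, Cmod (z - z0)%C < r ->
      is_pseries (K := C_AbsRing) (V := C_NormedModule) a (z - z0)%C (f z).

(* [f] is the analytic continuation to C \ {1} of the sum over n >= 0 of
   [u n s], a series converging for Re s > 1.  By the identity theorem these
   two clauses determine [f s] for every s <> 1; the value [f 1] is left free. *)
Definition is_continuation_of_series (u : nat -> C -> C) (f : C -> C) : Prop :=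
  (forall s : C, 1 < Re s ->
     is_series (K := C_AbsRing) (V := C_NormedModule) (fun n => u n s) (f s))
  /\ (forall s : C, s <> RtoC 1 -> analytic_at f s).

(* Series are indexed from 0, so the n-th term below is the classical term of
   index n + 1. *)
Definition is_riemann_zeta (zeta : C -> C) : Prop :=
  is_continuation_of_series (fun n s => cpow_opp (INR (S n)) s) zeta.

Definition is_modified_hurwitz_zeta (zeta1 : C -> R -> C) : Prop :=
  forall alpha : R, 0 <= alpha ->
    is_continuation_of_series
      (fun n s => cpow_opp (INR (S n) + alpha) s) (fun s => zeta1 s alpha).

(* The integrand is continuous in alpha.  The integral is positive:
   zeta1 (s, 0) - zeta1 (s, 1) = 1, so the integrand does not vanish
   at both endpoints. *)
Definition hurwitz_moment (zeta1 : C -> R -> C) (k : nat) (t : R) : R :=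
  RInt (fun alpha => Cmod (zeta1 (1 / 2, t) alpha) ^ (2 * k)) 0 1.

(* Main.v *)
(* Write s = 1/2 + i t and Z(alpha) = zeta_1(s, alpha).  If lam ^ (2 k) = sqrt t * I_k(t), then
   |Z| <= lam + |Z| ^ (2 k) / lam ^ (2 k - 1) shows that Z has integral O(lam) against every
   nonnegative kernel on [0, 1] of height O(sqrt t) and mass O(1).  It remains to express zeta(s)
   by such integrals.

   Euler-Maclaurin summation (valid at s by uniqueness of analytic continuation along a horizontal
   ray) gives Z(alpha) = sum_(n <= N) (n + alpha) ^ (- s) + O(1) for N of size t ^ 2, and zeta(s) = Z(0).
   Split n ^ (- s) = c(n) n ^ (- s) + (1 - c(n)) n ^ (- s) with c(x) = t / (t + x ^ 2).

   The part with 1 - c is the integral of Z against the periodic Green function K of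
   1 - (1/t) d^2/dx^2, up to O(1): testing K against (1 - c(x)) x ^ (- s) produces the sum over the
   integers, while to leading order the operator multiplies x ^ (- s) by 1 + t / x ^ 2 = 1 / (1 - c).

   The part with c is reduced, by summing by parts twice, to the Cesaro sums of n ^ (- s), that is,
   up to conjugation, of m ^ (s - 1).  The m-th Fourier coefficient of Z is C m ^ (s - 1) up to a small
   error, where C is the integral of x ^ (- s) e ^ (2 pi i x), so these Cesaro sums are integrals of Z
   against Fejer kernels.  |C| is bounded below: after rotating C by the value of the phase at its
   stationary point, the imaginary part is the integral of sin u against functions of u decreasing
   in u. *)
Require Import Defs.
From Stdlib Require Import Reals Factorial Lra Lia.
From Coquelicot Require Import Coquelicot.
Open Scope R_scope.

(** * Real-analytic functions *)

(** A kernel of height O(sqrt t) averages over alpha-intervals of length t ^ (-1/2), while (n +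
    alpha) ^ (-s) oscillates in alpha with frequency of order t / n. Such averages see the terms
    with n well beyond sqrt t and wash out the smaller ones; these are reached from the dual side,
    through Fourier coefficients in alpha. Hence [cut] drops from 1 to 0 around sqrt t, and its
    exact shape is dictated by the symbol 1 / (1 + t / x ^ 2) of the Green kernel. A Fejer kernel of
    order n has height n + 1, too much once n exceeds sqrt t; there the second differences of [cut]
    are small enough to make up for it.

    All steps leave additive errors O(1), so lam must also be bounded below, uniformly in k. The
    bound 1/400 comes from the mean of |Z|, which the first Fourier coefficient keeps away from 0.
    Complex values are handled through [rotated_re b], the real part after rotation by - b, so that
    all integrals are real and b is a free parameter. The threshold 10 ^ 9 makes the numerical lower
    bounds for |C| and for that mean hold. *)

Lemma pseries_zero_right (a : nat -> R) (r : R) :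
  0 < r ->
  (forall y, Rabs y < r -> ex_series (fun k => a k * y ^ k)) ->
  (forall y, 0 < y < r -> PSeries a y = 0) ->
  forall n, a n = 0.
Proof.
  intros Hr Hex Hz n. revert a Hex Hz.
  (* Constant term: the sum is continuous at 0 and vanishes to the right of 0. Dividing the series
     by y then brings each higher coefficient to the front. *)
  assert (H0 : forall a : nat -> R,
    (forall y, Rabs y < r -> ex_series (fun k => a k * y ^ k)) ->
    (forall y, 0 < y < r -> PSeries a y = 0) -> a 0%nat = 0).
  { intros a Hex Hz.
    assert (Hcv : Rbar_lt 0 (CV_radius a)).
    { apply Rbar_lt_le_trans with (r / 2); [simpl; lra|].
      apply Rbar_not_lt_le. intros Hlt.
      apply (CV_disk_outside a (r / 2)).
      - rewrite Rabs_pos_eq; [exact Hlt | lra].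
      - apply ex_series_lim_0. apply Hex. rewrite Rabs_pos_eq; lra. }
    assert (Hc : continuity_pt (PSeries a) 0).
    { apply PSeries_continuity. rewrite Rabs_R0. exact Hcv. }
    rewrite <- PSeries_0.
    destruct (Req_dec (PSeries a 0) 0) as [E|E]; [exact E|exfalso].
    destruct (Hc (Rabs (PSeries a 0)) (Rabs_pos_lt _ E)) as [d [Hd Hdd]].
    assert (Hm : 0 < Rmin d r) by (apply Rmin_glb_lt; lra).
    pose proof (Rmin_l d r). pose proof (Rmin_r d r).
    specialize (Hdd (Rmin d r / 2)).
    simpl in Hdd. unfold R_dist in Hdd.
    rewrite Hz in Hdd by lra.
    rewrite Rminus_0_l, Rabs_Ropp in Hdd.
    apply (Rlt_irrefl (Rabs (PSeries a 0))), Hdd.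
    split; [split; [exact I|lra]|].
    rewrite Rminus_0_r, Rabs_pos_eq; lra. }
  induction n as [|n IH]; intros a Hex Hz; [apply H0; assumption|].
  pose proof (H0 a Hex Hz) as Ha0.
  change (a (S n)) with (PS_decr_1 a n). apply IH.
  - intros y Hy. destruct (Req_dec y 0) as [->|Hy0].
    + exists (PS_decr_1 a 0%nat). apply (proj1 (is_pseries_R _ _ _)).
      exact (@is_pseries_0 R_AbsRing R_NormedModule (PS_decr_1 a)).
    + apply ex_series_ext with (fun k => / y * (a (S k) * y ^ S k)).
      * intros k. unfold PS_decr_1. simpl. now field.
      * apply (ex_series_scal_l (/ y) (fun k => a (S k) * y ^ S k)).
        now apply (ex_series_incr_1 (fun k => a k * y ^ k)), Hex.
  - intros y Hy. pose proof (Hz y Hy) as E.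
    rewrite PSeries_decr_1_aux in E by assumption.
    apply Rmult_integral in E. destruct E; [lra|assumption].
Qed.

Definition real_analytic_at (h : R -> R) (x : R) : Prop :=
  exists (r : R) (a : nat -> R), 0 < r /\
    forall y, Rabs y < r -> is_series (fun k => a k * y ^ k) (h (x + y)).

Lemma real_analytic_at_minus (f g : R -> R) (x : R) :
  real_analytic_at f x -> real_analytic_at g x ->
  real_analytic_at (fun y => f y - g y) x.
Proof.
  intros [r1 [a [Hr1 Ha]]] [r2 [b [Hr2 Hb]]].
  exists (Rmin r1 r2), (fun k => a k - b k). split; [now apply Rmin_glb_lt|].
  intros y Hy.
  apply is_series_ext with (fun k => minus (a k * y ^ k) (b k * y ^ k)).
  - intros k. unfold minus, plus, opp; simpl. ring.
  - apply (is_series_minus (fun k => a k * y ^ k) (fun k => b k * y ^ k)).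
    + apply Ha. eapply Rlt_le_trans; [exact Hy|apply Rmin_l].
    + apply Hb. eapply Rlt_le_trans; [exact Hy|apply Rmin_r].
Qed.

(** Let s be the supremum of the points beyond l where h is nonzero. The expansion at s vanishes to
    the right of s, hence identically, so h vanishes on a left neighbourhood of s as well, against
    the choice of s. *)
Lemma real_analytic_unique (h : R -> R) (l m : R) :
  l < m -> (forall x, l <= x -> real_analytic_at h x) ->
  (forall x, m < x -> h x = 0) -> h l = 0.
Proof.
  intros Hlm Han Hz.
  destruct (Req_dec (h l) 0) as [E|E]; [exact E|exfalso].
  set (P := fun x => l <= x /\ h x <> 0).
  assert (Hb : bound P).
  { exists m. intros x [_ Hx]. apply Rnot_lt_le. intros Hmx. now apply Hx, Hz. }
  destruct (completeness P Hb) as [s [Hub Hlub]]; [exists l; split; lra|].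
  assert (Hls : l <= s) by (apply Hub; split; lra).
  assert (Hright : forall x, s < x -> h x = 0).
  { intros x Hx. destruct (Req_dec (h x) 0) as [|Hn]; [assumption|exfalso].
    assert (x <= s) by (apply Hub; split; lra). lra. }
  destruct (Han s Hls) as [r [a [Hr Ha]]].
  assert (Hz0 : forall n, a n = 0).
  { apply pseries_zero_right with r; [assumption|..].
    - intros y Hy. eexists. now apply Ha.
    - intros y Hy. unfold PSeries. rewrite (is_series_unique _ _ (Ha y ltac:(rewrite Rabs_pos_eq; lra))).
      apply Hright. lra. }
  assert (Hall : forall x, s - r < x -> h x = 0).
  { intros x Hx. destruct (Rlt_le_dec s x) as [Hs|Hs]; [now apply Hright|].
    replace x with (s + (x - s)) by ring.
    rewrite <- (is_series_unique _ _ (Ha (x - s) ltac:(rewrite Rabs_left1; lra))).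
    rewrite (Series_ext _ (fun k => 0 * (x - s) ^ k)) by (intros n; now rewrite Hz0).
    rewrite Series_scal_l. ring. }
  assert (s <= s - r); [|lra].
  apply Hlub. intros x [_ Hx]. apply Rnot_lt_le. intros Hlt. now apply Hx, Hall.
Qed.

(** Weierstrass's double series theorem. The Cauchy-type bound on the coefficients makes the tail of
    the n-th series at most [U n] times a geometric remainder in q = |y| / rho, with the same q for
    all n, so the two summations may be exchanged. *)
Lemma is_series_of_power_series (c : nat -> nat -> R) (u U : nat -> R) (rho y : R) :
  0 < rho -> Rabs y < rho ->
  (forall n, is_series (fun j => c n j * y ^ j) (u n)) ->
  (forall n j, Rabs (c n j) * rho ^ j <= U n) -> ex_series U ->
  is_series (fun j => Series (fun n => c n j) * y ^ j) (Series u).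
Proof.
  intros Hrho Hy Hu HcU HU.
  set (q := Rabs y / rho).
  assert (Hq0 : 0 <= q) by (apply Rdiv_le_0_compat; [apply Rabs_pos|lra]).
  assert (Hq1 : q < 1) by (apply Rlt_div_l; lra).
  assert (Hcy : forall n j, Rabs (c n j * y ^ j) <= U n * q ^ j).
  { intros n j. rewrite Rabs_mult, <- RPow_abs.
    replace (Rabs y ^ j) with (rho ^ j * q ^ j).
    - rewrite <- Rmult_assoc. apply Rmult_le_compat_r; [now apply pow_le|apply HcU].
    - rewrite <- Rpow_mult_distr. f_equal. unfold q. field. lra. }
  assert (Hgeom : ex_series (fun j => q ^ j)).
  { eexists. apply is_series_geom. now rewrite Rabs_pos_eq. }
  assert (HU0 : forall n, 0 <= U n).
  { intros n. eapply Rle_trans; [|apply (HcU n 0%nat)]. simpl. rewrite Rmult_1_r. apply Rabs_pos. }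
  assert (Hc : forall j, ex_series (fun n => c n j)).
  { intros j. apply (@ex_series_le R_AbsRing R_CompleteNormedModule) with (fun n => U n * / rho ^ j).
    - intros n. change (Rabs (c n j) <= U n * / rho ^ j).
      apply (Rle_div_r (Rabs (c n j))); [apply pow_lt; lra|apply HcU].
    - now apply ex_series_scal_r. }
  assert (Hub : forall n, Rabs (u n) <= U n * / (1 - q)).
  { intros n. rewrite <- (is_series_unique _ _ (Hu n)).
    eapply Rle_trans; [apply Series_Rabs|].
    - apply (@ex_series_le R_AbsRing R_CompleteNormedModule) with (fun j => U n * q ^ j).
      + intros j. change (Rabs (Rabs (c n j * y ^ j)) <= U n * q ^ j). rewrite Rabs_Rabsolu. apply Hcy.
      + now apply (ex_series_scal_l (U n) (fun j => q ^ j)).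
    - rewrite <- (is_series_unique (fun j => q ^ j) (/ (1 - q)))
        by (apply is_series_geom; now rewrite Rabs_pos_eq).
      rewrite <- Series_scal_l. apply Series_le.
      + intros j. split; [apply Rabs_pos|apply Hcy].
      + now apply (ex_series_scal_l (U n) (fun j => q ^ j)). }
  assert (Hexu : ex_series u).
  { apply (@ex_series_le R_AbsRing R_CompleteNormedModule) with (fun n => U n * / (1 - q)); [exact Hub|].
    now apply ex_series_scal_r. }
  assert (Hpart : forall J, is_series (fun n => sum_n (fun j => c n j * y ^ j) J)
                     (sum_n (fun j => Series (fun n => c n j) * y ^ j) J)).
  { induction J as [|J IH].
    - rewrite sum_O.
      apply is_series_ext with (fun n => c n 0%nat * y ^ 0).
      + intros n. now rewrite sum_O.
      + apply is_series_scal_r with (c := y ^ 0). now apply Series_correct.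
    - rewrite sum_Sn.
      apply is_series_ext with (fun n => plus (sum_n (fun j => c n j * y ^ j) J) (c n (S J) * y ^ S J)).
      + intros n. now rewrite sum_Sn.
      + apply (is_series_plus (fun n => sum_n (fun j => c n j * y ^ j) J)); [exact IH|].
        apply is_series_scal_r with (c := y ^ S J). now apply Series_correct. }
  assert (Htail : forall n J, Rabs (u n - sum_n (fun j => c n j * y ^ j) J) <= U n * (q ^ S J / (1 - q))).
  { intros n J.
    rewrite <- (is_series_unique _ _ (Hu n)).
    rewrite (Series_incr_n _ (S J)); [|lia|eexists; apply Hu].
    rewrite <- sum_n_Reals. simpl pred.
    match goal with |- Rabs (?a + ?b - ?a) <= _ => replace (a + b - a) with b by ring end.
    assert (Hex : ex_series (fun j => U n * (q ^ S J) * q ^ j)) by now apply (ex_series_scal_l (U n * q ^ S J) (fun j => q ^ j)).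
    assert (Hle : forall j, Rabs (c n (S J + j)%nat * y ^ (S J + j)) <= U n * q ^ S J * q ^ j).
    { intros j. eapply Rle_trans; [apply Hcy|]. rewrite pow_add. right. ring. }
    eapply Rle_trans; [apply Series_Rabs|].
    - apply (@ex_series_le R_AbsRing R_CompleteNormedModule) with (2 := Hex).
      intros j. change (Rabs (Rabs (c n (S J + j)%nat * y ^ (S J + j))) <= U n * q ^ S J * q ^ j).
      rewrite Rabs_Rabsolu. apply Hle.
    - eapply Rle_trans; [apply Series_le with (2 := Hex)|].
      + intros j. split; [apply Rabs_pos|apply Hle].
      + rewrite (Series_scal_l _ (fun j => q ^ j)), (is_series_unique (fun j => q ^ j) (/ (1 - q))).
        * right. unfold Rdiv. ring.
        * apply is_series_geom. now rewrite Rabs_pos_eq. }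
  assert (Hdiff : forall J, Rabs (Series u - sum_n (fun j => Series (fun n => c n j) * y ^ j) J)
                    <= Series U * / (1 - q) * q ^ S J).
  { intros J. rewrite <- (is_series_unique _ _ (Hpart J)).
    rewrite <- Series_minus; [|assumption|eexists; apply Hpart].
    assert (Hex : ex_series (fun n => U n * (q ^ S J / (1 - q)))) by now apply ex_series_scal_r.
    eapply Rle_trans; [apply Series_Rabs|].
    - apply (@ex_series_le R_AbsRing R_CompleteNormedModule) with (2 := Hex).
      intros n. unfold norm; simpl; unfold abs; simpl. rewrite Rabs_Rabsolu. apply Htail.
    - eapply Rle_trans; [apply Series_le with (2 := Hex)|].
      + intros n. split; [apply Rabs_pos|apply Htail].
      + rewrite Series_scal_r. right. unfold Rdiv. ring. }
  change (is_lim_seq (sum_n (fun j => Series (fun n => c n j) * y ^ j)) (Series u)).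
  apply is_lim_seq_spec. intros eps.
  assert (Hlim : is_lim_seq (fun J => Series U * / (1 - q) * q ^ S J) 0).
  { replace (Finite 0) with (Rbar_mult (Series U * / (1 - q)) 0) by (simpl; f_equal; ring).
    apply is_lim_seq_scal_l.
    apply (is_lim_seq_incr_1 (fun J => q ^ J)), is_lim_seq_geom. now rewrite Rabs_pos_eq. }
  apply is_lim_seq_spec in Hlim.
  destruct (Hlim eps) as [J0 HJ0]. exists J0. intros J HJ.
  rewrite Rabs_minus_sym. eapply Rle_lt_trans; [apply Hdiff|].
  specialize (HJ0 J HJ). rewrite Rminus_0_r in HJ0.
  eapply Rle_lt_trans; [apply Rle_abs|exact HJ0].
Qed.

Lemma real_analytic_at_plus (f g : R -> R) (x : R) :
  real_analytic_at f x -> real_analytic_at g x ->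
  real_analytic_at (fun y => f y + g y) x.
Proof.
  intros [r1 [a [Hr1 Ha]]] [r2 [b [Hr2 Hb]]].
  exists (Rmin r1 r2), (fun k => a k + b k). split; [now apply Rmin_glb_lt|].
  intros y Hy.
  apply is_series_ext with (fun k => plus (a k * y ^ k) (b k * y ^ k)).
  - intros k. unfold plus; simpl. ring.
  - apply (is_series_plus (fun k => a k * y ^ k) (fun k => b k * y ^ k)).
    + apply Ha. eapply Rlt_le_trans; [exact Hy|apply Rmin_l].
    + apply Hb. eapply Rlt_le_trans; [exact Hy|apply Rmin_r].
Qed.

Lemma real_analytic_at_scal (c : R) (f : R -> R) (x : R) :
  real_analytic_at f x -> real_analytic_at (fun y => c * f y) x.
Proof.
  intros [r [a [Hr Ha]]]. exists r, (fun k => c * a k). split; [assumption|].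
  intros y Hy. apply is_series_ext with (fun k => c * (a k * y ^ k)).
  - intros k. symmetry. apply Rmult_assoc.
  - apply (is_series_scal_l c (fun k => a k * y ^ k)). now apply Ha.
Qed.

Lemma is_series_shift (a : nat -> R) (y l : R) :
  is_series (fun k => a k * y ^ k) l ->
  is_series (fun k => match k with O => 0 | S k' => a k' end * y ^ k) (y * l).
Proof.
  intros H. apply is_series_decr_1.
  apply is_series_ext with (fun k => y * (a k * y ^ k)).
  - intros k. change (y * (a k * y ^ k) = a k * (y * y ^ k)). ring.
  - match goal with |- is_series _ ?v => replace v with (y * l) end.
    2: unfold plus, opp; simpl; ring.
    now apply (is_series_scal_l y (fun k => a k * y ^ k)).
Qed.

(** Serves the factor s - 1 in front of the zeta function; the new factor is expanded about x as x +
    y. *)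
Lemma real_analytic_at_mult_id (f : R -> R) (x : R) :
  real_analytic_at f x -> real_analytic_at (fun y => y * f y) x.
Proof.
  intros [r [a [Hr Ha]]].
  exists r, (fun k => x * a k + match k with O => 0 | S k' => a k' end).
  split; [assumption|]. intros y Hy.
  apply is_series_ext with
    (fun k => plus (x * (a k * y ^ k)) (match k with O => 0 | S k' => a k' end * y ^ k)).
  - intros k. unfold plus; simpl. ring.
  - replace ((x + y) * f (x + y)) with (plus (x * f (x + y)) (y * f (x + y)))
      by (unfold plus; simpl; ring).
    apply (is_series_plus (fun k => x * (a k * y ^ k))).
    + apply (is_series_scal_l x (fun k => a k * y ^ k)). now apply Ha.
    + apply is_series_shift. now apply Ha.
Qed.

Lemma real_analytic_at_ext (f g : R -> R) (x : R) :
  (forall y, f y = g y) -> real_analytic_at f x -> real_analytic_at g x.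
Proof.
  intros E [r [a [Hr Ha]]]. exists r, a. split; [assumption|].
  intros y Hy. rewrite <- E. now apply Ha.
Qed.

Lemma is_series_Re_Im (u : nat -> C) (l : C) :
  is_series (K := C_AbsRing) (V := C_NormedModule) u l ->
  is_series (fun n => Re (u n)) (Re l) /\ is_series (fun n => Im (u n)) (Im l).
Proof.
  intros H.
  assert (Hs : forall N, Re (sum_n u N) = sum_n (fun n => Re (u n)) N /\
                         Im (sum_n u N) = sum_n (fun n => Im (u n)) N).
  { induction N as [|N [IH1 IH2]].
    - now rewrite !sum_O.
    - rewrite !sum_Sn, <- IH1, <- IH2. split; reflexivity. }
  destruct l as [l1 l2]. split.
  - apply filterlim_ext with (fun N => Re (sum_n u N)); [intros N; apply Hs|].
    apply filterlim_comp with (2 := @continuous_fst R_UniformSpace R_UniformSpace l1 l2). exact H.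
  - apply filterlim_ext with (fun N => Im (sum_n u N)); [intros N; apply Hs|].
    apply filterlim_comp with (2 := @continuous_snd R_UniformSpace R_UniformSpace l1 l2). exact H.
Qed.

(** Along a horizontal line z - z0 is real, and so are its powers; the two parts of f therefore have
    expansions with coefficients Re (a k) and Im (a k). *)
Lemma analytic_at_Re_Im (f : C -> C) (s t : R) :
  analytic_at f (s, t) ->
  real_analytic_at (fun y => Re (f (y, t))) s /\ real_analytic_at (fun y => Im (f (y, t))) s.
Proof.
  intros [r [a Ha]].
  assert (H : forall y, Rabs y < r ->
     is_series (fun k => Re (a k) * y ^ k) (Re (f ((s + y)%R, t))) /\
     is_series (fun k => Im (a k) * y ^ k) (Im (f ((s + y)%R, t)))).
  { intros y Hy.
    assert (E : Cminus ((s + y)%R, t) (s, t) = RtoC y).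
    { unfold Cminus, Cplus, Copp, RtoC; simpl. f_equal; ring. }
    specialize (Ha ((s + y)%R, t)). rewrite E, Cmod_R in Ha. specialize (Ha Hy).
    apply is_series_Re_Im in Ha.
    assert (Hp : forall k, @pow_n C_AbsRing (RtoC y) k = RtoC (y ^ k)).
    { induction k as [|k IH]; [reflexivity|].
      simpl. rewrite IH. unfold mult; simpl. now rewrite RtoC_mult. }
    destruct Ha as [H1 H2].
    split; [refine (is_series_ext _ _ _ _ H1) | refine (is_series_ext _ _ _ _ H2)];
      intros k; rewrite Hp; unfold scal; simpl; unfold mult; simpl; destruct (a k) as [p q];
      unfold Re, Im, Cmult, RtoC; simpl; ring. }
  split.
  - exists r, (fun k => Re (a k)). split; [apply cond_pos|]. intros y Hy. now apply H.
  - exists r, (fun k => Im (a k)). split; [apply cond_pos|]. intros y Hy. now apply H.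
Qed.

(** * Analytic continuation by Euler-Maclaurin summation *)

(* [Re (exp (- i b) w)] *)
Definition rotated_re (b : R) (w : C) : R := cos b * Re w + sin b * Im w.

(* [pow_wave t b sg x] is [rotated_re b (x ^ (1 - s))] for [s = sg + i t], and
   [dpow_wave], [ddpow_wave] are its first two derivatives in [x]. *)
Definition pow_wave (t b sg x : R) : R := Rpower x (1 - sg) * cos (t * ln x + b).

Definition dpow_wave (t b sg x : R) : R :=
  Rpower x (- sg) * ((1 - sg) * cos (t * ln x + b) - t * sin (t * ln x + b)).

Definition ddpow_wave (t b sg x : R) : R :=
  Rpower x (- sg - 1) *
  (- sg * ((1 - sg) * cos (t * ln x + b) - t * sin (t * ln x + b))
   - (1 - sg) * t * sin (t * ln x + b) - t * t * cos (t * ln x + b)).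

Lemma is_derive_Rpower_l (p x : R) :
  0 < x -> is_derive (fun y => Rpower y p) x (p * Rpower x (p - 1)).
Proof.
  intros Hx. unfold Rpower.
  evar_last; [auto_derive; [assumption|reflexivity]|].
  replace ((p - 1) * ln x) with (p * ln x + - ln x) by ring.
  rewrite exp_plus, exp_Ropp, exp_ln by assumption. ring.
Qed.

Lemma Rpower_pred (p x : R) : 0 < x -> Rpower x p = x * Rpower x (p - 1).
Proof.
  intros Hx. rewrite <- (Rpower_1 x) at 2 by assumption.
  rewrite <- Rpower_plus. f_equal. ring.
Qed.

Lemma is_derive_pow_wave (t b sg x : R) :
  0 < x -> is_derive (pow_wave t b sg) x (dpow_wave t b sg x).
Proof.
  intros Hx. unfold pow_wave, dpow_wave.
  evar_last.
  - apply (is_derive_mult (fun y => Rpower y (1 - sg)) (fun y => cos (t * ln y + b))).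
    + now apply is_derive_Rpower_l.
    + auto_derive; [assumption|reflexivity].
    + intros; apply Rmult_comm.
  - unfold plus, mult; simpl.
    rewrite (Rpower_pred (1 - sg)) by assumption.
    replace (1 - sg - 1) with (- sg) by ring. field. lra.
Qed.

Lemma is_derive_dpow_wave (t b sg x : R) :
  0 < x -> is_derive (dpow_wave t b sg) x (ddpow_wave t b sg x).
Proof.
  intros Hx. unfold dpow_wave, ddpow_wave.
  evar_last.
  - apply (is_derive_mult (fun y => Rpower y (- sg))
      (fun y => (1 - sg) * cos (t * ln y + b) - t * sin (t * ln y + b))).
    + now apply is_derive_Rpower_l.
    + auto_derive; [repeat split; assumption|reflexivity].
    + intros; apply Rmult_comm.
  - unfold plus, mult; simpl.
    rewrite (Rpower_pred (- sg)) by assumption. field. lra.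
Qed.

(** Coefficients of x ^ (- h) in powers of h; [dlog_coef] and [ddlog_coef] are their first and
    second derivatives in x. *)
Definition log_coef (j : nat) (x : R) : R := (- ln x) ^ j / INR (fact j).

Definition dlog_coef (j : nat) (x : R) : R :=
  match j with O => 0 | S j' => - log_coef j' x / x end.

Definition ddlog_coef (j : nat) (x : R) : R :=
  match j with O => 0 | S j' => log_coef j' x / (x * x) - dlog_coef j' x / x end.

Lemma is_derive_log_coef (j : nat) (x : R) :
  0 < x -> is_derive (log_coef j) x (dlog_coef j x).
Proof.
  intros Hx. destruct j as [|j].
  - unfold log_coef, dlog_coef. simpl. auto_derive; [exact I|ring].
  - unfold log_coef, dlog_coef.
    apply is_derive_ext with (fun y => (/ INR (fact (S j))) * (- ln y) ^ S j).
    { intros y. apply Rmult_comm. }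
    evar_last.
    + apply (is_derive_scal (fun y => (- ln y) ^ S j)).
      apply (is_derive_pow (fun y => - ln y) (S j)).
      auto_derive; [assumption|reflexivity].
    + simpl pred. unfold log_coef. rewrite fact_simpl, mult_INR.
      field.
      repeat split; first [apply INR_fact_neq_0 | apply not_0_INR; lia | lra].
Qed.

Lemma is_derive_dlog_coef (j : nat) (x : R) :
  0 < x -> is_derive (dlog_coef j) x (ddlog_coef j x).
Proof.
  intros Hx. destruct j as [|j].
  - unfold dlog_coef, ddlog_coef. auto_derive; [exact I|reflexivity].
  - unfold dlog_coef at 1. unfold ddlog_coef.
    evar_last.
    + apply (is_derive_div (fun y => - log_coef j y) (fun y => y)).
      * apply (is_derive_opp (log_coef j)). now apply is_derive_log_coef.
      * apply is_derive_id.
      * lra.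
    + unfold opp, one; simpl. field. lra.
Qed.

(** The left side is a single term of the exponential series of rho ln x, whose terms are all
    nonnegative for x >= 1. *)
Lemma log_coef_bound (j : nat) (x rho : R) :
  1 <= x -> 0 < rho -> Rabs (log_coef j x) * rho ^ j <= Rpower x rho.
Proof.
  intros Hx Hr. unfold log_coef.
  assert (Hl : 0 <= ln x) by (rewrite <- ln_1; apply ln_le; lra).
  pose proof (INR_fact_lt_0 j) as Hf.
  unfold Rdiv. rewrite Rabs_mult, <- RPow_abs, Rabs_Ropp, (Rabs_pos_eq (ln x)) by assumption.
  rewrite Rabs_pos_eq by now apply Rlt_le, Rinv_0_lt_compat.
  replace (ln x ^ j * / INR (fact j) * rho ^ j) with ((rho * ln x) ^ j * / INR (fact j))
    by (rewrite Rpow_mult_distr; ring).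
  unfold Rpower. set (y := rho * ln x).
  assert (Hy : 0 <= y) by (apply Rmult_le_pos; lra).
  pose proof (is_exp_Reals y) as He. apply is_pseries_R in He.
  assert (Hterm : forall k, 0 <= / INR (fact k) * y ^ k).
  { intros k. apply Rmult_le_pos; [apply Rlt_le, Rinv_0_lt_compat, INR_fact_lt_0|now apply pow_le]. }
  apply Rle_trans with (sum_n (fun k => / INR (fact k) * y ^ k) j).
  - destruct j as [|j].
    + rewrite sum_O. right. ring.
    + rewrite sum_Sn. unfold plus; simpl.
      assert (0 <= sum_n (fun k => / INR (fact k) * y ^ k) j).
      { rewrite sum_n_Reals. now apply cond_pos_sum. }
      simpl in *. lra.
  - apply (is_lim_seq_incr_compare (sum_n (fun k => / INR (fact k) * y ^ k)) (exp y)); [exact He|].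
    intros n. rewrite sum_Sn. unfold plus; simpl. specialize (Hterm (S n)). simpl in Hterm. lra.
Qed.

(** Differentiation lowers the index j by one, which leaves a spare factor rho <= 1. *)
Lemma dlog_coef_bound (j : nat) (x rho : R) :
  1 <= x -> 0 < rho <= 1 -> Rabs (dlog_coef j x) * rho ^ j <= Rpower x rho / x.
Proof.
  intros Hx Hr. destruct j as [|j]; unfold dlog_coef.
  - rewrite Rabs_R0, Rmult_0_l. apply Rdiv_le_0_compat; [apply Rlt_le, exp_pos|lra].
  - unfold Rdiv. rewrite Rabs_mult, Rabs_Ropp, (Rabs_pos_eq (/ x))
      by (apply Rlt_le, Rinv_0_lt_compat; lra).
    pose proof (log_coef_bound j x rho Hx ltac:(lra)).
    replace (Rabs (log_coef j x) * / x * rho ^ S j)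
      with (Rabs (log_coef j x) * rho ^ j * rho * / x) by (simpl; ring).
    apply Rmult_le_compat_r; [apply Rlt_le, Rinv_0_lt_compat; lra|].
    assert (0 <= Rabs (log_coef j x) * rho ^ j).
    { apply Rmult_le_pos; [apply Rabs_pos|apply pow_le; lra]. }
    nra.
Qed.

Lemma ddlog_coef_bound (j : nat) (x rho : R) :
  1 <= x -> 0 < rho <= 1 -> Rabs (ddlog_coef j x) * rho ^ j <= 2 * (Rpower x rho / (x * x)).
Proof.
  intros Hx Hr.
  assert (Hp : 0 < Rpower x rho) by apply exp_pos.
  assert (Hi : 0 < / x) by (apply Rinv_0_lt_compat; lra).
  destruct j as [|j]; unfold ddlog_coef.
  - rewrite Rabs_R0, Rmult_0_l. apply Rmult_le_pos; [lra|]. apply Rdiv_le_0_compat; [lra|nra].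
  - pose proof (log_coef_bound j x rho Hx ltac:(lra)) as H1.
    pose proof (dlog_coef_bound j x rho Hx Hr) as H2.
    assert (Hj : 0 <= rho ^ j) by (apply pow_le; lra).
    apply Rle_trans with
      ((Rabs (log_coef j x) * rho ^ j * (/ x * / x) + Rabs (dlog_coef j x) * rho ^ j * / x) * rho).
    + replace ((Rabs (log_coef j x) * rho ^ j * (/ x * / x) + Rabs (dlog_coef j x) * rho ^ j * / x) * rho)
        with ((Rabs (log_coef j x) * (/ x * / x) + Rabs (dlog_coef j x) * / x) * rho ^ S j)
        by (simpl; ring).
      apply Rmult_le_compat_r; [apply pow_le; lra|].
      eapply Rle_trans; [apply Rabs_triang|].
      rewrite Rabs_Ropp. unfold Rdiv. rewrite !Rabs_mult, Rinv_mult.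
      rewrite (Rabs_pos_eq (/ x * / x)) by nra. rewrite (Rabs_pos_eq (/ x)) by lra. lra.
    + unfold Rdiv in *. rewrite Rinv_mult.
      assert (0 <= Rabs (log_coef j x) * rho ^ j).
      { apply Rmult_le_pos; [apply Rabs_pos|assumption]. }
      assert (0 <= Rabs (dlog_coef j x) * rho ^ j).
      { apply Rmult_le_pos; [apply Rabs_pos|assumption]. }
      assert (Rabs (log_coef j x) * rho ^ j * (/ x * / x) <= Rpower x rho * (/ x * / x))
        by (apply Rmult_le_compat_r; nra).
      assert (Rabs (dlog_coef j x) * rho ^ j * / x <= Rpower x rho * / x * / x)
        by (apply Rmult_le_compat_r; nra).
      assert (0 <= Rpower x rho * (/ x * / x)) by nra.
      assert (0 <= Rabs (log_coef j x) * rho ^ j * (/ x * / x)) by (apply Rmult_le_pos; nra).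
      assert (0 <= Rabs (dlog_coef j x) * rho ^ j * / x) by (apply Rmult_le_pos; nra).
      nra.
Qed.

Ltac as_R := match goal with |- @eq _ ?a ?b => change (@eq R a b) end.

Lemma is_derive_continuity_pt (f : R -> R) (x l : R) : is_derive f x l -> continuity_pt f x.
Proof.
  intros H. apply continuity_pt_filterlim.
  apply (@ex_derive_continuous R_AbsRing R_NormedModule f). now exists l.
Qed.

Lemma Rpower_le_neg (e x y : R) : 0 < x <= y -> e <= 0 -> Rpower y e <= Rpower x e.
Proof.
  intros Hx He. unfold Rpower.
  assert (ln x <= ln y) by (apply ln_le; lra).
  destruct (Req_dec (e * ln y) (e * ln x)) as [->|Hn]; [lra|].
  left. apply exp_increasing. nra.
Qed.

(** The mean value theorem, applied to F and then to F1; the constant 1 in place of 1/2 is enough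
    for what follows. *)
Lemma taylor2_unit (F F1 F2 : R -> R) (x M : R) :
  (forall y, x <= y <= x + 1 -> is_derive F y (F1 y)) ->
  (forall y, x <= y <= x + 1 -> is_derive F1 y (F2 y)) ->
  (forall y, x <= y <= x + 1 -> Rabs (F2 y) <= M) ->
  Rabs (F (x + 1) - F x - F1 x) <= M.
Proof.
  intros H1 H2 HM.
  destruct (MVT_gen F x (x + 1) F1) as [c [Hc E]].
  - rewrite Rmin_left, Rmax_right by lra. intros y Hy. apply H1. lra.
  - rewrite Rmin_left, Rmax_right by lra. intros y Hy. eapply is_derive_continuity_pt, H1. lra.
  - rewrite Rmin_left, Rmax_right in Hc by lra.
    destruct (MVT_gen F1 x c F2) as [d [Hd E2]].
    + rewrite Rmin_left, Rmax_right by lra. intros y Hy. apply H2. lra.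
    + rewrite Rmin_left, Rmax_right by lra. intros y Hy. eapply is_derive_continuity_pt, H2. lra.
    + rewrite Rmin_left, Rmax_right in Hd by lra.
      replace (F (x + 1) - F x - F1 x) with (F2 d * (c - x)) by (rewrite E, <- E2; ring).
      rewrite Rabs_mult, (Rabs_pos_eq (c - x)) by lra.
      specialize (HM d ltac:(lra)). pose proof (Rabs_pos (F2 d)). nra.
Qed.

(** The mean value theorem for x ^ (-1/4) bounds each term by four times a telescoping difference.
    The exponent 5/4 is what remains of s0 + 1 >= 3/2 after an expansion in sg with radius 1/4. *)
Lemma ex_series_Rpower_5_4 : ex_series (fun n => Rpower (INR (S n)) (- (5 / 4))).
Proof.
  assert (Hb : forall n, sum_n (fun n => Rpower (INR (S n)) (- (5 / 4))) n
                <= 5 - 4 * Rpower (INR (S n)) (- (1 / 4))).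
  { induction n as [|n IH].
    - rewrite sum_O. change (INR 1) with 1. unfold Rpower. rewrite ln_1, !Rmult_0_r, exp_0. lra.
    - rewrite sum_Sn.
      change (sum_n (fun n => Rpower (INR (S n)) (- (5 / 4))) n + Rpower (INR (S (S n))) (- (5 / 4))
              <= 5 - 4 * Rpower (INR (S (S n))) (- (1 / 4))).
      assert (Hn : 0 < INR (S n)) by (apply lt_0_INR; lia).
      rewrite (S_INR (S n)) in *. set (x := INR (S n)) in *.
      destruct (MVT_gen (fun y => Rpower y (- (1 / 4))) x (x + 1)
                 (fun y => - (1 / 4) * Rpower y (- (1 / 4) - 1))) as [c [Hc E]].
      + rewrite Rmin_left, Rmax_right by lra. intros y Hy. apply is_derive_Rpower_l. lra.
      + rewrite Rmin_left, Rmax_right by lra. intros y Hy. eapply is_derive_continuity_pt, is_derive_Rpower_l. lra.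
      + rewrite Rmin_left, Rmax_right in Hc by lra.
        replace (- (1 / 4) - 1) with (- (5 / 4)) in E by lra.
        pose proof (Rpower_le_neg (- (5 / 4)) c (x + 1) ltac:(lra) ltac:(lra)). lra. }
  assert (Hf : ex_finite_lim_seq (sum_n (fun n => Rpower (INR (S n)) (- (5 / 4))))).
  { apply ex_finite_lim_seq_incr with 5.
    - intros n. rewrite sum_Sn.
      change (sum_n (fun n => Rpower (INR (S n)) (- (5 / 4))) n
        <= sum_n (fun n => Rpower (INR (S n)) (- (5 / 4))) n + Rpower (INR (S (S n))) (- (5 / 4))).
      assert (0 < Rpower (INR (S (S n))) (- (5 / 4))) by apply exp_pos. lra.
    - intros n. specialize (Hb n).
      assert (0 < Rpower (INR (S n)) (- (1 / 4))) by apply exp_pos. lra. }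
  destruct Hf as [l Hl]. exists l. exact Hl.
Qed.

Lemma Rabs_cos_sin_comb (p q x : R) : Rabs (p * cos x - q * sin x) <= Rabs p + Rabs q.
Proof.
  unfold Rminus. eapply Rle_trans; [apply Rabs_triang|].
  rewrite Rabs_Ropp, !Rabs_mult.
  pose proof (COS_bound x). pose proof (SIN_bound x).
  assert (Rabs (cos x) <= 1) by (apply Rabs_le; lra).
  assert (Rabs (sin x) <= 1) by (apply Rabs_le; lra).
  pose proof (Rabs_pos p). pose proof (Rabs_pos q). nra.
Qed.

Lemma pow_wave_bound (t b sg x : R) : Rabs (pow_wave t b sg x) <= Rpower x (1 - sg).
Proof.
  unfold pow_wave. assert (0 < Rpower x (1 - sg)) by apply exp_pos.
  rewrite Rabs_mult, Rabs_pos_eq by lra.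
  pose proof (COS_bound (t * ln x + b)).
  assert (Rabs (cos (t * ln x + b)) <= 1) by (apply Rabs_le; lra). nra.
Qed.

Lemma dpow_wave_bound (t b sg x : R) :
  Rabs (dpow_wave t b sg x) <= Rpower x (- sg) * (Rabs (1 - sg) + Rabs t).
Proof.
  unfold dpow_wave. assert (0 < Rpower x (- sg)) by apply exp_pos.
  rewrite Rabs_mult, Rabs_pos_eq by lra.
  apply Rmult_le_compat_l; [lra|]. apply Rabs_cos_sin_comb.
Qed.

Lemma ddpow_wave_bound (t b sg x : R) :
  Rabs (ddpow_wave t b sg x) <=
  Rpower x (- sg - 1) * (Rabs (- sg * (1 - sg) - t * t) + Rabs (- sg * t + (1 - sg) * t)).
Proof.
  unfold ddpow_wave. assert (0 < Rpower x (- sg - 1)) by apply exp_pos.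
  rewrite Rabs_mult, Rabs_pos_eq by lra.
  apply Rmult_le_compat_l; [lra|].
  match goal with |- Rabs ?a <= _ =>
    replace a with ((- sg * (1 - sg) - t * t) * cos (t * ln x + b)
                    - (- sg * t + (1 - sg) * t) * sin (t * ln x + b)) by ring end.
  apply Rabs_cos_sin_comb.
Qed.

(* The coefficients of the expansions of [pow_wave] and [dpow_wave] in powers of [sg - s0]. *)
Definition wave_coef (t b s0 : R) (j : nat) (x : R) : R := pow_wave t b s0 x * log_coef j x.

Definition dwave_coef (t b s0 : R) (j : nat) (x : R) : R :=
  dpow_wave t b s0 x * log_coef j x + pow_wave t b s0 x * dlog_coef j x.

Definition ddwave_coef (t b s0 : R) (j : nat) (x : R) : R :=
  (ddpow_wave t b s0 x * log_coef j x + dpow_wave t b s0 x * dlog_coef j x) +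
  (dpow_wave t b s0 x * dlog_coef j x + pow_wave t b s0 x * ddlog_coef j x).

Lemma is_derive_wave_coef (t b s0 : R) (j : nat) (x : R) :
  0 < x -> is_derive (wave_coef t b s0 j) x (dwave_coef t b s0 j x).
Proof.
  intros Hx. apply (is_derive_mult (pow_wave t b s0) (log_coef j)).
  - now apply is_derive_pow_wave.
  - now apply is_derive_log_coef.
  - intros; apply Rmult_comm.
Qed.

Lemma is_derive_dwave_coef (t b s0 : R) (j : nat) (x : R) :
  0 < x -> is_derive (dwave_coef t b s0 j) x (ddwave_coef t b s0 j x).
Proof.
  intros Hx. apply (is_derive_plus (fun x => dpow_wave t b s0 x * log_coef j x)).
  - apply (is_derive_mult (dpow_wave t b s0) (log_coef j)).
    + now apply is_derive_dpow_wave.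
    + now apply is_derive_log_coef.
    + intros; apply Rmult_comm.
  - apply (is_derive_mult (pow_wave t b s0) (dlog_coef j)).
    + now apply is_derive_pow_wave.
    + now apply is_derive_dlog_coef.
    + intros; apply Rmult_comm.
Qed.

(** M depends neither on j nor on rho: in each product of the Leibniz rule the orders in x add up to
    rho - s0 - 1, and the factor rho ^ j is spent on the logarithmic coefficient. *)
Lemma ddwave_coef_bound (t b s0 : R) : exists M, forall rho j x,
  0 < rho <= 1 -> 1 <= x ->
  Rabs (ddwave_coef t b s0 j x) * rho ^ j <= M * Rpower x (rho - s0 - 1).
Proof.
  set (A := Rabs (- s0 * (1 - s0) - t * t) + Rabs (- s0 * t + (1 - s0) * t)).
  set (B := Rabs (1 - s0) + Rabs t).
  exists (A + 2 * B + 2). intros rho j x Hr Hx.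
  pose proof (ddpow_wave_bound t b s0 x) as P2. fold A in P2.
  pose proof (dpow_wave_bound t b s0 x) as P1. fold B in P1.
  pose proof (pow_wave_bound t b s0 x) as P0.
  pose proof (log_coef_bound j x rho Hx ltac:(lra)) as L0.
  pose proof (dlog_coef_bound j x rho Hx Hr) as L1.
  pose proof (ddlog_coef_bound j x rho Hx Hr) as L2.
  assert (Hj : 0 <= rho ^ j) by (apply pow_le; lra).
  set (p := Rpower x (rho - s0 - 1)).
  assert (E2 : Rpower x (- s0 - 1) * Rpower x rho = p).
  { rewrite <- Rpower_plus. unfold p. f_equal. ring. }
  assert (Hxr : Rpower x rho / x = Rpower x (rho - 1)).
  { rewrite (Rpower_pred rho) by lra. field. lra. }
  assert (Hxr2 : Rpower x rho / (x * x) = Rpower x (rho - 1 - 1)).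
  { rewrite (Rpower_pred rho), (Rpower_pred (rho - 1)) by lra. field. lra. }
  rewrite Hxr in L1. rewrite Hxr2 in L2.
  assert (E1 : Rpower x (- s0) * Rpower x (rho - 1) = p).
  { rewrite <- Rpower_plus. unfold p. f_equal. ring. }
  assert (E0 : Rpower x (1 - s0) * Rpower x (rho - 1 - 1) = p).
  { rewrite <- Rpower_plus. unfold p. f_equal. ring. }
  assert (Hprod : forall u v l m, Rabs u <= l -> Rabs v * rho ^ j <= m ->
            Rabs (u * v) * rho ^ j <= l * m).
  { intros u v l m Hu Hv. rewrite Rabs_mult, Rmult_assoc.
    apply Rmult_le_compat; try assumption; [apply Rabs_pos|].
    apply Rmult_le_pos; [apply Rabs_pos|assumption]. }
  unfold ddwave_coef.
  pose proof (Hprod _ _ _ _ P2 L0) as Q2.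
  pose proof (Hprod _ _ _ _ P1 L1) as Q1.
  pose proof (Hprod _ _ _ _ P0 L2) as Q0.
  apply Rle_trans with
   ((Rabs (ddpow_wave t b s0 x * log_coef j x) * rho ^ j
     + Rabs (dpow_wave t b s0 x * dlog_coef j x) * rho ^ j)
    + (Rabs (dpow_wave t b s0 x * dlog_coef j x) * rho ^ j
     + Rabs (pow_wave t b s0 x * ddlog_coef j x) * rho ^ j)).
  - rewrite <- !Rmult_plus_distr_r. apply Rmult_le_compat_r; [assumption|].
    eapply Rle_trans; [apply Rabs_triang|]. apply Rplus_le_compat; apply Rabs_triang.
  - replace (Rpower x (- s0 - 1) * A * Rpower x rho) with (A * p) in Q2 by (rewrite <- E2; ring).
    replace (Rpower x (- s0) * B * Rpower x (rho - 1)) with (B * p) in Q1 by (rewrite <- E1; ring).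
    replace (Rpower x (1 - s0) * (2 * Rpower x (rho - 1 - 1))) with (2 * p) in Q0 by (rewrite <- E0; ring).
    lra.
Qed.

Lemma is_series_exp_log (x h : R) : is_series (fun j => log_coef j x * h ^ j) (exp (- (h * ln x))).
Proof.
  replace (- (h * ln x)) with (- ln x * h) by ring.
  pose proof (is_exp_Reals (- ln x * h)) as He. apply is_pseries_R in He.
  refine (is_series_ext _ _ _ _ He). intros j. unfold log_coef.
  rewrite Rpow_mult_distr. unfold Rdiv. simpl. ring.
Qed.

Lemma is_series_dlog (x h : R) :
  0 < x ->
  is_series (fun j => dlog_coef j x * h ^ j) (- (h / x) * exp (- (h * ln x))).
Proof.
  intros Hx. pose proof (is_series_scal_l (- / x) _ _ (is_series_exp_log x h)) as H.
  pose proof (is_series_shift (fun j => - / x * log_coef j x) h (- / x * exp (- (h * ln x)))) as S1.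
  refine (is_series_ext _ _ _ _ (eq_rect _ (fun l => is_series _ l) (S1 _) _ _)).
  - intros [|j]; [reflexivity|]. unfold dlog_coef. change (- / x * log_coef j x * h ^ S j = - log_coef j x / x * h ^ S j). field. lra.
  - refine (is_series_ext _ _ _ _ H). intros j. symmetry. apply Rmult_assoc.
  - as_R. field. lra.
Qed.

Lemma Rpower_shift (x p h : R) : Rpower x (p - h) = Rpower x p * exp (- (h * ln x)).
Proof. unfold Rpower. rewrite <- exp_plus. f_equal. ring. Qed.

Lemma is_series_wave_coef (t b s0 x h : R) :
  is_series (fun j => wave_coef t b s0 j x * h ^ j) (pow_wave t b (s0 + h) x).
Proof.
  pose proof (is_series_scal_l (pow_wave t b s0 x) _ _ (is_series_exp_log x h)) as H.
  refine (is_series_ext _ _ _ _ (eq_rect _ (fun l => is_series _ l) H _ _)).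
  - intros j. symmetry. apply Rmult_assoc.
  - unfold pow_wave. replace (1 - (s0 + h)) with (1 - s0 - h) by ring.
    rewrite (Rpower_shift x (1 - s0) h). unfold scal; simpl; unfold mult; simpl. ring.
Qed.

Lemma is_series_dwave_coef (t b s0 x h : R) :
  0 < x ->
  is_series (fun j => dwave_coef t b s0 j x * h ^ j) (dpow_wave t b (s0 + h) x).
Proof.
  intros Hx.
  pose proof (is_series_scal_l (dpow_wave t b s0 x) _ _ (is_series_exp_log x h)) as H1.
  pose proof (is_series_scal_l (pow_wave t b s0 x) _ _ (is_series_dlog x h Hx)) as H2.
  pose proof (is_series_plus _ _ _ _ H1 H2) as H.
  refine (is_series_ext _ _ _ _ (eq_rect _ (fun l => is_series _ l) H _ _)).
  - intros j. unfold dwave_coef, plus, scal; simpl; unfold mult; simpl. ring.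
  - unfold dpow_wave, pow_wave. replace (- (s0 + h)) with (- s0 - h) by ring.
    rewrite (Rpower_shift x (- s0) h). unfold plus, scal; simpl; unfold mult; simpl.
    rewrite (Rpower_pred (1 - s0)) by assumption.
    replace (1 - s0 - 1) with (- s0) by ring. field. lra.
Qed.

(** One step of first-order Euler-Maclaurin summation of x ^ (1 - s), whose derivative is (1 - s) x
    ^ (- s). The remainder has the size x ^ (- sg - 1) of a second derivative, summable for sg > 0.
    Where the Dirichlet series converges, telescoping turns [em_sum] into (s - 1) times that series,
    rotated by b. *)
Definition em_term (t b sg x : R) : R :=
  pow_wave t b sg (x + 1) - pow_wave t b sg x - dpow_wave t b sg x.

Definition em_sum (t b alpha sg : R) : R :=
  pow_wave t b sg (1 + alpha) + Series (fun n => em_term t b sg (INR (S n) + alpha)).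

Lemma INR_S_ge_1 (n : nat) : 1 <= INR (S n).
Proof. rewrite S_INR. pose proof (pos_INR n). lra. Qed.

(** Every coefficient in sg - s0 is itself a smooth function of x, so [taylor2_unit] applies to it
    and the coefficients of the n-th term inherit the decay of [ddwave_coef]. With s0 >= 1/2 and rho
    = 1/4 the exponent rho - s0 - 1 is at most - 5/4. *)
Lemma em_sum_analytic (t b alpha s0 : R) :
  0 <= alpha -> 1 / 2 <= s0 -> real_analytic_at (em_sum t b alpha) s0.
Proof.
  intros Ha Hs. apply real_analytic_at_plus.
  - exists 1, (fun j => wave_coef t b s0 j (1 + alpha)). split; [lra|].
    intros y _. apply is_series_wave_coef.
  - destruct (ddwave_coef_bound t b s0) as [M HM].
    assert (HM0 : 0 <= M).
    { specialize (HM 1 0%nat 1 ltac:(lra) ltac:(lra)). simpl pow in HM.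
      assert (H1 : Rpower 1 (1 - s0 - 1) = 1) by (unfold Rpower; now rewrite ln_1, Rmult_0_r, exp_0).
      rewrite H1 in HM. pose proof (Rabs_pos (ddwave_coef t b s0 0 1)). lra. }
    set (x := fun n => INR (S n) + alpha).
    set (c := fun n j => wave_coef t b s0 j (x n + 1) - wave_coef t b s0 j (x n) - dwave_coef t b s0 j (x n)).
    exists (1 / 4), (fun j => Series (fun n => c n j)). split; [lra|].
    intros y Hy.
    apply is_series_of_power_series with
      (U := fun n => M * Rpower (INR (S n)) (- (5 / 4))) (rho := 1 / 4).
    + lra.
    + assumption.
    + intros n. pose proof (INR_S_ge_1 n).
      assert (Hx : 0 < x n) by (unfold x; lra).
      refine (is_series_ext _ _ _ _ (is_series_minus _ _ _ _ (is_series_minus _ _ _ _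
        (is_series_wave_coef t b s0 (x n + 1) y) (is_series_wave_coef t b s0 (x n) y))
        (is_series_dwave_coef t b s0 (x n) y Hx))).
      intros j. unfold c, minus, plus, opp; simpl. ring.
    + intros n j. pose proof (INR_S_ge_1 n).
      assert (Hp : 0 < (1 / 4) ^ j) by (apply pow_lt; lra).
      apply (Rle_div_r _ _ _ Hp). unfold c.
      apply taylor2_unit with (ddwave_coef t b s0 j).
      * intros z Hz. apply is_derive_wave_coef. unfold x in Hz. lra.
      * intros z Hz. apply is_derive_dwave_coef. unfold x in Hz. lra.
      * intros z Hz. unfold x in Hz. apply (Rle_div_r _ _ _ Hp).
        eapply Rle_trans; [apply HM; lra|].
        apply Rmult_le_compat_l; [assumption|].
        apply Rle_trans with (Rpower (INR (S n)) (1 / 4 - s0 - 1)).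
        -- apply Rpower_le_neg; lra.
        -- apply Rle_Rpower; lra.
    + apply (ex_series_scal_l M (fun n => Rpower (INR (S n)) (- (5 / 4)))), ex_series_Rpower_5_4.
Qed.

Lemma rotated_re_mult (b x y : R) (w : C) :
  rotated_re b (Cmult (x, y) w) =
  cos b * (x * Re w - y * Im w) + sin b * (x * Im w + y * Re w).
Proof. reflexivity. Qed.

Lemma dpow_wave_cpow (t b sg x : R) :
  dpow_wave t b sg x = - rotated_re b (Cmult (sg - 1, t) (cpow_opp x (sg, t))).
Proof.
  rewrite rotated_re_mult. unfold dpow_wave, cpow_opp, Re, Im; simpl.
  rewrite cos_plus, sin_plus. ring.
Qed.

Lemma is_lim_seq_Rpower_neg (e c : R) :
  e < 0 -> 0 <= c -> is_lim_seq (fun n => Rpower (INR (S n) + c) e) 0.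
Proof.
  intros He Hc.
  assert (Hle : forall n, Rpower (INR (S n) + c) e <= Rpower (INR (S n)) e).
  { intros n. pose proof (INR_S_ge_1 n). apply Rpower_le_neg; lra. }
  apply is_lim_seq_le_le with (u := fun _ => 0) (w := fun n => Rpower (INR (S n)) e).
  - intros n. split; [apply Rlt_le, exp_pos|apply Hle].
  - apply is_lim_seq_const.
  - unfold Rpower.
    apply (is_lim_seq_incr_1 (fun n => exp (e * ln (INR n)))).
    apply (is_lim_comp_seq exp (fun n => e * ln (INR n)) m_infty 0).
    + apply is_lim_exp_m.
    + exists 0%nat. intros n _. discriminate.
    + replace m_infty with (Rbar_mult e p_infty).
      * apply is_lim_seq_scal_l.
        apply (is_lim_comp_seq ln INR p_infty p_infty).
        -- apply is_lim_ln_p.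
        -- exists 0%nat. intros n _. discriminate.
        -- apply is_lim_seq_INR.
      * simpl. case Rle_dec; intros H; [exfalso; lra|reflexivity].
Qed.

Lemma em_sum_correct (f : C -> C) (t b alpha sg : R) :
  0 <= alpha -> 1 < sg ->
  is_continuation_of_series (fun n s => cpow_opp (INR (S n) + alpha) s) f ->
  rotated_re b (Cmult (sg - 1, t) (f (sg, t))) = em_sum t b alpha sg.
Proof.
  intros Ha Hs [Hf _].
  specialize (Hf (sg, t) Hs). apply is_series_Re_Im in Hf. destruct Hf as [HR HI].
  set (x := fun n => INR (S n) + alpha) in *.
  assert (Hd : is_series (fun n => dpow_wave t b sg (x n))
                 (- rotated_re b (Cmult (sg - 1, t) (f (sg, t))))).
  { rewrite rotated_re_mult.
    pose proof (is_series_plus _ _ _ _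
      (is_series_scal_l (- (cos b * (sg - 1) + sin b * t)) _ _ HR)
      (is_series_scal_l (cos b * t - sin b * (sg - 1)) _ _ HI)) as H.
    refine (is_series_ext _ _ _ _ (eq_rect _ (fun l => is_series _ l) H _ _)).
    - intros n. rewrite dpow_wave_cpow, rotated_re_mult. unfold x.
      generalize (Re (cpow_opp (INR (S n) + alpha) (sg, t))) (Im (cpow_opp (INR (S n) + alpha) (sg, t))).
      intros p q. unfold plus, scal; simpl; unfold mult; simpl. ring.
    - generalize (Re (f (sg, t))) (Im (f (sg, t))). intros p q.
      unfold plus, scal; simpl; unfold mult; simpl. ring. }
  assert (Hsum : forall N, sum_n (fun n => em_term t b sg (x n)) N =
    pow_wave t b sg (INR (S N) + (alpha + 1)) - pow_wave t b sg (1 + alpha)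
    - sum_n (fun n => dpow_wave t b sg (x n)) N).
  { induction N as [|N IH].
    - rewrite !sum_O. unfold em_term, x. change (INR 1) with 1.
      replace (1 + alpha + 1) with (1 + (alpha + 1)) by ring. reflexivity.
    - rewrite !sum_Sn, IH. unfold plus; simpl AbelianMonoid.sort.
      as_R. unfold em_term, x.
      replace (INR (S (S N)) + alpha + 1) with (INR (S (S N)) + (alpha + 1)) by ring.
      replace (INR (S (S N)) + alpha) with (INR (S N) + (alpha + 1)) by (rewrite (S_INR (S N)); ring).
      change (plus ?a ?b) with (a + b). simpl. ring. }
  assert (Hlim : is_lim_seq (fun N => pow_wave t b sg (INR (S N) + (alpha + 1))) 0).
  { apply is_lim_seq_abs_0.
    apply is_lim_seq_le_le with (u := fun _ => 0) (w := fun N => Rpower (INR (S N) + (alpha + 1)) (1 - sg)).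
    - intros n. split; [apply Rabs_pos|apply pow_wave_bound].
    - apply is_lim_seq_const.
    - apply is_lim_seq_Rpower_neg; lra. }
  assert (Hem : is_series (fun n => em_term t b sg (x n))
     (0 - pow_wave t b sg (1 + alpha) - - rotated_re b (Cmult (sg - 1, t) (f (sg, t))))).
  { change (is_lim_seq (sum_n (fun n => em_term t b sg (x n)))
     (0 - pow_wave t b sg (1 + alpha) - - rotated_re b (Cmult (sg - 1, t) (f (sg, t))))).
    apply is_lim_seq_ext with (1 := fun N => eq_sym (Hsum N)).
    apply is_lim_seq_minus'; [apply is_lim_seq_minus'|].
    - exact Hlim.
    - apply is_lim_seq_const.
    - exact Hd. }
  unfold em_sum.
  rewrite (is_series_unique (fun n => em_term t b sg (INR (S n) + alpha)) _ Hem). ring.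
Qed.

(** Both sides are real-analytic in sg along the horizontal ray starting at 1/2 + i t and agree for
    sg > 1; t <> 0 keeps the ray away from s = 1. *)
Lemma em_sum_continuation (f : C -> C) (t b alpha : R) :
  0 <= alpha -> t <> 0 ->
  is_continuation_of_series (fun n s => cpow_opp (INR (S n) + alpha) s) f ->
  rotated_re b (Cmult (1 / 2 - 1, t) (f (1 / 2, t))) = em_sum t b alpha (1 / 2).
Proof.
  intros Ha Ht Hf.
  assert (H : rotated_re b (Cmult (1 / 2 - 1, t) (f (1 / 2, t))) - em_sum t b alpha (1 / 2) = 0); [|lra].
  apply (real_analytic_unique
    (fun sg => rotated_re b (Cmult (sg - 1, t) (f (sg, t))) - em_sum t b alpha sg) (1 / 2) 1); [lra| |].
  - intros sg Hsg. apply real_analytic_at_minus; [|now apply em_sum_analytic].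
    assert (Hne : ((sg, t) : C) <> RtoC 1) by (intros E; injection E; intros; contradiction).
    destruct (analytic_at_Re_Im f sg t (proj2 Hf _ Hne)) as [HR HI].
    apply real_analytic_at_ext with (fun y =>
      cos b * (y * Re (f (y, t))) + (- cos b + sin b * t) * Re (f (y, t)) +
      (sin b * (y * Im (f (y, t))) + (- sin b - cos b * t) * Im (f (y, t)))).
    + intros y. rewrite rotated_re_mult. ring.
    + apply real_analytic_at_plus; apply real_analytic_at_plus; apply real_analytic_at_scal;
        try assumption; now apply real_analytic_at_mult_id.
  - intros sg Hsg. rewrite (em_sum_correct f t b alpha) by assumption. ring.
Qed.

(** * Truncated sums on the critical line *)

Fixpoint psum (f : nat -> R) (n : nat) : R :=
  match n with O => 0 | S m => psum f m + f n end.

(** The constant 1/4 + t ^ 2 is |s (1 - s)| for s = 1/2 + i t; on this line the sine part of the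
    second derivative vanishes. *)
Lemma em_term_bound (t b x : R) :
  1 <= x -> Rabs (em_term t b (1 / 2) x) <= (1 / 4 + t * t) * Rpower x (- (3 / 2)).
Proof.
  intros Hx. apply taylor2_unit with (ddpow_wave t b (1 / 2)).
  - intros y Hy. apply is_derive_pow_wave. lra.
  - intros y Hy. apply is_derive_dpow_wave. lra.
  - intros y Hy. eapply Rle_trans; [apply ddpow_wave_bound|].
    replace (- (1 / 2) * (1 - 1 / 2) - t * t) with (- (1 / 4 + t * t)) by field.
    replace (- (1 / 2) * t + (1 - 1 / 2) * t) with 0 by field.
    rewrite Rabs_Ropp, Rabs_R0, Rabs_pos_eq, Rplus_0_r by nra.
    rewrite Rmult_comm. apply Rmult_le_compat_l; [nra|].
    replace (- (1 / 2) - 1) with (- (3 / 2)) by field. apply Rpower_le_neg; lra.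
Qed.

(** Integral comparison with x ^ (-1/2). As the term sits at the left end of [x, x + 1], the
    constant must exceed 2; sqrt (x + 1) <= 3/2 sqrt x makes 4 enough. *)
Lemma Rpower_3_2_telescope (x : R) :
  1 <= x -> Rpower x (- (3 / 2)) <= 4 * (/ sqrt x - / sqrt (x + 1)).
Proof.
  intros Hx.
  replace (- (3 / 2)) with (- (1 / 2) - 1) by field.
  assert (E : Rpower x (- (1 / 2) - 1) = / sqrt x / x).
  { rewrite <- Rpower_sqrt by lra. rewrite <- Rpower_Ropp.
    replace (- (/ 2)) with (- (1 / 2)) by field.
    rewrite (Rpower_pred (- (1 / 2)) x) by lra. field. lra. }
  rewrite E.
  assert (Hs : 0 < sqrt x) by (apply sqrt_lt_R0; lra).
  assert (Hs1 : 0 < sqrt (x + 1)) by (apply sqrt_lt_R0; lra).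
  pose proof (sqrt_sqrt x ltac:(lra)) as Q. pose proof (sqrt_sqrt (x + 1) ltac:(lra)) as Q1.
  set (u := sqrt x) in *. set (v := sqrt (x + 1)) in *.
  assert (Huv : u < v) by nra.
  assert (Hv2 : v <= 3 / 2 * u) by nra.
  replace (/ u - / v) with (/ (u * v * (u + v))).
  - rewrite <- Q. unfold Rdiv. rewrite <- Rinv_mult.
    rewrite <- (Rinv_inv 4). rewrite <- Rinv_mult.
    apply Rinv_le_contravar.
    + apply Rmult_lt_0_compat; [lra|]. apply Rmult_lt_0_compat; [|lra]. now apply Rmult_lt_0_compat.
    + assert (u * v * (u + v) <= u * (3 / 2 * u) * (u + 3 / 2 * u)).
      { apply Rmult_le_compat; [nra|lra|nra|lra]. }
      assert (0 < u * u * u) by (apply Rmult_lt_0_compat; nra). nra.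
  - replace (/ (u * v * (u + v))) with ((v - u) / (u * v * ((v + u) * (v - u)))) by (field; nra).
    replace ((v + u) * (v - u)) with 1 by nra. field. lra.
Qed.

(** The first N Euler-Maclaurin steps telescope into the truncated sum and the boundary value at N +
    1 + alpha. The remaining steps are summed with [Rpower_3_2_telescope], uniformly in alpha. *)
Lemma em_estimate (f : C -> C) (t b alpha : R) (N : nat) :
  0 <= alpha -> t <> 0 ->
  is_continuation_of_series (fun n s => cpow_opp (INR (S n) + alpha) s) f ->
  Rabs (rotated_re b (Cmult (1 / 2 - 1, t) (f (1 / 2, t)))
        + psum (fun n => dpow_wave t b (1 / 2) (INR n + alpha)) N
        - pow_wave t b (1 / 2) (INR N + 1 + alpha))
  <= 4 * (1 / 4 + t * t) / sqrt (INR N + 1).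
Proof.
  intros Ha Ht Hf. rewrite (em_sum_continuation f t b alpha) by assumption.
  unfold em_sum. set (u := fun n => em_term t b (1 / 2) (INR (S n) + alpha)).
  assert (Hu : forall n, Rabs (u n) <= (1 / 4 + t * t) * Rpower (INR (S n)) (- (3 / 2))).
  { intros n. pose proof (INR_S_ge_1 n). eapply Rle_trans; [apply em_term_bound; lra|].
    apply Rmult_le_compat_l; [nra|]. apply Rpower_le_neg; lra. }
  assert (Hex : ex_series u).
  { apply (@ex_series_le R_AbsRing R_CompleteNormedModule) with
      (fun n => (1 / 4 + t * t) * Rpower (INR (S n)) (- (5 / 4))).
    - intros n. eapply Rle_trans; [apply Hu|]. apply Rmult_le_compat_l; [nra|].
      apply Rle_Rpower; [apply INR_S_ge_1|lra].
    - apply (ex_series_scal_l (1 / 4 + t * t) (fun n => Rpower (INR (S n)) (- (5 / 4)))), ex_series_Rpower_5_4. }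
  assert (Hp : forall k, Rabs (psum (fun i => u (N + pred i)%nat) k) <=
     4 * (1 / 4 + t * t) * (/ sqrt (INR N + 1) - / sqrt (INR N + 1 + INR k))).
  { induction k as [|k IH].
    - simpl. rewrite Rabs_R0, Rplus_0_r. right. ring.
    - cbn [psum]. eapply Rle_trans; [apply Rabs_triang|].
      pose proof (Hu (N + k)%nat) as H1. rewrite S_INR, plus_INR in H1.
      pose proof (pos_INR N). pose proof (pos_INR k).
      pose proof (Rpower_3_2_telescope (INR N + INR k + 1) ltac:(lra)) as H2.
      replace (INR N + 1 + INR (S k)) with (INR N + INR k + 1 + 1) by (rewrite S_INR; ring).
      replace (INR N + 1 + INR k) with (INR N + INR k + 1) in IH by ring.
      simpl pred.
      assert ((1 / 4 + t * t) * Rpower (INR N + INR k + 1) (- (3 / 2)) <=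
        (1 / 4 + t * t) * (4 * (/ sqrt (INR N + INR k + 1) - / sqrt (INR N + INR k + 1 + 1))))
        by (apply Rmult_le_compat_l; [nra|assumption]).
      lra. }
  assert (Htail : Rabs (Series (fun k => u (N + k)%nat)) <= 4 * (1 / 4 + t * t) / sqrt (INR N + 1)).
  { assert (Hex2 : ex_series (fun k => u (N + k)%nat)) by now apply (ex_series_incr_n u N).
    apply Series_correct in Hex2.
    assert (Hps : forall k, sum_n (fun k => u (N + k)%nat) k = psum (fun i => u (N + pred i)%nat) (S k)).
    { induction k as [|k IH]; [rewrite sum_O; simpl; symmetry; apply Rplus_0_l|].
      rewrite sum_Sn, IH. reflexivity. }
    assert (Hlim : is_lim_seq (fun k => Rabs (sum_n (fun k => u (N + k)%nat) k))
              (Rabs (Series (fun k => u (N + k)%nat)))).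
    { apply (is_lim_seq_abs _ (Finite _)). exact Hex2. }
    apply (is_lim_seq_le (fun k => Rabs (sum_n (fun k => u (N + k)%nat) k)) (fun _ => 4 * (1 / 4 + t * t) / sqrt (INR N + 1))
       (Rabs (Series (fun k => u (N + k)%nat))) (4 * (1 / 4 + t * t) / sqrt (INR N + 1))).
    - intros k. rewrite Hps. eapply Rle_trans; [apply Hp|].
      unfold Rdiv. apply Rmult_le_compat_l; [nra|].
      assert (0 < / sqrt (INR N + 1 + INR (S k))).
      { apply Rinv_0_lt_compat, sqrt_lt_R0. pose proof (pos_INR N). pose proof (pos_INR (S k)). lra. }
      lra.
    - exact Hlim.
    - apply is_lim_seq_const. }
  assert (Hhead : Series u = psum (fun i => u (pred i)) N + Series (fun k => u (N + k)%nat)).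
  { destruct N as [|N]; [simpl; now rewrite Rplus_0_l|].
    rewrite (Series_incr_n u (S N)) by (assumption || lia). f_equal. simpl pred.
    rewrite <- sum_n_Reals. clear. induction N as [|N IH]; [rewrite sum_O; simpl; symmetry; apply Rplus_0_l|].
    rewrite sum_Sn, IH. reflexivity. }
  assert (Htel : pow_wave t b (1 / 2) (1 + alpha) + psum (fun i => u (pred i)) N
    + psum (fun n => dpow_wave t b (1 / 2) (INR n + alpha)) N = pow_wave t b (1 / 2) (INR N + 1 + alpha)).
  { clear. induction N as [|N IH].
    - simpl. rewrite !Rplus_0_r, Rplus_0_l. reflexivity.
    - cbn [psum]. simpl pred. unfold u at 2. unfold em_term.
      replace (INR (S N) + alpha + 1) with (INR (S N) + 1 + alpha) by ring.
      replace (INR N + 1 + alpha) with (INR (S N) + alpha) in IH by (rewrite S_INR; ring).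
      lra. }
  rewrite Hhead.
  match goal with |- Rabs ?a <= _ => replace a with (Series (fun k => u (N + k)%nat)) by lra end.
  exact Htail.
Qed.

(* [rotated_re b (x ^ (- s))] for [s = 1/2 + i t]. *)
Definition wave (t b x : R) : R := cos (t * ln x + b) / sqrt x.

(* The primitive of [- wave t b], i.e. [rotated_re b (x ^ (1 - s) / (s - 1))] for [s = 1/2 + i t]. *)
Definition em_rem (t b x : R) : R :=
  - (sqrt x * (1 / 2 * cos (t * ln x + b) + t * sin (t * ln x + b)) / (1 / 4 + t * t)).

Lemma is_derive_em_rem (t b x : R) : 0 < x -> is_derive (em_rem t b) x (- wave t b x).
Proof.
  intros Hx. unfold em_rem, wave.
  assert (Hs : 0 < sqrt x) by now apply sqrt_lt_R0.
  pose proof (sqrt_sqrt x ltac:(lra)) as Q.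
  assert (Ht : 1 / 4 + t * t <> 0) by nra.
  auto_derive; [repeat split; assumption|].
  set (c := cos (t * ln x + b)). set (d := sin (t * ln x + b)).
  set (u := sqrt x) in *. clearbody c d u. rewrite <- Q. field. lra.
Qed.

Lemma rotated_re_minus_PI2 (b : R) (w : C) :
  rotated_re (b - PI / 2) w = sin b * Re w - cos b * Im w.
Proof.
  unfold rotated_re. rewrite cos_minus, sin_minus, cos_PI2, sin_PI2. ring.
Qed.

(** Division by s - 1: its inverse is (- 1/2 - i t) / (1/4 + t ^ 2), and the factor i amounts to
    replacing b by b - PI / 2. So [em_estimate] for b and for b - PI / 2 are combined, up to sign,
    with weights 1/2 and t over 1/4 + t ^ 2. *)
Lemma half_line_estimate (f : C -> C) (t b alpha : R) (N : nat) :
  0 <= alpha -> 1 <= t ->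
  is_continuation_of_series (fun n s => cpow_opp (INR (S n) + alpha) s) f ->
  Rabs (rotated_re b (f (1 / 2, t)) - psum (fun n => wave t b (INR n + alpha)) N
        - em_rem t b (INR N + 1 + alpha)) <= 6 * t / sqrt (INR N + 1).
Proof.
  intros Ha Ht Hf.
  pose proof (em_estimate f t b alpha N Ha ltac:(lra) Hf) as H1.
  pose proof (em_estimate f t (b - PI / 2) alpha N Ha ltac:(lra) Hf) as H2.
  rewrite rotated_re_mult in H1.
  set (X1 := Rabs _) in H1. set (X2 := Rabs _) in H2.
  assert (Ht4 : 0 < 1 / 4 + t * t) by nra.
  set (D := 1 / 4 + t * t) in *.
  assert (Hps : psum (fun n => wave t b (INR n + alpha)) N =
    (1 / 2 * psum (fun n => dpow_wave t b (1 / 2) (INR n + alpha)) N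
     + t * psum (fun n => dpow_wave t (b - PI / 2) (1 / 2) (INR n + alpha)) N) / D).
  { unfold D in *. clear - Ht4 Ha. induction N as [|N IH]; [simpl; field; lra|].
    cbn [psum]. rewrite IH. set (x := INR (S N) + alpha).
    assert (Hx : 0 < x) by (unfold x; pose proof (INR_S_ge_1 N); lra).
    assert (E : wave t b x = (1 / 2 * dpow_wave t b (1 / 2) x + t * dpow_wave t (b - PI / 2) (1 / 2) x) / (1 / 4 + t * t)).
    { unfold wave, dpow_wave.
      replace (t * ln x + (b - PI / 2)) with (t * ln x + b - PI / 2) by ring.
      rewrite cos_minus, sin_minus, cos_PI2, sin_PI2.
      replace (- (1 / 2)) with (- / 2) by field. rewrite Rpower_Ropp, Rpower_sqrt by assumption.
      field. split; [apply Rgt_not_eq, sqrt_lt_R0; assumption|lra]. }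
    rewrite E. field. lra. }
  set (y := INR N + 1 + alpha) in *.
  assert (Hy : 0 < y) by (unfold y; pose proof (pos_INR N); lra).
  assert (Hrem : em_rem t b y = - (1 / 2 * pow_wave t b (1 / 2) y + t * pow_wave t (b - PI / 2) (1 / 2) y) / D).
  { unfold em_rem, pow_wave.
    replace (t * ln y + (b - PI / 2)) with (t * ln y + b - PI / 2) by ring.
    rewrite cos_minus, cos_PI2, sin_PI2.
    replace (1 - 1 / 2) with (/ 2) by field. rewrite Rpower_sqrt by assumption.
    fold D. field. lra. }
  assert (Hval : rotated_re b (f (1 / 2, t)) =
    - (1 / 2 * (cos b * ((1 / 2 - 1) * Re (f (1 / 2, t)) - t * Im (f (1 / 2, t)))
         + sin b * ((1 / 2 - 1) * Im (f (1 / 2, t)) + t * Re (f (1 / 2, t))))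
       + t * rotated_re (b - PI / 2) (Cmult (1 / 2 - 1, t) (f (1 / 2, t)))) / D).
  { rewrite rotated_re_minus_PI2. unfold rotated_re, D.
    generalize (f (1 / 2, t)). intros [p q]. unfold Cmult, Re, Im; simpl. field. nra. }
  rewrite Hps, Hrem, Hval.
  match goal with |- Rabs ?a <= _ => set (Y := a) end.
  match (eval unfold X1 in X1) with Rabs ?a => set (Y1 := a) in X1 end.
  match (eval unfold X2 in X2) with Rabs ?a => set (Y2 := a) in X2 end.
  assert (EY : Y = - (1 / 2 * Y1 + t * Y2) / D).
  { unfold Y, Y1, Y2. field. lra. }
  rewrite EY. unfold Rdiv. rewrite Rabs_mult, Rabs_Ropp, (Rabs_pos_eq (/ D)) by (apply Rlt_le, Rinv_0_lt_compat; lra).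
  assert (HN : 0 < / sqrt (INR N + 1)).
  { apply Rinv_0_lt_compat, sqrt_lt_R0. pose proof (pos_INR N). lra. }
  unfold Rdiv in H1, H2. set (v := / sqrt (INR N + 1)) in *.
  apply (Rle_div_l _ _ _ Ht4).
  apply Rle_trans with (1 / 2 * X1 + t * X2).
  - unfold X1, X2. eapply Rle_trans; [apply Rabs_triang|].
    rewrite (Rabs_mult _ Y1), (Rabs_mult t Y2), (Rabs_pos_eq (1 * / 2)), (Rabs_pos_eq t) by lra. lra.
  - assert (t * X2 <= t * (4 * D * v)) by (apply Rmult_le_compat_l; lra).
    assert (0 < D * v) by nra. nra.
Qed.

Lemma Rabs_cos_le_1 (x : R) : Rabs (cos x) <= 1.
Proof. apply Rabs_le. pose proof (COS_bound x). lra. Qed.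

Lemma Rabs_sin_le_1 (x : R) : Rabs (sin x) <= 1.
Proof. apply Rabs_le. pose proof (SIN_bound x). lra. Qed.

Lemma wave_bound (t b x : R) : 0 < x -> Rabs (wave t b x) <= / sqrt x.
Proof.
  intros Hx. unfold wave, Rdiv.
  assert (0 < / sqrt x) by now apply Rinv_0_lt_compat, sqrt_lt_R0.
  rewrite Rabs_mult, (Rabs_pos_eq (/ sqrt x)) by lra.
  pose proof (Rabs_cos_le_1 (t * ln x + b)). nra.
Qed.

Lemma em_rem_bound (t b x : R) : 1 <= t -> Rabs (em_rem t b x) <= 2 * sqrt x / t.
Proof.
  intros Ht. unfold em_rem. rewrite Rabs_Ropp.
  assert (Ht4 : 0 < 1 / 4 + t * t) by nra.
  pose proof (sqrt_pos x).
  unfold Rdiv at 1. rewrite Rabs_mult, (Rabs_pos_eq (/ _)) by (apply Rlt_le, Rinv_0_lt_compat; lra).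
  apply (Rle_div_l _ _ _ Ht4).
  rewrite Rabs_mult, (Rabs_pos_eq (sqrt x)) by assumption.
  replace (2 * sqrt x / t * (1 / 4 + t * t)) with (sqrt x * (2 * (1 / 4 + t * t) / t)) by (field; lra).
  apply Rmult_le_compat_l; [assumption|].
  apply Rle_trans with (1 / 2 + t).
  - eapply Rle_trans; [apply Rabs_triang|]. rewrite !Rabs_mult, (Rabs_pos_eq (1 / 2)), (Rabs_pos_eq t) by lra.
    pose proof (Rabs_cos_le_1 (t * ln x + b)). pose proof (Rabs_sin_le_1 (t * ln x + b)). nra.
  - apply Rle_div_r; [lra|]. nra.
Qed.

Lemma em_rem_increment (t b x a : R) :
  0 < x -> 0 <= a <= 1 -> Rabs (em_rem t b (x + a) - em_rem t b x) <= / sqrt x.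
Proof.
  intros Hx Ha.
  destruct (MVT_gen (em_rem t b) x (x + a) (fun y => - wave t b y)) as [c [Hc E]].
  - rewrite Rmin_left, Rmax_right by lra. intros y Hy. apply is_derive_em_rem. lra.
  - rewrite Rmin_left, Rmax_right by lra. intros y Hy. eapply is_derive_continuity_pt, is_derive_em_rem. lra.
  - rewrite Rmin_left, Rmax_right in Hc by lra. rewrite E.
    replace (x + a - x) with a by ring.
    rewrite Rabs_mult, Rabs_Ropp, (Rabs_pos_eq a) by lra.
    pose proof (wave_bound t b c ltac:(lra)).
    assert (/ sqrt c <= / sqrt x).
    { apply Rinv_le_contravar; [now apply sqrt_lt_R0|apply sqrt_le_1_alt; lra]. }
    pose proof (Rabs_pos (wave t b c)). nra.
Qed.

(** * Continuity in alpha *)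

Lemma continuous_psum (f : nat -> R -> R) (N : nat) (x : R) :
  (forall n, continuous (f (S n)) x) -> continuous (fun a => psum (fun n => f n a) N) x.
Proof.
  intros H. induction N as [|N IH]; [apply continuous_const|].
  apply (continuous_plus (fun a => psum (fun n => f n a) N) (f (S N))); [exact IH|apply H].
Qed.

Lemma continuous_wave (t b x : R) : 0 < x -> continuous (wave t b) x.
Proof.
  intros Hx. apply (@ex_derive_continuous R_AbsRing R_NormedModule).
  unfold wave. auto_derive. repeat split; try assumption.
  apply Rgt_not_eq. now apply sqrt_lt_R0.
Qed.

Lemma continuous_uniform_approx (F : R -> R) (x : R) :
  (forall eps, 0 < eps -> exists g, continuous g x /\ forall y, Rabs (F y - g y) <= eps) ->
  continuous F x.
Proof.
  intros H. apply filterlim_locally. intros eps.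
  destruct (H (eps / 4)) as [g [Hg Hd]]; [pose proof (cond_pos eps); lra|].
  assert (He : 0 < eps / 4) by (pose proof (cond_pos eps); lra).
  pose proof (proj1 (filterlim_locally g (g x)) Hg (mkposreal _ He)) as Hl.
  apply filter_imp with (2 := Hl). intros y Hy.
  unfold ball in *; simpl in *; unfold AbsRing_ball, abs, minus, plus, opp in *; simpl in *.
  pose proof (Hd y) as A1. pose proof (Hd x) as A2.
  apply Rabs_def2 in Hy. apply Rabs_le_between in A1. apply Rabs_le_between in A2.
  apply Rabs_def1; lra.
Qed.

(** A uniform limit of continuous truncations, since the error in [half_line_estimate] does not
    depend on alpha. [Rabs a] gives two-sided continuity at 0, to the left of which [zeta1] is
    unspecified. *)
Lemma continuous_half_line (zeta1 : C -> R -> C) (t b x : R) :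
  is_modified_hurwitz_zeta zeta1 -> 1 <= t ->
  continuous (fun a => rotated_re b (zeta1 (1 / 2, t) (Rabs a))) x.
Proof.
  intros Hz Ht. apply continuous_uniform_approx. intros eps He.
  (* N + 1 exceeds (6 t / eps) ^ 2, which makes the error 6 t / sqrt (N + 1) at most eps. *)
  destruct (nfloor_ex ((6 * t / eps) * (6 * t / eps))) as [N [_ HN]].
  { apply Rle_0_sqr. }
  exists (fun a => psum (fun n => wave t b (INR n + Rabs a)) N + em_rem t b (INR N + 1 + Rabs a)).
  split.
  - assert (Hc : forall c, continuous (fun a => c + Rabs a) x).
    { intros c. apply (continuous_plus (fun _ => c) Rabs); [apply continuous_const|apply continuous_Rabs]. }
    pose proof (Rabs_pos x).
    apply (continuous_plus (fun a => psum (fun n => wave t b (INR n + Rabs a)) N)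
              (fun a => em_rem t b (INR N + 1 + Rabs a))).
    + apply (continuous_psum (fun n a => wave t b (INR n + Rabs a))). intros n.
      apply (continuous_comp (fun a => INR (S n) + Rabs a) (wave t b)); [apply Hc|].
      apply continuous_wave. pose proof (INR_S_ge_1 n). lra.
    + apply (continuous_comp (fun a => INR N + 1 + Rabs a) (em_rem t b)); [apply Hc|].
      apply (@ex_derive_continuous R_AbsRing R_NormedModule). eexists. apply is_derive_em_rem.
      pose proof (pos_INR N). lra.
  - intros y.
    pose proof (half_line_estimate (fun s => zeta1 s (Rabs y)) t b (Rabs y) N (Rabs_pos y) Ht (Hz _ (Rabs_pos y))) as H.
    rewrite Rminus_plus_distr. eapply Rle_trans; [exact H|].
    assert (Hq : 6 * t / eps <= sqrt (INR N + 1)).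
    { rewrite <- (sqrt_square (6 * t / eps)) by (apply Rdiv_le_0_compat; lra).
      apply sqrt_le_1_alt. lra. }
    assert (0 < sqrt (INR N + 1)) by (apply sqrt_lt_R0; pose proof (pos_INR N); lra).
    apply Rle_div_l; [assumption|]. apply Rle_div_l in Hq; [|assumption]. lra.
Qed.

Lemma rotated_re_le_Cmod (b : R) (w : C) : Rabs (rotated_re b w) <= Cmod w.
Proof.
  unfold rotated_re, Cmod. destruct w as [p q]. unfold Re, Im; simpl.
  rewrite <- sqrt_Rsqr_abs. apply sqrt_le_1_alt. unfold Rsqr.
  pose proof (sin2_cos2 b) as E. unfold Rsqr in E.
  pose proof (Rle_0_sqr (sin b * p - cos b * q)) as Hs. unfold Rsqr in Hs.
  replace (p * (p * 1) + q * (q * 1)) with ((p * p + q * q) * (sin b * sin b + cos b * cos b))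
    by (rewrite E; ring).
  lra.
Qed.

Lemma Cmod_le_rotated_re (w : C) : Cmod w <= Rabs (rotated_re 0 w) + Rabs (rotated_re (PI / 2) w).
Proof.
  unfold rotated_re, Cmod. rewrite cos_0, sin_0, cos_PI2, sin_PI2.
  destruct w as [p q]. unfold Re, Im; simpl.
  replace (1 * p + 0 * q) with p by ring. replace (0 * p + 1 * q) with q by ring.
  pose proof (Rabs_pos p). pose proof (Rabs_pos q).
  rewrite <- (sqrt_square (Rabs p + Rabs q)) by lra.
  apply sqrt_le_1_alt.
  assert (p * p = Rabs p * Rabs p) by (rewrite <- Rabs_mult, Rabs_pos_eq; nra).
  assert (q * q = Rabs q * Rabs q) by (rewrite <- Rabs_mult, Rabs_pos_eq; nra).
  nra.
Qed.

Lemma continuous_Cmod_half_line (zeta1 : C -> R -> C) (t x : R) :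
  is_modified_hurwitz_zeta zeta1 -> 1 <= t ->
  continuous (fun a => Cmod (zeta1 (1 / 2, t) (Rabs a))) x.
Proof.
  intros Hz Ht.
  pose proof (continuous_half_line zeta1 t 0 x Hz Ht) as H0.
  pose proof (continuous_half_line zeta1 t (PI / 2) x Hz Ht) as H1.
  apply continuous_ext with (fun a => sqrt
    (rotated_re 0 (zeta1 (1 / 2, t) (Rabs a)) * rotated_re 0 (zeta1 (1 / 2, t) (Rabs a))
     + rotated_re (PI / 2) (zeta1 (1 / 2, t) (Rabs a)) * rotated_re (PI / 2) (zeta1 (1 / 2, t) (Rabs a)))).
  - intros a. unfold Cmod, rotated_re. rewrite cos_0, sin_0, cos_PI2, sin_PI2.
    unfold Re, Im. f_equal. ring.
  - apply (continuous_comp _ sqrt); [|apply continuous_sqrt].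
    apply (continuous_plus (fun a => _ * _) (fun a => _ * _)).
    + now apply (continuous_mult (fun a => rotated_re 0 (zeta1 (1 / 2, t) (Rabs a)))).
    + now apply (continuous_mult (fun a => rotated_re (PI / 2) (zeta1 (1 / 2, t) (Rabs a)))).
Qed.

(** * Oscillatory integrals *)

Ltac continuous_by_derive :=
  apply (@ex_derive_continuous R_AbsRing R_NormedModule); auto_derive.

Lemma ex_RInt_continuous_le (f : R -> R) (a b : R) :
  a <= b -> (forall x, a <= x <= b -> continuous f x) -> ex_RInt f a b.
Proof.
  intros Hab H. apply (@ex_RInt_continuous R_CompleteNormedModule).
  rewrite Rmin_left, Rmax_right by assumption. exact H.
Qed.

Lemma is_RInt_derive_le (f df : R -> R) (a b : R) :
  a <= b -> (forall x, a <= x <= b -> is_derive f x (df x)) ->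
  (forall x, a <= x <= b -> continuous df x) -> is_RInt df a b (f b - f a).
Proof.
  intros Hab H1 H2.
  apply (@is_RInt_derive R_CompleteNormedModule f df a b);
    rewrite Rmin_left, Rmax_right by assumption; assumption.
Qed.

Lemma RInt_ge_derive (F dF f : R -> R) (a b : R) :
  a <= b -> (forall x, a <= x <= b -> is_derive F x (dF x)) ->
  (forall x, a <= x <= b -> continuous dF x) ->
  (forall x, a <= x <= b -> continuous f x) ->
  (forall x, a <= x <= b -> dF x <= f x) -> F b - F a <= RInt f a b.
Proof.
  intros Hab H1 H2 H3 H4.
  rewrite <- (is_RInt_unique _ _ _ _ (is_RInt_derive_le F dF a b Hab H1 H2)).
  apply RInt_le; [assumption|now apply ex_RInt_continuous_le|now apply ex_RInt_continuous_le|].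
  intros x Hx. apply H4. lra.
Qed.

(** First derivative test: integrate by parts against the primitive sin th, with V dominating the
    variation of g. In the applications g is amplitude over phase derivative; V is g or - g when g
    is monotone, and a separate majorant otherwise. *)
Lemma oscillatory_bound (th dth g dg V dV : R -> R) (a b : R) :
  a <= b ->
  (forall x, a <= x <= b -> is_derive th x (dth x)) ->
  (forall x, a <= x <= b -> continuous dth x) ->
  (forall x, a <= x <= b -> is_derive g x (dg x)) ->
  (forall x, a <= x <= b -> continuous dg x) ->
  (forall x, a <= x <= b -> is_derive V x (dV x)) ->
  (forall x, a <= x <= b -> continuous dV x) ->
  (forall x, a <= x <= b -> Rabs (dg x) <= dV x) ->
  Rabs (RInt (fun x => g x * dth x * cos (th x)) a b) <= Rabs (g a) + Rabs (g b) + (V b - V a).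
Proof.
  intros Hab Dth Cdth Dg Cdg DV CdV Hle.
  assert (Cth : forall x, a <= x <= b -> continuous th x).
  { intros x Hx. apply (@ex_derive_continuous R_AbsRing R_NormedModule). eexists. now apply Dth. }
  assert (Cg : forall x, a <= x <= b -> continuous g x).
  { intros x Hx. apply (@ex_derive_continuous R_AbsRing R_NormedModule). eexists. now apply Dg. }
  assert (C1 : forall x, a <= x <= b -> continuous (fun x => g x * dth x * cos (th x)) x).
  { intros x Hx. apply (continuous_mult (fun x => g x * dth x)).
    - apply (continuous_mult g); auto.
    - apply (continuous_comp th cos); [auto|apply continuous_cos]. }
  assert (C2 : forall x, a <= x <= b -> continuous (fun x => dg x * sin (th x)) x).
  { intros x Hx. apply (continuous_mult dg); [auto|].
    apply (continuous_comp th sin); [auto|apply continuous_sin]. }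
  assert (H : is_RInt (fun x => dg x * sin (th x) + g x * dth x * cos (th x)) a b
    (g b * sin (th b) - g a * sin (th a))).
  { apply (is_RInt_derive_le (fun x => g x * sin (th x))
      (fun x => dg x * sin (th x) + g x * dth x * cos (th x))); [assumption| |].
    - intros x Hx. evar_last.
      + apply (is_derive_mult g (fun x => sin (th x))).
        * now apply Dg.
        * apply (is_derive_comp sin th); [apply is_derive_sin|now apply Dth].
        * intros; apply Rmult_comm.
      + unfold plus, scal, mult; simpl; unfold mult; simpl. ring.
    - intros x Hx. apply (continuous_plus (fun x => dg x * sin (th x))); auto. }
  assert (E : RInt (fun x => dg x * sin (th x)) a b + RInt (fun x => g x * dth x * cos (th x)) a b
    = g b * sin (th b) - g a * sin (th a)).
  { rewrite <- (is_RInt_unique _ _ _ _ H). symmetry.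
    apply (RInt_plus (fun x => dg x * sin (th x)) (fun x => g x * dth x * cos (th x)));
      now apply ex_RInt_continuous_le. }
  assert (HI : Rabs (RInt (fun x => dg x * sin (th x)) a b) <= V b - V a).
  { eapply Rle_trans; [apply abs_RInt_le; [assumption|now apply ex_RInt_continuous_le]|].
    rewrite <- (is_RInt_unique _ _ _ _ (is_RInt_derive_le V dV a b Hab DV CdV)).
    apply RInt_le; [assumption| |now apply ex_RInt_continuous_le|].
    - apply ex_RInt_continuous_le; [assumption|]. intros x Hx.
      apply (continuous_comp (fun x => dg x * sin (th x)) Rabs); [auto|apply continuous_Rabs].
    - intros x Hx. specialize (Hle x ltac:(lra)). rewrite Rabs_mult.
      pose proof (Rabs_sin_le_1 (th x)). pose proof (Rabs_pos (dg x)). nra. }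
  assert (Hs : forall u v, Rabs (u * sin v) <= Rabs u).
  { intros u v. rewrite Rabs_mult. pose proof (Rabs_sin_le_1 v). pose proof (Rabs_pos u). nra. }
  pose proof (Hs (g a) (th a)) as Sa. pose proof (Hs (g b) (th b)) as Sb.
  apply Rabs_le_between in HI. apply Rabs_le_between in Sa. apply Rabs_le_between in Sb.
  apply Rabs_le. lra.
Qed.

Lemma RInt_wave_bound (t b X : R) :
  0 < t -> 1 <= X -> Rabs (RInt (wave t b) 1 X) <= 2 * sqrt X / t.
Proof.
  intros Ht HX.
  rewrite (RInt_ext _ (fun x => (sqrt x / t) * (t / x) * cos (t * ln x + b))).
  - eapply Rle_trans; [apply (oscillatory_bound (fun x => t * ln x + b) (fun x => t / x)
       (fun x => sqrt x / t) (fun x => / (2 * sqrt x) / t) (fun x => sqrt x / t) (fun x => / (2 * sqrt x) / t)); try assumption|].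
    + intros x Hx. auto_derive; [lra|]. field. lra.
    + intros x Hx. continuous_by_derive. lra.
    + intros x Hx. auto_derive; [lra|]. unfold Rdiv. ring.
    + intros x Hx. assert (0 < sqrt x) by (apply sqrt_lt_R0; lra). continuous_by_derive. repeat split; lra.
    + intros x Hx. auto_derive; [lra|]. unfold Rdiv. ring.
    + intros x Hx. assert (0 < sqrt x) by (apply sqrt_lt_R0; lra). continuous_by_derive. repeat split; lra.
    + intros x Hx. assert (0 < sqrt x) by (apply sqrt_lt_R0; lra).
      rewrite Rabs_pos_eq; [lra|]. apply Rlt_le, Rdiv_lt_0_compat; [|lra]. apply Rinv_0_lt_compat. lra.
    + rewrite sqrt_1. assert (0 < / t) by now apply Rinv_0_lt_compat.
      pose proof (sqrt_pos X).
      unfold Rdiv. rewrite !Rabs_pos_eq by nra. right. ring.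
  - rewrite Rmin_left, Rmax_right by assumption. intros x Hx. as_R. unfold wave.
    assert (0 < sqrt x) by (apply sqrt_lt_R0; lra).
    pose proof (sqrt_sqrt x ltac:(lra)) as Q.
    set (u := sqrt x) in *. set (c := cos _). clearbody c u. rewrite <- Q. field. lra.
Qed.

(** The quotient sqrt x / (mu x + t) rises until mu x = t and then falls, with maximum 1 / (2 sqrt
    (mu t)). Its variation is dominated by an arctangent of total increase at most (PI / 2) / sqrt
    (mu t), so that the two end values and the variation fit into the constant 3. *)
Lemma RInt_nonstationary_bound (mu t b X : R) :
  0 < mu -> 0 < t -> 1 <= X ->
  Rabs (RInt (fun x => cos (mu * x + t * ln x + b) / sqrt x) 1 X) <= 3 / sqrt (mu * t).
Proof.
  intros Hmu Ht HX.
  assert (Hmt : 0 < mu * t) by now apply Rmult_lt_0_compat.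
  assert (Hs : 0 < sqrt (mu * t)) by now apply sqrt_lt_R0.
  pose proof (sqrt_sqrt (mu * t) ltac:(lra)) as Qs.
  set (s := sqrt (mu * t)) in *.
  assert (Hg : forall x, 1 <= x -> 0 <= sqrt x / (mu * x + t) <= / (2 * s)).
  { intros x Hx. assert (Hx0 : 0 < sqrt x) by (apply sqrt_lt_R0; lra).
    pose proof (sqrt_sqrt x ltac:(lra)) as Q. set (u := sqrt x) in *.
    assert (0 < mu * x) by nra.
    split; [apply Rlt_le, Rdiv_lt_0_compat; lra|].
    apply Rle_div_l; [lra|].
    replace (/ (2 * s) * (mu * x + t)) with ((mu * x + t) / (2 * s)) by (field; lra).
    apply Rle_div_r; [lra|]. rewrite <- Q.
    assert (Hm : 0 < sqrt mu) by now apply sqrt_lt_R0.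
    assert (Htt : 0 < sqrt t) by now apply sqrt_lt_R0.
    assert (Es : s = sqrt mu * sqrt t) by (unfold s; apply sqrt_mult; lra).
    pose proof (sqrt_sqrt mu ltac:(lra)) as Q1. pose proof (sqrt_sqrt t ltac:(lra)) as Q2.
    rewrite Es, <- Q1, <- Q2. rewrite sqrt_square, sqrt_square by lra.
    pose proof (Rle_0_sqr (sqrt mu * u - sqrt t)) as HH. unfold Rsqr in HH. nra. }
  rewrite (RInt_ext _ (fun x => (sqrt x / (mu * x + t)) * (mu + t / x) * cos (mu * x + t * ln x + b))).
  - eapply Rle_trans; [apply (oscillatory_bound (fun x => mu * x + t * ln x + b) (fun x => mu + t / x)
       (fun x => sqrt x / (mu * x + t)) (fun x => (t - mu * x) / (2 * sqrt x * (mu * x + t) * (mu * x + t)))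
       (fun x => atan (s / t * sqrt x) / s) (fun x => / (2 * sqrt x * (mu * x + t)))); try assumption|].
    + intros x Hx. auto_derive; [lra|]. field. lra.
    + intros x Hx. continuous_by_derive. lra.
    + intros x Hx. assert (Hx0 : 0 < sqrt x) by (apply sqrt_lt_R0; lra). assert (0 < mu * x) by nra.
      pose proof (sqrt_sqrt x ltac:(lra)) as Q.
      auto_derive; [split; [lra|split; [lra|exact I]]|].
      set (u := sqrt x) in *. clearbody u. rewrite <- Q in *. field. split; nra.
    + intros x Hx. assert (0 < sqrt x) by (apply sqrt_lt_R0; lra). assert (0 < mu * x) by nra.
      continuous_by_derive. repeat split; try lra.
      apply Rgt_not_eq. apply Rmult_lt_0_compat; [|lra]. apply Rmult_lt_0_compat; lra.
    + intros x Hx. assert (Hx0 : 0 < sqrt x) by (apply sqrt_lt_R0; lra). assert (0 < mu * x) by nra.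
      pose proof (sqrt_sqrt x ltac:(lra)) as Q.
      auto_derive; [lra|].
      set (u := sqrt x) in *. clearbody u. rewrite <- Q in *.
      replace mu with (s * s / t) by (rewrite Qs; field; lra). field.
      assert (0 < s * s * (u * u)) by (apply Rmult_lt_0_compat; nra).
      repeat split; nra.
    + intros x Hx. assert (0 < sqrt x) by (apply sqrt_lt_R0; lra). assert (0 < mu * x) by nra.
      continuous_by_derive. repeat split; try lra.
      apply Rgt_not_eq. apply Rmult_lt_0_compat; lra.
    + intros x Hx. assert (Hx0 : 0 < sqrt x) by (apply sqrt_lt_R0; lra). assert (0 < mu * x) by nra.
      assert (Hd : 0 < 2 * sqrt x * (mu * x + t)) by (apply Rmult_lt_0_compat; lra).
      replace ((t - mu * x) / (2 * sqrt x * (mu * x + t) * (mu * x + t)))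
        with (/ (2 * sqrt x * (mu * x + t)) * ((t - mu * x) / (mu * x + t))) by (field; lra).
      rewrite Rabs_mult, Rabs_pos_eq by now apply Rlt_le, Rinv_0_lt_compat.
      rewrite <- (Rmult_1_r (/ _)) at 2. apply Rmult_le_compat_l; [now apply Rlt_le, Rinv_0_lt_compat|].
      apply Rabs_le. split; [apply Rle_div_r; lra|apply Rle_div_l; lra].
    + pose proof (Hg 1 ltac:(lra)) as G1. pose proof (Hg X HX) as G2.
      rewrite !Rabs_pos_eq by lra.
      pose proof (atan_bound (s / t * sqrt X)). pose proof (atan_bound (s / t * sqrt 1)).
      assert (0 <= atan (s / t * sqrt 1)).
      { rewrite <- atan_0. apply Rlt_le, atan_increasing. rewrite sqrt_1, Rmult_1_r. apply Rdiv_lt_0_compat; lra. }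
      assert (Hi : 0 < / s) by now apply Rinv_0_lt_compat.
      replace (/ (2 * s)) with (/ 2 * / s) in * by (field; lra).
      unfold Rdiv. pose proof PI_4. unfold Rdiv in *.
      assert (atan (s * / t * sqrt X) * / s <= 2 * / s) by nra.
      assert (0 <= atan (s * / t * sqrt 1) * / s) by nra. lra.
  - rewrite Rmin_left, Rmax_right by assumption. intros x Hx. as_R.
    assert (0 < sqrt x) by (apply sqrt_lt_R0; lra). assert (0 < mu * x) by nra.
    pose proof (sqrt_sqrt x ltac:(lra)) as Q.
    set (u := sqrt x) in *. set (c := cos _). clearbody c u. rewrite <- Q in *. field. split; nra.
Qed.

(** * The integral with a stationary point *)

Definition stat_wave (t b y : R) : R := cos (2 * PI * y - t * ln y + b) / sqrt y.

(* The amplitude of [stat_wave] divided by the derivative of its phase. *)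
Definition stat_amp (t y : R) : R := sqrt y / (2 * PI * y - t).

Definition dstat_amp (t y : R) : R :=
  - ((2 * PI * y + t) / (2 * sqrt y * (2 * PI * y - t) * (2 * PI * y - t))).

Lemma is_derive_stat_amp (t y : R) :
  0 < y -> 2 * PI * y - t <> 0 -> is_derive (stat_amp t) y (dstat_amp t y).
Proof.
  intros Hy Hn. unfold stat_amp, dstat_amp.
  assert (Hx0 : 0 < sqrt y) by (apply sqrt_lt_R0; lra).
  pose proof (sqrt_sqrt y ltac:(lra)) as Q.
  auto_derive; [repeat split; assumption|].
  set (u := sqrt y) in *. clearbody u. rewrite <- Q in *. field. split; lra.
Qed.

Lemma continuous_dstat_amp (t y : R) :
  0 < y -> 2 * PI * y - t <> 0 -> continuous (dstat_amp t) y.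
Proof.
  intros Hy Hn. unfold dstat_amp. assert (0 < sqrt y) by (apply sqrt_lt_R0; lra).
  continuous_by_derive. repeat split; try lra.
  apply Rmult_integral_contrapositive_currified; [|assumption].
  apply Rmult_integral_contrapositive_currified; [lra|assumption].
Qed.

Lemma dstat_amp_neg (t y : R) :
  0 < t -> 0 < y -> 2 * PI * y - t <> 0 -> dstat_amp t y < 0.
Proof.
  intros Ht Hy Hn. unfold dstat_amp. apply Ropp_lt_gt_0_contravar.
  assert (0 < sqrt y) by (apply sqrt_lt_R0; lra). pose proof PI_RGT_0.
  assert (0 < (2 * PI * y - t) * (2 * PI * y - t)) by now apply Rsqr_pos_lt.
  apply Rdiv_lt_0_compat; [nra|]. rewrite Rmult_assoc. apply Rmult_lt_0_compat; lra.
Qed.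

Lemma continuous_stat_wave (t b y : R) : 0 < y -> continuous (stat_wave t b) y.
Proof.
  intros Hy. unfold stat_wave. assert (0 < sqrt y) by (apply sqrt_lt_R0; lra).
  continuous_by_derive. repeat split; lra.
Qed.

(** On either side of the stationary point t / (2 PI) the quotient [stat_amp] is decreasing, so its
    variation is the difference of its end values. *)
Lemma RInt_stat_wave_bound (t b a c : R) :
  0 < t -> 0 < a <= c -> (forall y, a <= y <= c -> 2 * PI * y - t <> 0) ->
  Rabs (RInt (stat_wave t b) a c) <=
    Rabs (stat_amp t a) + Rabs (stat_amp t c) + (stat_amp t a - stat_amp t c).
Proof.
  intros Ht Ha Hn.
  rewrite (RInt_ext _ (fun x => stat_amp t x * (2 * PI - t / x) * cos (2 * PI * x - t * ln x + b))).
  - eapply Rle_trans; [apply (oscillatory_bound (fun x => 2 * PI * x - t * ln x + b) (fun x => 2 * PI - t / x)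
       (stat_amp t) (dstat_amp t) (fun x => - stat_amp t x) (fun x => - dstat_amp t x))|].
    + lra.
    + intros x Hx. auto_derive; [lra|]. field. lra.
    + intros x Hx. continuous_by_derive. lra.
    + intros x Hx. apply is_derive_stat_amp; [lra|auto].
    + intros x Hx. apply continuous_dstat_amp; [lra|auto].
    + intros x Hx. apply (is_derive_opp (stat_amp t)). apply is_derive_stat_amp; [lra|auto].
    + intros x Hx. apply (continuous_opp (dstat_amp t)). apply continuous_dstat_amp; [lra|auto].
    + intros x Hx. rewrite Rabs_left; [lra|]. apply dstat_amp_neg; [lra|lra|auto].
    + lra.
  - rewrite Rmin_left, Rmax_right by lra. intros x Hx. as_R. unfold stat_wave, stat_amp.
    specialize (Hn x ltac:(lra)).
    assert (0 < sqrt x) by (apply sqrt_lt_R0; lra).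
    pose proof (sqrt_sqrt x ltac:(lra)) as Q.
    set (u := sqrt x) in *. set (c0 := cos _). clearbody c0 u. rewrite <- Q in *. field.
    repeat split; lra.
Qed.

Lemma Rdiv_le_of_le (a b c : R) : 0 < c -> a <= b * c -> a / c <= b.
Proof. intros Hc H. now apply Rle_div_l. Qed.

Lemma Rle_div_of_le (a b c : R) : 0 < c -> a * c <= b -> a <= b / c.
Proof. intros Hc H. now apply Rle_div_r. Qed.

Lemma ln_1p_bounds (r : R) : -1 < r -> 0 <= r - ln (1 + r) <= r * r / (1 + r).
Proof.
  intros Hr.
  assert (H : forall y, 0 < y -> ln y <= y - 1).
  { intros y Hy. pose proof (exp_ineq1_le (ln y)) as E. rewrite exp_ln in E by assumption. lra. }
  split.
  - specialize (H (1 + r) ltac:(lra)). lra.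
  - assert (Hi : 0 < / (1 + r)) by (apply Rinv_0_lt_compat; lra).
    specialize (H _ Hi). rewrite ln_Rinv in H by lra.
    replace (r * r / (1 + r)) with (r + (/ (1 + r) - 1)) by (field; lra). lra.
Qed.

Lemma ln_1p_lower (r : R) : 0 <= r -> r * r / 2 - r * r * r / 3 <= r - ln (1 + r).
Proof.
  intros Hr. destruct (Req_dec r 0) as [->|Hn].
  { rewrite Rplus_0_r, ln_1. lra. }
  destruct (MVT_gen (fun x => x - x * x / 2 + x * x * x / 3 - ln (1 + x)) 0 r
     (fun x => x * x * x / (1 + x))) as [c [Hc E]].
  - rewrite Rmin_left, Rmax_right by lra. intros x Hx. auto_derive; [lra|]. field. lra.
  - rewrite Rmin_left, Rmax_right by lra. intros x Hx.
    apply is_derive_continuity_pt with (x * x * x / (1 + x)). auto_derive; [lra|]. field. lra.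
  - rewrite Rmin_left, Rmax_right in Hc by lra.
    rewrite (Rplus_0_r 1), ln_1 in E.
    assert (0 <= c * c * c / (1 + c)).
    { apply Rdiv_le_0_compat; [|lra]. apply Rmult_le_pos; [nra|lra]. }
    assert (0 <= c * c * c / (1 + c) * (r - 0)) by (apply Rmult_le_pos; lra). lra.
Qed.

(* The phase [2 pi y - t ln y], normalised to vanish at its minimum [y = t / (2 pi)]. *)
Definition phase (t y : R) : R := 2 * PI * y - t * ln y - (t - t * ln (t / (2 * PI))).

Lemma phase_eq (t r : R) :
  0 < t -> -1 < r -> phase t (t / (2 * PI) * (1 + r)) = t * (r - ln (1 + r)).
Proof.
  intros Ht Hr. pose proof PI_RGT_0. unfold phase.
  rewrite ln_mult; [|apply Rdiv_lt_0_compat; lra|lra]. field. lra.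
Qed.

Lemma one_minus_cos_le (x : R) : 0 <= x -> 1 - cos x <= x.
Proof.
  intros Hx. replace x with (2 * (x / 2)) at 1 by field.
  rewrite cos_2a_sin.
  pose proof (SIN_bound (x / 2)).
  destruct (Req_dec x 0) as [->|Hn].
  - rewrite Rdiv_0_l, sin_0. lra.
  - pose proof (sin_lt_x (x / 2) ltac:(lra)).
    destruct (Rle_lt_dec 0 (sin (x / 2))); [nra|].
    assert (- (x / 2) < sin (x / 2)).
    { pose proof (sin_lt_x (x / 2) ltac:(lra)).
      destruct (Rle_lt_dec (x / 2) PI) as [Hpi|Hpi].
      - pose proof (sin_ge_0 (x / 2) ltac:(lra) Hpi). lra.
      - pose proof PI2_1. lra. }
    nra.
Qed.

(** The primitive of the sine is taken as 1 - cos: it is nonnegative, and small near the stationary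
    point, where [stat_amp] has its pole. As [stat_amp] decreases, the second term of the derivative
    is nonpositive; dropping it bounds the integral of the sine from below by boundary values. *)
Lemma is_derive_phase_primitive (t y : R) :
  0 < t -> 0 < y -> 2 * PI * y - t <> 0 ->
  is_derive (fun y => (1 - cos (phase t y)) * stat_amp t y) y
    (sin (phase t y) / sqrt y + (1 - cos (phase t y)) * dstat_amp t y).
Proof.
  intros Ht Hy Hn.
  assert (Hu : 0 < sqrt y) by (apply sqrt_lt_R0; lra).
  pose proof (sqrt_sqrt y ltac:(lra)) as Q.
  evar_last.
  - apply (is_derive_mult (fun y => 1 - cos (phase t y)) (stat_amp t)).
    + unfold phase. auto_derive; [assumption|reflexivity].
    + now apply is_derive_stat_amp.
    + intros; apply Rmult_comm.
  - unfold plus, mult; simpl. f_equal. fold (phase t y). unfold stat_amp.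
    replace (2 * PI * y + - (t * ln y) + - (t + - (t * ln (t * / (2 * PI))))) with (phase t y)
      by (unfold phase, Rdiv; ring).
    set (s := sin _). set (u := sqrt y) in *. clearbody s u. rewrite <- Q in *.
    field. split; lra.
Qed.

Lemma continuous_sin_phase (t y : R) : 0 < y -> continuous (fun y => sin (phase t y) / sqrt y) y.
Proof.
  intros Hy. unfold phase. assert (0 < sqrt y) by (apply sqrt_lt_R0; lra).
  continuous_by_derive. repeat split; lra.
Qed.

Lemma continuous_one_minus_cos_phase (t y : R) :
  0 < y -> continuous (fun y => 1 - cos (phase t y)) y.
Proof. intros Hy. unfold phase. continuous_by_derive. lra. Qed.

Lemma RInt_sin_phase_ge (t a c : R) :
  0 < t -> 0 < a <= c -> (forall y, a <= y <= c -> 2 * PI * y - t <> 0) ->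
  (1 - cos (phase t c)) * stat_amp t c - (1 - cos (phase t a)) * stat_amp t a
  <= RInt (fun y => sin (phase t y) / sqrt y) a c.
Proof.
  intros Ht Ha Hn.
  apply (RInt_ge_derive (fun y => (1 - cos (phase t y)) * stat_amp t y)
    (fun y => sin (phase t y) / sqrt y + (1 - cos (phase t y)) * dstat_amp t y)).
  - lra.
  - intros y Hy. apply is_derive_phase_primitive; [assumption|lra|auto].
  - intros y Hy. apply (continuous_plus (fun y => sin (phase t y) / sqrt y)).
    + apply continuous_sin_phase. lra.
    + apply (continuous_mult (fun y => 1 - cos (phase t y)) (dstat_amp t)).
      * apply continuous_one_minus_cos_phase. lra.
      * apply continuous_dstat_amp; [lra|auto].
  - intros y Hy. apply continuous_sin_phase. lra.
  - intros y Hy. pose proof (COS_bound (phase t y)).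
    pose proof (dstat_amp_neg t y Ht ltac:(lra) (Hn y Hy)). nra.
Qed.

(** Where cos <= 0 the factor 1 - cos is at least 1, so the term dropped in [RInt_sin_phase_ge] is
    worth at least the whole drop of [stat_amp]. This is the strictly positive gain behind the lower
    bound for |C|. *)
Lemma RInt_sin_phase_ge_middle (t a c : R) :
  0 < t -> 0 < a <= c -> (forall y, a <= y <= c -> 2 * PI * y - t <> 0) ->
  (forall y, a <= y <= c -> cos (phase t y) <= 0) ->
  (1 - cos (phase t c)) * stat_amp t c - (1 - cos (phase t a)) * stat_amp t a
  + (stat_amp t a - stat_amp t c)
  <= RInt (fun y => sin (phase t y) / sqrt y) a c.
Proof.
  intros Ht Ha Hn Hc.
  replace ((1 - cos (phase t c)) * stat_amp t c - (1 - cos (phase t a)) * stat_amp t a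
    + (stat_amp t a - stat_amp t c)) with
    (((1 - cos (phase t c)) * stat_amp t c - stat_amp t c)
     - ((1 - cos (phase t a)) * stat_amp t a - stat_amp t a)) by ring.
  apply (RInt_ge_derive (fun y => (1 - cos (phase t y)) * stat_amp t y - stat_amp t y)
    (fun y => sin (phase t y) / sqrt y + (1 - cos (phase t y)) * dstat_amp t y - dstat_amp t y)).
  - lra.
  - intros y Hy. apply (is_derive_minus (fun y => (1 - cos (phase t y)) * stat_amp t y) (stat_amp t)).
    + apply is_derive_phase_primitive; [assumption|lra|auto].
    + apply is_derive_stat_amp; [lra|auto].
  - intros y Hy.
    apply (continuous_minus (fun y => sin (phase t y) / sqrt y + (1 - cos (phase t y)) * dstat_amp t y) (dstat_amp t)).
    + apply (continuous_plus (fun y => sin (phase t y) / sqrt y)).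
      * apply continuous_sin_phase. lra.
      * apply (continuous_mult (fun y => 1 - cos (phase t y)) (dstat_amp t)).
        -- apply continuous_one_minus_cos_phase. lra.
        -- apply continuous_dstat_amp; [lra|auto].
    + apply continuous_dstat_amp; [lra|auto].
  - intros y Hy. apply continuous_sin_phase. lra.
  - intros y Hy. specialize (Hc y Hy).
    pose proof (dstat_amp_neg t y Ht ltac:(lra) (Hn y Hy)). nra.
Qed.

(** The chosen b turns the integrand into sin (phase) / sqrt y. The boundary terms of the pieces
    cancel at x1 and x2 and have a favourable sign at 1 and X; on [x0 - 1, x0 + 1] the phase is
    small and its sine nonnegative; the gain is made on [x1, x2]. *)
Lemma stat_integral_lower (t X : R) :
  10 ^ 9 <= t -> t <= X -> exists b, 1 / 60 <= RInt (stat_wave t b) 1 X.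
Proof.
  intros Ht HX. exists (- (t - t * ln (t / (2 * PI))) - PI / 2).
  rewrite (RInt_ext _ (fun y => sin (phase t y) / sqrt y)).
  2:{ intros y _. as_R. unfold stat_wave, phase.
      replace (2 * PI * y - t * ln y + (- (t - t * ln (t / (2 * PI))) - PI / 2))
        with (2 * PI * y - t * ln y - (t - t * ln (t / (2 * PI))) - PI / 2) by ring.
      rewrite cos_minus, cos_PI2, sin_PI2. unfold Rdiv. ring. }
  pose proof PI_4 as HP4. pose proof PI2_3_2 as HP3.
  assert (HP : 3 < PI) by lra.
  set (x0 := t / (2 * PI)).
  assert (Et : t = 2 * PI * x0) by (unfold x0; field; lra).
  assert (Hx0 : 10 ^ 8 <= x0) by (apply (Rle_div_r (10 ^ 8) t (2 * PI)); lra).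
  set (q := sqrt x0).
  assert (Hqq : q * q = x0) by (apply sqrt_sqrt; lra).
  assert (Hq : 10 ^ 4 <= q).
  { unfold q. rewrite <- (sqrt_square (10 ^ 4)) by lra. apply sqrt_le_1_alt. lra. }
  assert (Hpos : forall y, x0 < y -> 2 * PI * y - t <> 0) by (intros y Hy; rewrite Et; nra).
  assert (Hneg : forall y, y < x0 -> 2 * PI * y - t <> 0) by (intros y Hy; rewrite Et; nra).
  assert (Hph : forall y, x0 / 2 <= y ->
            0 <= phase t y <= t * ((y - x0) * (y - x0) / (x0 * y))).
  { intros y Hy.
    assert (Hr : -1 < (y - x0) / x0) by (apply Rlt_div_r; lra).
    pose proof (phase_eq t ((y - x0) / x0) ltac:(lra) Hr) as E. fold x0 in E.
    replace (x0 * (1 + (y - x0) / x0)) with y in E by (field; lra). rewrite E.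
    pose proof (ln_1p_bounds _ Hr) as B.
    replace ((y - x0) / x0 * ((y - x0) / x0) / (1 + (y - x0) / x0))
      with ((y - x0) * (y - x0) / (x0 * y)) in B by (field; lra).
    split; [apply Rmult_le_pos; lra|apply Rmult_le_compat_l; lra]. }
  assert (Hnear : forall y, x0 - 1 <= y <= x0 + 1 -> 0 <= phase t y <= 10 / x0).
  { intros y Hy. destruct (Hph y ltac:(lra)) as [H1 H2]. split; [assumption|].
    eapply Rle_trans; [exact H2|]. rewrite Et.
    replace (2 * PI * x0 * ((y - x0) * (y - x0) / (x0 * y))) with (2 * PI * ((y - x0) * (y - x0)) / y)
      by (field; lra).
    apply Rdiv_le_of_le; [lra|]. replace (10 / x0 * y) with (10 * y / x0) by (field; lra).
    apply Rle_div_of_le; [lra|].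
    assert ((y - x0) * (y - x0) <= 1) by nra.
    assert (2 * PI * ((y - x0) * (y - x0)) <= 8) by nra. nra. }
  assert (Hsmall : 10 / x0 <= 1 / 1000) by (apply Rdiv_le_of_le; lra).
  assert (Hq2 : / q <= 1 / 10 ^ 4) by (apply Rinv_le_contravar in Hq; lra).
  (* 1 - cos is at most 10 / x0 and |stat_amp| at most q = sqrt x0, so the loss is at most 10 /
     q. *)
  assert (Hloss : forall y, y = x0 - 1 \/ y = x0 + 1 ->
     Rabs ((1 - cos (phase t y)) * stat_amp t y) <= 1 / 1000).
  { intros y Hy. destruct (Hnear y ltac:(lra)) as [H1 H2].
    pose proof (one_minus_cos_le _ H1) as H3. pose proof (COS_bound (phase t y)).
    assert (Hamp : Rabs (stat_amp t y) <= q).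
    { unfold stat_amp, Rdiv. rewrite Rabs_mult, (Rabs_pos_eq (sqrt y)) by apply sqrt_pos.
      assert (Hsq : sqrt y <= 2 * q).
      { unfold q. replace 2 with (sqrt 4) by (replace 4 with (2 * 2) by ring; apply sqrt_square; lra).
        rewrite <- sqrt_mult by lra. apply sqrt_le_1_alt. lra. }
      assert (Hd : Rabs (/ (2 * PI * y - t)) <= / 2).
      { rewrite Rabs_inv. apply Rinv_le_contravar; [lra|].
        rewrite Et. destruct Hy as [-> | ->].
        - rewrite Rabs_left; nra.
        - rewrite Rabs_pos_eq; nra. }
      pose proof (Rabs_pos (/ (2 * PI * y - t))). pose proof (sqrt_pos y). nra. }
    rewrite Rabs_mult, Rabs_pos_eq by lra.
    apply Rle_trans with (10 / x0 * q).
    - apply Rmult_le_compat; [lra|apply Rabs_pos|lra|assumption].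
    - rewrite <- Hqq. replace (10 / (q * q) * q) with (10 * / q) by (field; lra). lra. }
  (* At x0 + v q the phase is close to PI v ^ 2. For 3/4 <= v <= 6/7 it lies between PI / 2 and 3 PI
     / 2: 9/16 exceeds 1/2 with room for the cubic correction, and even the crude upper bound 2 PI v
     ^ 2 gives 72/49 < 3/2. *)
  set (x1 := x0 + 3 / 4 * q). set (x2 := x0 + 6 / 7 * q).
  assert (Hx12 : x0 + 1 <= x1 <= x2) by (unfold x1, x2; lra).
  assert (Hx2X : x2 <= X).
  { apply Rle_trans with t; [|assumption]. rewrite Et. unfold x2.
    assert (q <= x0) by (rewrite <- Hqq; nra). nra. }
  assert (Hmid : forall y, x1 <= y <= x2 -> cos (phase t y) <= 0).
  { intros y Hy. unfold x1, x2 in Hy.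
    assert (Hex : exists r, y = x0 * (1 + r) /\ 3 / 4 <= r * q <= 6 / 7).
    { exists ((y - x0) / x0). split; [field; lra|].
      replace ((y - x0) / x0 * q) with ((y - x0) / q) by (rewrite <- Hqq; field; lra).
      split; [apply Rle_div_of_le; lra|apply Rdiv_le_of_le; lra]. }
    destruct Hex as [r [Ey Hr]].
    assert (Hr0 : 0 < r) by nra. assert (Hr1 : r <= 1 / 1000) by nra.
    rewrite Ey. unfold x0 at 1. rewrite phase_eq by lra.
    pose proof (ln_1p_lower r ltac:(lra)) as HL. pose proof (ln_1p_bounds r ltac:(lra)) as [_ HU].
    assert (HU2 : r - ln (1 + r) <= r * r).
    { eapply Rle_trans; [exact HU|]. apply Rdiv_le_of_le; nra. }
    assert (Hrq : 9 / 16 <= (r * q) * (r * q) <= 36 / 49) by nra.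
    apply cos_le_0.
    - apply Rle_trans with (t * (r * r / 2 - r * r * r / 3)); [|apply Rmult_le_compat_l; lra].
      rewrite Et, <- Hqq.
      replace (2 * PI * (q * q) * (r * r / 2 - r * r * r / 3))
        with (PI * ((r * q) * (r * q) * (1 - 2 / 3 * r))) by field.
      assert (1 / 2 <= (r * q) * (r * q) * (1 - 2 / 3 * r)).
      { apply Rle_trans with (9 / 16 * (1 - 2 / 3 * r)); [lra|]. apply Rmult_le_compat_r; lra. }
      assert (PI * (1 / 2) <= PI * ((r * q) * (r * q) * (1 - 2 / 3 * r)))
        by (apply Rmult_le_compat_l; lra). lra.
    - apply Rle_trans with (t * (r * r)); [apply Rmult_le_compat_l; lra|].
      rewrite Et, <- Hqq.
      replace (2 * PI * (q * q) * (r * r)) with (2 * PI * ((r * q) * (r * q))) by ring.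
      assert (2 * PI * ((r * q) * (r * q)) <= 2 * PI * (36 / 49))
        by (apply Rmult_le_compat_l; lra). lra. }
  (* [stat_amp] at x0 + v q is about 1 / (2 PI v), so the drop is about (2/3 - 7/12) / PI. After the
     two losses of 1/1000 the remainder of 1/50 is still above 1/60. *)
  assert (Hamp12 : 1 / 50 <= stat_amp t x1 - stat_amp t x2).
  { unfold stat_amp. rewrite Et. unfold x1, x2.
    replace (2 * PI * (x0 + 3 / 4 * q) - 2 * PI * x0) with (2 * PI * (3 / 4 * q)) by ring.
    replace (2 * PI * (x0 + 6 / 7 * q) - 2 * PI * x0) with (2 * PI * (6 / 7 * q)) by ring.
    assert (H1 : q <= sqrt (x0 + 3 / 4 * q)) by (unfold q; apply sqrt_le_1_alt; fold q; lra).
    assert (H2 : sqrt (x0 + 6 / 7 * q) <= 1001 / 1000 * q).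
    { rewrite <- (sqrt_square (1001 / 1000 * q)) by lra. apply sqrt_le_1_alt. rewrite <- Hqq. nra. }
    assert (Hd1 : q / (2 * PI * (3 / 4 * q)) <= sqrt (x0 + 3 / 4 * q) / (2 * PI * (3 / 4 * q))).
    { apply Rmult_le_compat_r; [apply Rlt_le, Rinv_0_lt_compat; nra|assumption]. }
    assert (Hd2 : sqrt (x0 + 6 / 7 * q) / (2 * PI * (6 / 7 * q)) <= 1001 / 1000 * q / (2 * PI * (6 / 7 * q))).
    { apply Rmult_le_compat_r; [apply Rlt_le, Rinv_0_lt_compat; nra|assumption]. }
    replace (q / (2 * PI * (3 / 4 * q))) with (2 / 3 * / PI) in Hd1 by (field; lra).
    replace (1001 / 1000 * q / (2 * PI * (6 / 7 * q))) with (7007 / 12000 * / PI) in Hd2 by (field; lra).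
    assert (/ 4 <= / PI) by (apply Rinv_le_contravar; lra). lra. }
  set (g := fun y => sin (phase t y) / sqrt y).
  assert (HexS : forall a c, 0 < a <= c -> ex_RInt g a c).
  { intros a c Hac. apply ex_RInt_continuous_le; [lra|]. intros y Hy. apply continuous_sin_phase. lra. }
  assert (Hch : forall a c d, 0 < a <= c -> c <= d -> RInt g a d = RInt g a c + RInt g c d).
  { intros a c d H1 H2. symmetry. apply (RInt_Chasles g); apply HexS; lra. }
  rewrite (Hch 1 (x0 - 1) X), (Hch (x0 - 1) (x0 + 1) X), (Hch (x0 + 1) x1 X), (Hch x1 x2 X) by lra.
  pose proof (RInt_sin_phase_ge t 1 (x0 - 1) ltac:(lra) ltac:(lra) ltac:(intros; apply Hneg; lra)) as I1.
  pose proof (RInt_sin_phase_ge t (x0 + 1) x1 ltac:(lra) ltac:(lra) ltac:(intros; apply Hpos; lra)) as I3.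
  pose proof (RInt_sin_phase_ge_middle t x1 x2 ltac:(lra) ltac:(lra) ltac:(intros; apply Hpos; lra) Hmid) as I4.
  pose proof (RInt_sin_phase_ge t x2 X ltac:(lra) ltac:(lra) ltac:(intros; apply Hpos; lra)) as I5.
  assert (I2 : 0 <= RInt g (x0 - 1) (x0 + 1)).
  { apply RInt_ge_0; [lra|apply HexS; lra|]. intros y Hy. unfold g.
    apply Rdiv_le_0_compat; [|apply sqrt_lt_R0; lra].
    destruct (Hnear y ltac:(lra)). apply sin_ge_0; lra. }
  fold g in I1, I3, I4, I5.
  pose proof (Hloss (x0 - 1) ltac:(now left)) as L1. apply Rabs_le_between in L1.
  pose proof (Hloss (x0 + 1) ltac:(now right)) as L2. apply Rabs_le_between in L2.
  assert (P1 : (1 - cos (phase t 1)) * stat_amp t 1 <= 0).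
  { pose proof (COS_bound (phase t 1)).
    assert (stat_amp t 1 <= 0); [|nra].
    unfold stat_amp. rewrite sqrt_1. apply Rlt_le. unfold Rdiv. rewrite Rmult_1_l.
    apply Rinv_lt_0_compat. nra. }
  assert (P2 : 0 <= (1 - cos (phase t X)) * stat_amp t X).
  { pose proof (COS_bound (phase t X)).
    assert (0 <= stat_amp t X); [|nra].
    unfold stat_amp. apply Rdiv_le_0_compat; [apply sqrt_pos|]. rewrite Et. nra. }
  lra.
Qed.

Lemma RInt_stat_wave_right (t b a c : R) :
  0 < t -> t <= a <= c -> Rabs (RInt (stat_wave t b) a c) <= / sqrt a.
Proof.
  intros Ht Ha. pose proof PI2_3_2 as HP.
  eapply Rle_trans; [apply RInt_stat_wave_bound; [assumption|lra|]|].
  - intros y Hy. apply Rgt_not_eq. nra.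
  - assert (Hs : 0 < sqrt a) by (apply sqrt_lt_R0; lra).
    pose proof (sqrt_sqrt a ltac:(lra)) as Q. pose proof (sqrt_pos c).
    assert (Hd : 2 * a <= 2 * PI * a - t) by nra.
    assert (0 <= stat_amp t c).
    { unfold stat_amp. apply Rdiv_le_0_compat; [assumption|nra]. }
    assert (H2 : 2 * stat_amp t a <= / sqrt a).
    { unfold stat_amp. replace (2 * (sqrt a / (2 * PI * a - t))) with (2 * sqrt a / (2 * PI * a - t)) by (field; lra).
      apply Rdiv_le_of_le; [lra|]. replace (/ sqrt a * (2 * PI * a - t)) with ((2 * PI * a - t) / sqrt a) by (field; lra).
      apply Rle_div_of_le; [assumption|]. nra. }
    assert (0 <= stat_amp t a).
    { unfold stat_amp. apply Rdiv_le_0_compat; [lra|lra]. }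
    rewrite !Rabs_pos_eq by assumption. lra.
Qed.

Lemma RInt_stat_wave_left (t b c : R) :
  1 <= c -> 10 * c <= t -> Rabs (RInt (stat_wave t b) 1 c) <= 10 * sqrt c / t.
Proof.
  intros Hc Ht. pose proof PI_4 as HP. pose proof PI_RGT_0.
  eapply Rle_trans; [apply RInt_stat_wave_bound; [lra|lra|]|].
  - intros y Hy. apply Rlt_not_eq. nra.
  - assert (Hs : 0 < sqrt c) by (apply sqrt_lt_R0; lra).
    (* From PI <= 4: 2 PI c <= 8 c <= 4 t / 5. *)
    assert (Hd : 2 * PI * c - t <= - (t / 5)) by nra.
    assert (H2 : - (2 * stat_amp t c) <= 10 * sqrt c / t).
    { unfold stat_amp. replace (- (2 * (sqrt c / (2 * PI * c - t)))) with (2 * sqrt c / (t - 2 * PI * c)) by (field; lra).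
      apply Rdiv_le_of_le; [lra|]. replace (10 * sqrt c / t * (t - 2 * PI * c)) with (10 * sqrt c * (t - 2 * PI * c) / t) by (field; lra).
      apply Rle_div_of_le; [lra|]. nra. }
    assert (Hneg : forall y, 1 <= y <= c -> stat_amp t y <= 0).
    { intros y Hy. unfold stat_amp.
      assert (0 < sqrt y) by (apply sqrt_lt_R0; lra).
      assert (/ (2 * PI * y - t) < 0) by (apply Rinv_lt_0_compat; nra).
      unfold Rdiv. nra. }
    rewrite !Rabs_left1 by (apply Hneg; lra). lra.
Qed.

(** The two integrals on the right are the real and imaginary parts of the constant C, truncated to
    [1, X]. *)
Lemma RInt_stat_wave_phase (t b X : R) :
  1 <= X -> RInt (stat_wave t b) 1 X =
  cos b * RInt (stat_wave t 0) 1 X - sin b * RInt (stat_wave t (- (PI / 2))) 1 X.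
Proof.
  intros HX.
  assert (Hex : forall b, ex_RInt (stat_wave t b) 1 X).
  { intros b'. apply ex_RInt_continuous_le; [assumption|]. intros y Hy. apply continuous_stat_wave. lra. }
  pose proof (RInt_minus (fun x => scal (cos b) (stat_wave t 0 x))
    (fun x => scal (sin b) (stat_wave t (- (PI / 2)) x)) 1 X
    (ex_RInt_scal (stat_wave t 0) 1 X (cos b) (Hex _))
    (ex_RInt_scal (stat_wave t (- (PI / 2))) 1 X (sin b) (Hex _))) as E.
  rewrite (RInt_scal (stat_wave t 0)), (RInt_scal (stat_wave t (- (PI / 2)))) in E by apply Hex.
  refine (eq_trans _ E). apply RInt_ext. intros y _.
  change (stat_wave t b y = cos b * stat_wave t 0 y - sin b * stat_wave t (- (PI / 2)) y).
  unfold stat_wave. rewrite Rplus_0_r, cos_plus.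
  replace (2 * PI * y - t * ln y + - (PI / 2)) with (2 * PI * y - t * ln y - PI / 2) by ring.
  rewrite (cos_minus (2 * PI * y - t * ln y) (PI / 2)), cos_PI2, sin_PI2. unfold Rdiv. ring.
Qed.

(** Product-to-sum formulas give the phases 2 PI m x + t ln x, never stationary, and 2 PI m x - t ln
    x. In the latter y = m x produces the factor m ^ (-1/2) and the shift t ln m, on the interval
    [m, m X]. Passing to [1, X] costs integrals over [1, m] and [X, m X], which 10 m <= t <= X keeps
    away from t / (2 PI). *)
Lemma wave_fourier_coef (t b X : R) (m : nat) :
  (1 <= m)%nat -> 10 * INR m <= t -> t * t <= X ->
  Rabs (RInt (fun x => wave t b x * (2 * cos (2 * PI * INR m * x))) 1 X
        - / sqrt (INR m) * RInt (stat_wave t (t * ln (INR m) - b)) 1 X)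
  <= 20 / sqrt (INR m * t).
Proof.
  intros Hm Ht HX. pose proof PI_RGT_0 as HP. pose proof PI2_3_2 as HP3.
  assert (Hm1 : 1 <= INR m) by (apply (le_INR 1); assumption).
  set (M := INR m) in *.
  assert (HX1 : t <= X) by nra.
  assert (Hsm : 0 < sqrt M) by (apply sqrt_lt_R0; lra).
  pose proof (sqrt_sqrt M ltac:(lra)) as Qm.
  assert (Hst : 0 < sqrt t) by (apply sqrt_lt_R0; lra).
  pose proof (sqrt_sqrt t ltac:(lra)) as Qt.
  set (f1 := fun x => cos (2 * PI * M * x + t * ln x + b) / sqrt x).
  set (f2 := fun x => cos (2 * PI * M * x - t * ln x - b) / sqrt x).
  assert (Hex1 : ex_RInt f1 1 X).
  { apply ex_RInt_continuous_le; [lra|]. intros y Hy. unfold f1.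
    assert (0 < sqrt y) by (apply sqrt_lt_R0; lra). continuous_by_derive. repeat split; lra. }
  assert (Hex2 : ex_RInt f2 1 X).
  { apply ex_RInt_continuous_le; [lra|]. intros y Hy. unfold f2.
    assert (0 < sqrt y) by (apply sqrt_lt_R0; lra). continuous_by_derive. repeat split; lra. }
  assert (E : RInt (fun x => wave t b x * (2 * cos (2 * PI * M * x))) 1 X = RInt f1 1 X + RInt f2 1 X).
  { refine (eq_trans _ (RInt_plus f1 f2 1 X Hex1 Hex2)). apply RInt_ext. intros x _.
    change (wave t b x * (2 * cos (2 * PI * M * x)) = f1 x + f2 x). unfold wave, f1, f2.
    replace (2 * PI * M * x + t * ln x + b) with (2 * PI * M * x + (t * ln x + b)) by ring.
    replace (2 * PI * M * x - t * ln x - b) with (2 * PI * M * x - (t * ln x + b)) by ring.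
    rewrite (cos_plus (2 * PI * M * x)), (cos_minus (2 * PI * M * x)). unfold Rdiv. ring. }
  assert (B1 : Rabs (RInt f1 1 X) <= 3 / sqrt (M * t)).
  { eapply Rle_trans; [apply RInt_nonstationary_bound; nra|].
    unfold Rdiv. apply Rmult_le_compat_l; [lra|]. apply Rinv_le_contravar; [apply sqrt_lt_R0; nra|].
    apply sqrt_le_1_alt. assert (0 < M * t) by nra. nra. }
  set (bm := t * ln M - b).
  assert (Esub : RInt f2 1 X = / sqrt M * RInt (stat_wave t bm) M (M * X)).
  { pose proof (RInt_comp_lin (stat_wave t bm) M 0 1 X) as HC.
    rewrite !Rplus_0_r, Rmult_1_r in HC. rewrite <- HC.
    - refine (eq_trans _ (RInt_scal (fun y => scal M (stat_wave t bm (M * y + 0))) 1 X (/ sqrt M) _)).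
      + apply RInt_ext. rewrite Rmin_left, Rmax_right by lra. intros x Hx.
        change (f2 x = / sqrt M * (M * stat_wave t bm (M * x + 0))). rewrite Rplus_0_r.
        unfold f2, stat_wave, bm. rewrite ln_mult, sqrt_mult by lra.
        replace (2 * PI * (M * x) - t * (ln M + ln x) + (t * ln M - b)) with (2 * PI * M * x - t * ln x - b) by ring.
        set (c := cos _). clearbody c. rewrite <- Qm at 2. field.
        split; [apply Rgt_not_eq, sqrt_lt_R0; lra|lra].
      + apply ex_RInt_continuous_le; [lra|]. intros y Hy.
        apply (continuous_scal_r M (fun y => stat_wave t bm (M * y + 0))).
        apply (continuous_comp (fun y => M * y + 0) (stat_wave t bm)).
        * continuous_by_derive. exact I.
        * apply continuous_stat_wave. nra.
    - apply ex_RInt_continuous_le; [nra|]. intros y Hy. apply continuous_stat_wave. lra. }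
  assert (Hexs : forall a c, 0 < a <= c -> ex_RInt (stat_wave t bm) a c).
  { intros a c Hac. apply ex_RInt_continuous_le; [lra|]. intros y Hy. apply continuous_stat_wave. lra. }
  assert (Ech : RInt (stat_wave t bm) M (M * X) =
    RInt (stat_wave t bm) 1 X + RInt (stat_wave t bm) X (M * X) - RInt (stat_wave t bm) 1 M).
  { pose proof (RInt_Chasles (stat_wave t bm) 1 M (M * X) ltac:(apply Hexs; lra) ltac:(apply Hexs; nra)) as C1.
    pose proof (RInt_Chasles (stat_wave t bm) 1 X (M * X) ltac:(apply Hexs; lra) ltac:(apply Hexs; nra)) as C2.
    unfold plus in C1, C2; simpl in C1, C2. lra. }
  pose proof (RInt_stat_wave_left t bm M Hm1 ltac:(lra)) as B2.
  pose proof (RInt_stat_wave_right t bm X (M * X) ltac:(lra) ltac:(nra)) as B3.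
  rewrite E, Esub, Ech.
  set (I1 := RInt f1 1 X) in *. set (I2 := RInt (stat_wave t bm) 1 M) in *.
  set (I3 := RInt (stat_wave t bm) X (M * X)) in *. set (J := RInt (stat_wave t bm) 1 X).
  replace (I1 + / sqrt M * (J + I3 - I2) - / sqrt M * J) with (I1 + / sqrt M * I3 - / sqrt M * I2) by ring.
  assert (Him : 0 < / sqrt M) by now apply Rinv_0_lt_compat.
  rewrite sqrt_mult in * by lra.
  set (e := / (sqrt M * sqrt t)).
  assert (He : 0 < e) by (apply Rinv_0_lt_compat, Rmult_lt_0_compat; assumption).
  assert (Hmt : sqrt M <= sqrt t) by (apply sqrt_le_1_alt; lra).
  assert (A2 : Rabs (/ sqrt M * I2) <= 10 * e).
  { rewrite Rabs_mult, Rabs_pos_eq by lra.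
    apply Rle_trans with (/ sqrt M * (10 * sqrt M / t)); [apply Rmult_le_compat_l; lra|].
    replace (/ sqrt M * (10 * sqrt M / t)) with (10 * / t) by (field; lra).
    apply Rmult_le_compat_l; [lra|]. apply Rinv_le_contravar; [now apply Rmult_lt_0_compat|nra]. }
  assert (A3 : Rabs (/ sqrt M * I3) <= e).
  { rewrite Rabs_mult, Rabs_pos_eq by lra. unfold e. rewrite Rinv_mult.
    apply Rmult_le_compat_l; [lra|]. eapply Rle_trans; [exact B3|].
    apply Rinv_le_contravar; [assumption|]. apply sqrt_le_1_alt. assumption. }
  unfold Rdiv in B1 |- *. fold e in B1 |- *.
  apply Rabs_le_between in B1. apply Rabs_le_between in A2. apply Rabs_le_between in A3.
  apply Rabs_le. lra.
Qed.

(** * Fejer kernels *)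

Lemma psum_ext (f g : nat -> R) (N : nat) :
  (forall n, (1 <= n <= N)%nat -> f n = g n) -> psum f N = psum g N.
Proof.
  induction N as [|N IH]; intros H; [reflexivity|].
  cbn [psum]. rewrite IH by (intros; apply H; lia). now rewrite H by lia.
Qed.

Lemma psum_plus (f g : nat -> R) (N : nat) :
  psum (fun n => f n + g n) N = psum f N + psum g N.
Proof. induction N as [|N IH]; cbn [psum]; [ring|rewrite IH; ring]. Qed.

Lemma psum_scal (c : R) (f : nat -> R) (N : nat) : psum (fun n => c * f n) N = c * psum f N.
Proof. induction N as [|N IH]; cbn [psum]; [ring|rewrite IH; ring]. Qed.

Lemma psum_Rabs_le (f g : nat -> R) (N : nat) :
  (forall n, (1 <= n <= N)%nat -> Rabs (f n) <= g n) -> Rabs (psum f N) <= psum g N.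
Proof.
  induction N as [|N IH]; intros H; cbn [psum].
  - rewrite Rabs_R0. lra.
  - eapply Rle_trans; [apply Rabs_triang|]. apply Rplus_le_compat; [apply IH; intros; apply H; lia|apply H; lia].
Qed.

Lemma RInt_psum (f : nat -> R -> R) (a b : R) (N : nat) :
  (forall n, ex_RInt (f (S n)) a b) ->
  ex_RInt (fun x => psum (fun n => f n x) N) a b /\
  RInt (fun x => psum (fun n => f n x) N) a b = psum (fun n => RInt (f n) a b) N.
Proof.
  intros H. induction N as [|N [IH1 IH2]].
  - cbn [psum]. split; [exact (ex_RInt_const a b 0)|].
    refine (eq_trans (RInt_const a b 0) _). unfold scal; simpl; unfold mult; simpl. ring.
  - split.
    + apply (ex_RInt_plus (fun x => psum (fun n => f n x) N) (f (S N))); [exact IH1|apply H].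
    + cbn [psum]. rewrite <- IH2.
      apply (RInt_plus (fun x => psum (fun n => f n x) N) (f (S N))); [exact IH1|apply H].
Qed.

Lemma continuous_shift (h : R -> R) (c x : R) :
  continuous h (c + x) -> continuous (fun a => h (c + a)) x.
Proof.
  intros H. apply (continuous_comp (fun a => c + a) h); [|exact H].
  apply (continuous_plus (fun _ => c) (fun a => a)); [apply continuous_const|apply continuous_id].
Qed.

(** Unfolding against a 1-periodic kernel: the unit intervals are glued together. The lower limit is
    1 because [psum] starts at n = 1. *)
Lemma RInt_unfold (h k : R -> R) (N : nat) :
  (forall x, 1 <= x -> continuous h x) -> (forall x, continuous k x) ->
  (forall (n : nat) x, k (INR n + x) = k x) ->
  RInt (fun a => psum (fun n => h (INR n + a)) N * k a) 0 1 = RInt (fun x => h x * k x) 1 (INR N + 1).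
Proof.
  intros Hh Hk Hper.
  assert (Hex : forall n, ex_RInt (fun a => h (INR (S n) + a) * k a) 0 1).
  { intros n. apply ex_RInt_continuous_le; [lra|]. intros x Hx.
    apply (continuous_mult (fun a => h (INR (S n) + a)) k); [|apply Hk].
    apply continuous_shift, Hh. pose proof (INR_S_ge_1 n). lra. }
  destruct (RInt_psum (fun n a => h (INR n + a) * k a) 0 1 N Hex) as [_ E].
  rewrite (RInt_ext _ (fun x => psum (fun n => h (INR n + x) * k x) N)).
  2:{ intros x _. as_R. induction N as [|N IH]; cbn [psum]; [ring|].
      rewrite Rmult_plus_distr_r. rewrite <- IH; [reflexivity|]. apply RInt_psum. exact Hex. }
  rewrite E. clear E.
  assert (Hex2 : forall a b, 1 <= a <= b -> ex_RInt (fun x => h x * k x) a b).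
  { intros a b Hab. apply ex_RInt_continuous_le; [lra|]. intros x Hx.
    apply (continuous_mult h k); [apply Hh; lra|apply Hk]. }
  induction N as [|N IH].
  - cbn [psum]. rewrite Rplus_0_l. symmetry. exact (@RInt_point R_CompleteNormedModule 1 (fun x => h x * k x)).
  - cbn [psum]. rewrite IH.
    pose proof (pos_INR N).
    assert (E1 : RInt (fun a => h (INR (S N) + a) * k a) 0 1 = RInt (fun x => h x * k x) (INR N + 1) (INR (S N) + 1)).
    { pose proof (RInt_comp_lin (fun x => h x * k x) 1 (INR (S N)) 0 1) as HC.
      replace (1 * 0 + INR (S N)) with (INR N + 1) in HC by (rewrite S_INR; ring).
      replace (1 * 1 + INR (S N)) with (INR (S N) + 1) in HC by ring.
      rewrite <- HC by (apply Hex2; rewrite S_INR; lra).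
      apply RInt_ext. intros x _.
      change (h (INR (S N) + x) * k x = 1 * (h (1 * x + INR (S N)) * k (1 * x + INR (S N)))).
      rewrite !Rmult_1_l, (Rplus_comm x), Hper. reflexivity. }
    rewrite E1. apply (RInt_Chasles (fun x => h x * k x)); apply Hex2; rewrite ?S_INR; lra.
Qed.

Definition dirichlet (j : nat) (x : R) : R := 1 + psum (fun m => 2 * cos (2 * PI * INR m * x)) j.

(* [n + 1] times the Fejer kernel of order [n]. *)
Definition fejer (n : nat) (x : R) : R := 1 + psum (fun i => dirichlet i x) n.

Lemma continuous_cos_lin (c x : R) : continuous (fun x => 2 * cos (c * x)) x.
Proof. continuous_by_derive. exact I. Qed.

Lemma continuous_dirichlet (j : nat) (x : R) : continuous (dirichlet j) x.
Proof.
  apply (continuous_plus (fun _ => 1)); [apply continuous_const|].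
  apply (continuous_psum (fun m x => 2 * cos (2 * PI * INR m * x))). intros n. apply continuous_cos_lin.
Qed.

Lemma continuous_fejer (n : nat) (x : R) : continuous (fejer n) x.
Proof.
  apply (continuous_plus (fun _ => 1)); [apply continuous_const|].
  apply (continuous_psum (fun i x => dirichlet i x)). intros i. apply continuous_dirichlet.
Qed.

(** Keeping the sine as a factor makes the identity valid at integers too, and the induction
    telescopes through sin (u + v) - sin (u - v). *)
Lemma dirichlet_closed (j : nat) (x : R) : sin (PI * x) * dirichlet j x = sin ((2 * INR j + 1) * (PI * x)).
Proof.
  unfold dirichlet. induction j as [|j IH].
  - cbn [psum]. simpl INR. rewrite Rplus_0_r, Rmult_1_r. f_equal. ring.
  - cbn [psum]. rewrite <- Rplus_assoc, Rmult_plus_distr_l, IH.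
    replace ((2 * INR j + 1) * (PI * x)) with (2 * PI * INR (S j) * x - PI * x) by (rewrite S_INR; ring).
    replace ((2 * INR (S j) + 1) * (PI * x)) with (2 * PI * INR (S j) * x + PI * x) by ring.
    rewrite sin_minus, sin_plus. ring.
Qed.

Lemma fejer_closed (n : nat) (x : R) :
  2 * (sin (PI * x) * sin (PI * x)) * fejer n x = 1 - cos (2 * INR (S n) * (PI * x)).
Proof.
  unfold fejer. induction n as [|n IH].
  - cbn [psum]. rewrite Rplus_0_r. replace (2 * INR 1 * (PI * x)) with (2 * (PI * x)) by (simpl; ring).
    rewrite cos_2a_sin. ring.
  - cbn [psum]. rewrite <- Rplus_assoc, Rmult_plus_distr_l, IH.
    replace (2 * (sin (PI * x) * sin (PI * x)) * dirichlet (S n) x)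
      with (2 * (sin (PI * x) * (sin (PI * x) * dirichlet (S n) x))) by ring.
    rewrite dirichlet_closed. set (y := (2 * INR (S n) + 1) * (PI * x)).
    replace (2 * INR (S n) * (PI * x)) with (y - PI * x) by (unfold y; ring).
    replace (2 * INR (S (S n)) * (PI * x)) with (y + PI * x) by (unfold y; rewrite (S_INR (S n)); ring).
    rewrite cos_minus, cos_plus. ring.
Qed.

(** The closed form is divided by the square of sin (PI x), hence the open interval; the smoothing
    estimates ask for nonnegativity only there. *)
Lemma fejer_nonneg (n : nat) (x : R) : 0 < x < 1 -> 0 <= fejer n x.
Proof.
  intros Hx. pose proof PI_RGT_0.
  assert (Hs : 0 < sin (PI * x)) by (apply sin_gt_0; nra).
  pose proof (fejer_closed n x) as E. pose proof (COS_bound (2 * INR (S n) * (PI * x))).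
  assert (0 < sin (PI * x) * sin (PI * x)) by nra. nra.
Qed.

Lemma fejer_le (n : nat) (x : R) : fejer n x <= INR (S n) * INR (S n).
Proof.
  assert (Hd : forall j, dirichlet j x <= 2 * INR j + 1).
  { unfold dirichlet. induction j as [|j IH]; [simpl; lra|].
    cbn [psum]. pose proof (COS_bound (2 * PI * INR (S j) * x)). rewrite S_INR in *. lra. }
  unfold fejer. induction n as [|n IH]; [simpl; lra|].
  cbn [psum]. specialize (Hd (S n)). rewrite (S_INR (S n)). lra.
Qed.

Lemma RInt_cos_period (m : nat) : (1 <= m)%nat -> is_RInt (fun x => 2 * cos (2 * PI * INR m * x)) 0 1 0.
Proof.
  intros Hm. assert (Hm1 : 1 <= INR m) by (apply (le_INR 1); assumption). pose proof PI_RGT_0.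
  evar_last.
  - apply (is_RInt_derive_le (fun x => 2 * sin (2 * PI * INR m * x) / (2 * PI * INR m))).
    + lra.
    + intros x _. auto_derive; [exact I|]. field. lra.
    + intros x _. apply continuous_cos_lin.
  - rewrite Rmult_0_r, Rmult_1_r, sin_0.
    replace (2 * PI * INR m) with (0 + 2 * INR m * PI) by ring.
    rewrite sin_period, sin_0. unfold Rdiv. ring.
Qed.

Lemma RInt_dirichlet (j : nat) : RInt (dirichlet j) 0 1 = 1.
Proof.
  assert (Hex : forall n, ex_RInt ((fun m x => 2 * cos (2 * PI * INR m * x)) (S n)) 0 1).
  { intros n. eexists. apply RInt_cos_period. lia. }
  destruct (RInt_psum (fun m x => 2 * cos (2 * PI * INR m * x)) 0 1 j Hex) as [H1 H2].
  refine (eq_trans (RInt_plus (fun _ => 1) (fun x => psum (fun m => 2 * cos (2 * PI * INR m * x)) j) 0 1 _ H1) _).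
  - exact (ex_RInt_const 0 1 1).
  - rewrite H2, (RInt_const 0 1 1). unfold plus, scal; simpl; unfold mult; simpl.
    rewrite (psum_ext _ (fun _ => 0 * 1)).
    + rewrite psum_scal. ring.
    + intros n Hn. rewrite (is_RInt_unique _ _ _ _ (RInt_cos_period n ltac:(lia))). ring.
Qed.

Lemma RInt_fejer (n : nat) : RInt (fejer n) 0 1 = INR (S n).
Proof.
  assert (Hex : forall i, ex_RInt ((fun i x => dirichlet i x) (S i)) 0 1).
  { intros i. apply ex_RInt_continuous_le; [lra|]. intros x _. apply continuous_dirichlet. }
  destruct (RInt_psum (fun i x => dirichlet i x) 0 1 n Hex) as [H1 H2].
  refine (eq_trans (RInt_plus (fun _ => 1) (fun x => psum (fun i => dirichlet i x) n) 0 1 _ H1) _).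
  - exact (ex_RInt_const 0 1 1).
  - rewrite H2, (RInt_const 0 1 1), (psum_ext _ (fun _ => 1)) by (intros i _; apply RInt_dirichlet).
    assert (E : psum (fun _ => 1) n = INR n).
    { clear. induction n as [|n IH]; [reflexivity|]. cbn [psum]. now rewrite S_INR, <- IH. }
    rewrite E, S_INR. change ((1 - 0) * 1 + INR n = INR n + 1). ring.
Qed.

Lemma cos_period_shift (m n : nat) (x : R) :
  2 * cos (2 * PI * INR m * (INR n + x)) = 2 * cos (2 * PI * INR m * x).
Proof.
  f_equal. replace (2 * PI * INR m * (INR n + x)) with (2 * PI * INR m * x + 2 * INR (m * n) * PI)
    by (rewrite mult_INR; ring).
  apply cos_period.
Qed.

(** Unfolding each cosine turns the Fejer average into double partial sums of Fourier coefficients,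
    the very shape that two summations by parts call for. *)
Lemma RInt_wave_fejer (t b : R) (N n : nat) :
  RInt (fun a => psum (fun i => wave t b (INR i + a)) N * fejer n a) 0 1 =
  INR (S n) * RInt (wave t b) 1 (INR N + 1)
  + psum (fun i => psum (fun m =>
      RInt (fun x => wave t b x * (2 * cos (2 * PI * INR m * x))) 1 (INR N + 1)) i) n.
Proof.
  set (S0 := fun a => psum (fun i => wave t b (INR i + a)) N).
  set (b0 := RInt (wave t b) 1 (INR N + 1)).
  set (bm := fun m => RInt (fun x => wave t b x * (2 * cos (2 * PI * INR m * x))) 1 (INR N + 1)).
  assert (Hw : forall x, 1 <= x -> continuous (wave t b) x) by (intros; apply continuous_wave; lra).
  assert (HcS : forall x, 0 <= x <= 1 -> continuous S0 x).
  { intros x Hx. apply (continuous_psum (fun i a => wave t b (INR i + a))). intros i.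
    apply continuous_shift, Hw. pose proof (INR_S_ge_1 i). lra. }
  assert (E0 : RInt (fun a => S0 a * 1) 0 1 = b0).
  { unfold S0. rewrite (RInt_unfold (wave t b) (fun _ => 1)); [|assumption|intros; apply continuous_const|reflexivity].
    apply RInt_ext. intros x _. as_R. apply Rmult_1_r. }
  assert (Em : forall m, RInt (fun a => S0 a * (2 * cos (2 * PI * INR m * a))) 0 1 = bm m).
  { intros m. apply (RInt_unfold (wave t b) (fun a => 2 * cos (2 * PI * INR m * a)));
      [assumption|intros; apply continuous_cos_lin|intros; apply cos_period_shift]. }
  assert (Hex : forall k : R -> R, (forall x, continuous k x) -> ex_RInt (fun a => S0 a * k a) 0 1).
  { intros k Hk. apply ex_RInt_continuous_le; [lra|]. intros x Hx. apply (continuous_mult S0 k); auto. }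
  assert (Hlin : forall (f : nat -> R -> R) j, (forall i x, continuous (f i) x) ->
     RInt (fun a => S0 a * (1 + psum (fun i => f i a) j)) 0 1 = b0 + psum (fun i => RInt (fun a => S0 a * f i a) 0 1) j).
  { intros f j Hf.
    destruct (RInt_psum (fun i a => S0 a * f i a) 0 1 j) as [H1 H2].
    { intros i. now apply Hex. }
    rewrite <- E0, <- H2.
    refine (eq_trans _ (RInt_plus (fun a => S0 a * 1) (fun a => psum (fun i => S0 a * f i a) j) 0 1 _ H1)).
    - apply RInt_ext. intros x _.
      change (S0 x * (1 + psum (fun i => f i x) j) = S0 x * 1 + psum (fun i => S0 x * f i x) j).
      rewrite (psum_scal (S0 x) (fun i => f i x)). as_R. ring.
    - apply Hex. intros; apply continuous_const. }
  assert (Ed : forall i, RInt (fun a => S0 a * dirichlet i a) 0 1 = b0 + psum bm i).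
  { intros i. unfold dirichlet.
    rewrite (Hlin (fun m a => 2 * cos (2 * PI * INR m * a))) by (intros; apply continuous_cos_lin).
    f_equal. apply psum_ext. intros m _. apply Em. }
  unfold fejer. rewrite (Hlin (fun i a => dirichlet i a)) by (intros; apply continuous_dirichlet).
  rewrite (psum_ext _ (fun i => b0 + psum bm i)) by (intros; apply Ed).
  rewrite (psum_plus (fun _ => b0) (fun i => psum bm i)).
  assert (Ec : psum (fun _ => b0) n = INR n * b0).
  { clear. induction n as [|n IH]; [simpl; ring|]. cbn [psum]. rewrite IH, S_INR. ring. }
  rewrite Ec, S_INR. as_R. ring.
Qed.

Lemma double_abel (w b : nat -> R) (Y : nat) :
  psum (fun n => w n * b n) Y =
  w (S Y) * psum b Y + (w (S Y) - w (S (S Y))) * psum (fun i => psum b i) Y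
  + psum (fun n => (w n - 2 * w (S n) + w (S (S n))) * psum (fun i => psum b i) n) Y.
Proof. induction Y as [|Y IH]; cbn [psum] in *; [ring|rewrite IH; ring]. Qed.

(** * The Green function kernel *)

Definition cut (t x : R) : R := t / (t + x * x).

Definition cut_wave (t b x : R) : R := (1 - cut t x) * wave t b x.

Definition dwave (t b x : R) : R :=
  - (1 / 2 * cos (t * ln x + b) + t * sin (t * ln x + b)) / (x * sqrt x).

Definition dcut_wave (t b x : R) : R :=
  2 * t * x / ((t + x * x) * (t + x * x)) * wave t b x + (1 - cut t x) * dwave t b x.

(** The Leibniz rule; the last quotient is the second derivative of [wave]. *)
Definition ddcut_wave (t b x : R) : R :=
  2 * t * (t - 3 * (x * x)) / ((t + x * x) * (t + x * x) * (t + x * x)) * wave t b x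
  + 2 * (2 * t * x / ((t + x * x) * (t + x * x)) * dwave t b x)
  + (1 - cut t x) * (((3 / 4 - t * t) * cos (t * ln x + b) + 2 * t * sin (t * ln x + b)) / (x * x * sqrt x)).

Lemma is_derive_wave (t b x : R) : 0 < x -> is_derive (wave t b) x (dwave t b x).
Proof.
  intros Hx. unfold wave, dwave.
  assert (Hu : 0 < sqrt x) by now apply sqrt_lt_R0.
  pose proof (sqrt_sqrt x ltac:(lra)) as Q.
  auto_derive; [repeat split; lra|].
  set (c := cos _). set (s := sin _). set (u := sqrt x) in *. clearbody c s u.
  rewrite <- Q. field. lra.
Qed.

Lemma is_derive_dwave (t b x : R) :
  0 < x -> is_derive (dwave t b) x
    (((3 / 4 - t * t) * cos (t * ln x + b) + 2 * t * sin (t * ln x + b)) / (x * x * sqrt x)).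
Proof.
  intros Hx. unfold dwave.
  assert (Hu : 0 < sqrt x) by now apply sqrt_lt_R0.
  pose proof (sqrt_sqrt x ltac:(lra)) as Q.
  auto_derive; [repeat split; try lra; apply Rmult_integral_contrapositive_currified; lra|].
  set (c := cos _). set (s := sin _). set (u := sqrt x) in *. clearbody c s u.
  rewrite <- Q. field. lra.
Qed.

Lemma is_derive_cut (t x : R) :
  0 < t -> is_derive (fun x => 1 - cut t x) x (2 * t * x / ((t + x * x) * (t + x * x))).
Proof.
  intros Ht. unfold cut. assert (0 < t + x * x) by nra.
  auto_derive; [lra|]. field. lra.
Qed.

Lemma is_derive_cut_wave (t b x : R) :
  0 < t -> 0 < x -> is_derive (cut_wave t b) x (dcut_wave t b x).
Proof.
  intros Ht Hx. apply (is_derive_mult (fun x => 1 - cut t x) (wave t b)).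
  - now apply is_derive_cut.
  - now apply is_derive_wave.
  - intros; apply Rmult_comm.
Qed.

Lemma is_derive_dcut_wave (t b x : R) :
  0 < t -> 0 < x -> is_derive (dcut_wave t b) x (ddcut_wave t b x).
Proof.
  intros Ht Hx. assert (Hp : 0 < t + x * x) by nra. unfold dcut_wave.
  evar_last.
  - apply (is_derive_plus (fun x => 2 * t * x / ((t + x * x) * (t + x * x)) * wave t b x)
      (fun x => (1 - cut t x) * dwave t b x)).
    + apply (is_derive_mult (fun x => 2 * t * x / ((t + x * x) * (t + x * x))) (wave t b)).
      * auto_derive; [apply Rmult_integral_contrapositive_currified; lra|reflexivity].
      * now apply is_derive_wave.
      * intros; apply Rmult_comm.
    + apply (is_derive_mult (fun x => 1 - cut t x) (dwave t b)).
      * now apply is_derive_cut.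
      * now apply is_derive_dwave.
      * intros; apply Rmult_comm.
  - unfold plus, mult; simpl. unfold ddcut_wave.
    assert (0 < sqrt x) by now apply sqrt_lt_R0. field. repeat split; lra.
Qed.

Lemma continuous_cut_wave (t b x : R) : 0 < t -> 0 < x -> continuous (cut_wave t b) x.
Proof.
  intros Ht Hx. apply (@ex_derive_continuous R_AbsRing R_NormedModule).
  eexists. now apply is_derive_cut_wave.
Qed.

Lemma continuous_ddcut_wave (t b x : R) : 0 < t -> 0 < x -> continuous (ddcut_wave t b) x.
Proof.
  intros Ht Hx. unfold ddcut_wave, dwave, wave, cut.
  assert (0 < sqrt x) by now apply sqrt_lt_R0. assert (0 < t + x * x) by nra.
  assert (x * sqrt x <> 0) by (apply Rmult_integral_contrapositive_currified; lra).
  assert (x * x * sqrt x <> 0)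
    by (repeat apply Rmult_integral_contrapositive_currified; lra).
  assert ((t + x * x) * (t + x * x) <> 0)
    by (repeat apply Rmult_integral_contrapositive_currified; lra).
  assert ((t + x * x) * (t + x * x) * (t + x * x) <> 0)
    by (repeat apply Rmult_integral_contrapositive_currified; lra).
  continuous_by_derive. repeat split; try assumption; lra.
Qed.

Lemma dwave_bound (t b x : R) : 1 <= t -> 0 < x -> Rabs (dwave t b x) <= 3 / 2 * t / (x * sqrt x).
Proof.
  intros Ht Hx. assert (0 < sqrt x) by now apply sqrt_lt_R0. assert (0 < x * sqrt x) by nra.
  unfold dwave, Rdiv. rewrite Rabs_mult, Rabs_Ropp, (Rabs_pos_eq (/ _)) by (apply Rlt_le, Rinv_0_lt_compat; lra).
  apply Rmult_le_compat_r; [apply Rlt_le, Rinv_0_lt_compat; lra|].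
  eapply Rle_trans; [apply Rabs_triang|].
  rewrite (Rabs_mult (1 * / 2)), (Rabs_mult t), (Rabs_pos_eq (1 * / 2)), (Rabs_pos_eq t) by lra.
  pose proof (Rabs_cos_le_1 (t * ln x + b)). pose proof (Rabs_sin_le_1 (t * ln x + b)). nra.
Qed.

(* The operator [1 - (1/t) d^2/dx^2] turns the high-frequency part [cut_wave] back into [wave]:
   to leading order it multiplies [x ^ (- s)] by [1 + t / x ^ 2 = 1 / (1 - cut t x)]. *)
Lemma cut_wave_green_error (t b x : R) :
  1 <= t -> 1 <= x ->
  Rabs (cut_wave t b x - ddcut_wave t b x / t - wave t b x) <= 15 / (x * x).
Proof.
  intros Ht Hx.
  assert (Hu : 1 <= sqrt x) by (rewrite <- sqrt_1; apply sqrt_le_1_alt; lra).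
  pose proof (sqrt_sqrt x ltac:(lra)) as Q.
  set (p := t + x * x). assert (Hp : 1 <= p) by (unfold p; nra).
  assert (Hpx : x * x <= p) by (unfold p; lra).
  (* What the second derivative of x ^ (- s) leaves besides its leading part - t ^ 2 x ^ (- s - 2);
     that part is accounted for by the factor 1 + t / x ^ 2. *)
  set (r := (3 / 4 * cos (t * ln x + b) + 2 * t * sin (t * ln x + b)) / (x * x * sqrt x)).
  replace (cut_wave t b x - ddcut_wave t b x / t - wave t b x) with
    (- (2 * (t - 3 * (x * x)) / (p * p * p) * wave t b x
        + 4 * x / (p * p) * dwave t b x + x * x / p / t * r)).
  2:{ unfold cut_wave, ddcut_wave, cut, r, dwave, wave. fold p.
      replace t with (p - x * x) by (unfold p; ring). fold p.
      set (c := cos _). set (s := sin _).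
      assert (p - x * x <> 0) by (unfold p; lra). field. repeat split; lra. }
  rewrite Rabs_Ropp.
  assert (Hip : 0 < / p <= 1) by (split; [apply Rinv_0_lt_compat; lra|rewrite <- Rinv_1; apply Rinv_le_contravar; lra]).
  assert (Hw : Rabs (wave t b x) <= 1).
  { eapply Rle_trans; [apply wave_bound; lra|]. rewrite <- Rinv_1. apply Rinv_le_contravar; lra. }
  pose proof (dwave_bound t b x Ht ltac:(lra)) as Hd.
  assert (T1 : Rabs (2 * (t - 3 * (x * x)) / (p * p * p) * wave t b x) <= 6 * / p).
  { rewrite Rabs_mult.
    assert (H1 : Rabs (2 * (t - 3 * (x * x)) / (p * p * p)) <= 6 * / p).
    { unfold Rdiv. rewrite Rabs_mult, (Rabs_pos_eq (/ (p * p * p))) by (rewrite !Rinv_mult; apply Rlt_le; repeat apply Rmult_lt_0_compat; lra).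
      assert (Rabs (2 * (t - 3 * (x * x))) <= 6 * p) by (apply Rabs_le; unfold p; nra).
      apply Rle_trans with (6 * p * / (p * p * p)).
      - apply Rmult_le_compat_r; [|assumption]. rewrite !Rinv_mult; apply Rlt_le; repeat apply Rmult_lt_0_compat; lra.
      - replace (6 * p * / (p * p * p)) with (6 * / p * / p) by (field; lra). nra. }
    pose proof (Rabs_pos (wave t b x)). pose proof (Rabs_pos (2 * (t - 3 * (x * x)) / (p * p * p))). nra. }
  assert (T2 : Rabs (4 * x / (p * p) * dwave t b x) <= 6 * / p).
  { rewrite Rabs_mult, (Rabs_pos_eq (4 * x / (p * p))) by (apply Rlt_le, Rdiv_lt_0_compat; nra).
    apply Rle_trans with (4 * x / (p * p) * (3 / 2 * t / (x * sqrt x))).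
    - apply Rmult_le_compat_l; [apply Rlt_le, Rdiv_lt_0_compat; nra|exact Hd].
    - replace (4 * x / (p * p) * (3 / 2 * t / (x * sqrt x))) with (6 * / p * (t / p * / sqrt x)) by (field; lra).
      assert (0 < t / p <= 1) by (split; [apply Rdiv_lt_0_compat; lra|apply Rdiv_le_of_le; unfold p; nra]).
      assert (0 < / sqrt x <= 1) by (split; [apply Rinv_0_lt_compat; lra|rewrite <- Rinv_1; apply Rinv_le_contravar; lra]).
      assert (t / p * / sqrt x <= 1) by nra. nra. }
  assert (T3 : Rabs (x * x / p / t * r) <= 3 * / p).
  { rewrite Rabs_mult, (Rabs_pos_eq (x * x / p / t)) by (apply Rlt_le; repeat apply Rdiv_lt_0_compat; nra).
    assert (Hr : Rabs r <= 3 * t / (x * x)).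
    { unfold r, Rdiv. rewrite Rabs_mult, (Rabs_pos_eq (/ _)) by (apply Rlt_le, Rinv_0_lt_compat; nra).
      apply Rmult_le_compat; [apply Rabs_pos|apply Rlt_le, Rinv_0_lt_compat; nra| |apply Rinv_le_contravar; nra].
      eapply Rle_trans; [apply Rabs_triang|].
      rewrite (Rabs_mult (3 * / 4)), (Rabs_mult (2 * t)), (Rabs_pos_eq (3 * / 4)), (Rabs_pos_eq (2 * t)) by lra.
      pose proof (Rabs_cos_le_1 (t * ln x + b)). pose proof (Rabs_sin_le_1 (t * ln x + b)). nra. }
    apply Rle_trans with (x * x / p / t * (3 * t / (x * x))).
    - apply Rmult_le_compat_l; [apply Rlt_le; repeat apply Rdiv_lt_0_compat; nra|exact Hr].
    - right. field. nra. }
  assert (/ p <= / (x * x)) by (apply Rinv_le_contravar; nra).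
  unfold Rdiv at 4.
  eapply Rle_trans; [apply Rabs_triang|].
  eapply Rle_trans; [apply Rplus_le_compat_r, Rabs_triang|]. lra.
Qed.

(** In between, near x = sqrt t, the derivative can reach the order t ^ (1/4), but only the two ends
    of a telescoping sum will matter. At x = 1 the factor 1 - cut = 1 / (t + 1) absorbs t; for x >=
    t the power of x does. *)
Lemma dcut_wave_bound (t b x : R) :
  1 <= t -> 1 <= x -> x = 1 \/ t <= x -> Rabs (dcut_wave t b x) <= 4.
Proof.
  intros Ht Hx Hc.
  assert (Hu : 1 <= sqrt x) by (rewrite <- sqrt_1; apply sqrt_le_1_alt; lra).
  set (p := t + x * x). assert (Hp : 1 <= p) by (unfold p; nra).
  assert (Hw : Rabs (wave t b x) <= 1).
  { eapply Rle_trans; [apply wave_bound; lra|]. rewrite <- Rinv_1. apply Rinv_le_contravar; lra. }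
  pose proof (dwave_bound t b x Ht ltac:(lra)) as Hd.
  unfold dcut_wave, cut. fold p.
  assert (T1 : Rabs (2 * t * x / (p * p) * wave t b x) <= 2).
  { rewrite Rabs_mult.
    assert (0 <= 2 * t * x / (p * p) <= 2).
    { split; [apply Rdiv_le_0_compat; nra|]. apply Rdiv_le_of_le; [nra|].
      assert (t * x <= p * p); [|nra]. apply Rmult_le_compat; unfold p; nra. }
    rewrite (Rabs_pos_eq (2 * t * x / (p * p))) by lra.
    pose proof (Rabs_pos (wave t b x)). nra. }
  assert (T2 : Rabs ((1 - t / p) * dwave t b x) <= 3 / 2).
  { assert (E : 1 - t / p = x * x / p) by (unfold p; field; nra). rewrite E.
    assert (Hxp : 0 <= x * x / p <= 1) by (split; [apply Rdiv_le_0_compat; nra|apply Rdiv_le_of_le; unfold p; nra]).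
    rewrite Rabs_mult, Rabs_pos_eq by lra.
    apply Rle_trans with (x * x / p * (3 / 2 * t / (x * sqrt x))); [apply Rmult_le_compat_l; lra|].
    destruct Hc as [-> | Hc].
    - unfold p. rewrite sqrt_1. replace (1 * 1 / (t + 1 * 1) * (3 / 2 * t / (1 * 1))) with (3 / 2 * t / (t + 1)) by (field; lra).
      apply Rdiv_le_of_le; lra.
    - assert (H : 3 / 2 * t / (x * sqrt x) <= 3 / 2) by (apply Rdiv_le_of_le; nra).
      assert (0 <= 3 / 2 * t / (x * sqrt x)) by (apply Rdiv_le_0_compat; nra). nra. }
  eapply Rle_trans; [apply Rabs_triang|]. lra.
Qed.

(* The periodic Green function of [1 - (1/t) d^2/dx^2], on a period. *)
Definition green (t x : R) : R :=
  sqrt t / 2 * (exp (sqrt t * (1 / 2 - x)) + exp (- (sqrt t * (1 / 2 - x))))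
  / (exp (sqrt t / 2) - exp (- (sqrt t / 2))).

Definition dgreen (t x : R) : R :=
  - (t / 2 * (exp (sqrt t * (1 / 2 - x)) - exp (- (sqrt t * (1 / 2 - x))))
     / (exp (sqrt t / 2) - exp (- (sqrt t / 2)))).

Lemma green_denominator_pos (t : R) : 0 < t -> 0 < exp (sqrt t / 2) - exp (- (sqrt t / 2)).
Proof.
  intros Ht. assert (0 < sqrt t) by now apply sqrt_lt_R0.
  pose proof (exp_increasing (- (sqrt t / 2)) (sqrt t / 2) ltac:(lra)). lra.
Qed.

Lemma is_derive_green (t x : R) : 0 < t -> is_derive (green t) x (dgreen t x).
Proof.
  intros Ht. pose proof (green_denominator_pos t Ht) as Hd. unfold green, dgreen.
  pose proof (sqrt_sqrt t ltac:(lra)) as Q.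
  set (D := exp (sqrt t / 2) - exp (- (sqrt t / 2))) in *. clearbody D.
  set (k := sqrt t) in *. clearbody k. rewrite <- Q.
  auto_derive; [exact I|].
  replace (k * (1 / 2 + - x)) with (k * (1 / 2 - x)) by ring. field. lra.
Qed.

Lemma is_derive_dgreen (t x : R) : 0 < t -> is_derive (dgreen t) x (t * green t x).
Proof.
  intros Ht. pose proof (green_denominator_pos t Ht) as Hd. unfold green, dgreen.
  pose proof (sqrt_sqrt t ltac:(lra)) as Q.
  set (D := exp (sqrt t / 2) - exp (- (sqrt t / 2))) in *. clearbody D.
  set (k := sqrt t) in *. clearbody k. rewrite <- Q.
  auto_derive; [exact I|].
  replace (k * (1 / 2 + - x)) with (k * (1 / 2 - x)) by ring. field. lra.
Qed.

Lemma dgreen_0 (t : R) : 0 < t -> dgreen t 0 = - (t / 2).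
Proof.
  intros Ht. pose proof (green_denominator_pos t Ht) as Hd. unfold dgreen.
  replace (sqrt t * (1 / 2 - 0)) with (sqrt t / 2) by field. field. lra.
Qed.

Lemma dgreen_1 (t : R) : 0 < t -> dgreen t 1 = t / 2.
Proof.
  intros Ht. pose proof (green_denominator_pos t Ht) as Hd. unfold dgreen.
  replace (sqrt t * (1 / 2 - 1)) with (- (sqrt t / 2)) by field. rewrite Ropp_involutive. field. lra.
Qed.

Lemma green_1 (t : R) : green t 1 = green t 0.
Proof.
  unfold green.
  replace (sqrt t * (1 / 2 - 1)) with (- (sqrt t / 2)) by field.
  replace (sqrt t * (1 / 2 - 0)) with (sqrt t / 2) by field.
  rewrite Ropp_involutive. f_equal. ring.
Qed.

(** Both exponentials in the numerator are at most exp (sqrt t / 2), and t >= 1 keeps the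
    denominator above a quarter of that. *)
Lemma green_bounds (t x : R) : 1 <= t -> 0 <= x <= 1 -> 0 <= green t x <= 4 * sqrt t.
Proof.
  intros Ht Hx. pose proof (green_denominator_pos t ltac:(lra)) as Hd. unfold green.
  assert (Hk : 1 <= sqrt t) by (rewrite <- sqrt_1; apply sqrt_le_1_alt; lra).
  set (k := sqrt t) in *.
  pose proof (exp_pos (k * (1 / 2 - x))). pose proof (exp_pos (- (k * (1 / 2 - x)))).
  split; [apply Rdiv_le_0_compat; nra|]. apply Rdiv_le_of_le; [assumption|].
  assert (Hexp : forall y, y <= k / 2 -> exp y <= exp (k / 2)).
  { intros y Hy. destruct (Req_dec y (k / 2)) as [->|Hn]; [lra|]. left. apply exp_increasing. lra. }
  pose proof (Hexp (k * (1 / 2 - x)) ltac:(nra)). pose proof (Hexp (- (k * (1 / 2 - x))) ltac:(nra)).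
  pose proof (exp_ineq1_le (k / 2)) as HE.
  assert (HEi : exp (- (k / 2)) <= 2 / 3).
  { rewrite exp_Ropp. replace (2 / 3) with (/ (3 / 2)) by field. apply Rinv_le_contravar; lra. }
  assert (exp (k / 2) <= 4 * (exp (k / 2) - exp (- (k / 2)))) by lra. nra.
Qed.

Lemma continuous_green (t x : R) : 0 < t -> continuous (green t) x.
Proof.
  intros Ht. apply (@ex_derive_continuous R_AbsRing R_NormedModule). eexists. now apply is_derive_green.
Qed.

Lemma RInt_green (t : R) : 0 < t -> RInt (green t) 0 1 = 1.
Proof.
  intros Ht.
  apply is_RInt_unique. evar_last.
  - apply (is_RInt_derive_le (fun x => dgreen t x / t)); [lra| |].
    + intros x _. evar_last.
      * eapply (is_derive_scal_l (dgreen t) x _ (/ t)). now apply is_derive_dgreen.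
      * unfold scal; simpl; unfold mult; simpl. field. lra.
    + intros x _. now apply continuous_green.
  - simpl. rewrite dgreen_0, dgreen_1 by assumption. field. lra.
Qed.

(** Green's second identity on [c, c + 1]. The end values - t / 2 and t / 2 of [dgreen], that is,
    the jump of the periodic kernel's derivative at integers, produce half the sum of the end values
    of phi; the boundary term in dphi telescopes when c runs over the integers. *)
Lemma green_identity (phi dphi ddphi : R -> R) (t c : R) :
  0 < t ->
  (forall x, 0 <= x <= 1 -> is_derive phi (c + x) (dphi (c + x))) ->
  (forall x, 0 <= x <= 1 -> is_derive dphi (c + x) (ddphi (c + x))) ->
  (forall x, 0 <= x <= 1 -> continuous ddphi (c + x)) ->
  RInt (fun x => (phi (c + x) - ddphi (c + x) / t) * green t x) 0 1 =
  (phi c + phi (c + 1)) / 2 - green t 0 / t * (dphi (c + 1) - dphi c).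
Proof.
  intros Ht D1 D2 C3. apply is_RInt_unique.
  assert (Hsh : forall f df : R -> R, (forall x, 0 <= x <= 1 -> is_derive f (c + x) (df (c + x))) ->
     forall x, 0 <= x <= 1 -> is_derive (fun x => f (c + x)) x (df (c + x))).
  { intros f df Hf x Hx. evar_last.
    - apply (is_derive_comp f (fun x => c + x)); [now apply Hf|].
      apply (is_derive_plus (fun _ => c) (fun x => x)); [apply (is_derive_const c)|apply (is_derive_id x)].
    - unfold scal, plus, zero, one; simpl; unfold mult; simpl. ring. }
  evar_last.
  - apply (is_RInt_derive_le
      (fun x => (phi (c + x) * dgreen t x - dphi (c + x) * green t x) / t)); [lra| |].
    + intros x Hx. evar_last.
      * eapply (is_derive_scal_l (fun x => phi (c + x) * dgreen t x - dphi (c + x) * green t x) x _ (/ t)).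
        apply (is_derive_minus (fun x => phi (c + x) * dgreen t x) (fun x => dphi (c + x) * green t x)).
        -- apply (is_derive_mult (fun x => phi (c + x)) (dgreen t)).
           ++ apply (Hsh phi dphi); assumption.
           ++ now apply is_derive_dgreen.
           ++ intros; apply Rmult_comm.
        -- apply (is_derive_mult (fun x => dphi (c + x)) (green t)).
           ++ apply (Hsh dphi ddphi); assumption.
           ++ now apply is_derive_green.
           ++ intros; apply Rmult_comm.
      * unfold scal, minus, plus, opp, mult; simpl; unfold mult; simpl. field. lra.
    + intros x Hx. apply (continuous_mult (fun x => phi (c + x) - ddphi (c + x) / t) (green t)).
      * apply (continuous_minus (fun x => phi (c + x)) (fun x => ddphi (c + x) / t)).
        -- apply continuous_shift. apply (@ex_derive_continuous R_AbsRing R_NormedModule). eexists. now apply D1.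
        -- apply (continuous_mult (fun x => ddphi (c + x)) (fun _ => / t)); [|apply continuous_const].
           apply continuous_shift. now apply C3.
      * now apply continuous_green.
  - simpl. rewrite dgreen_0, dgreen_1, green_1, !Rplus_0_r by assumption. field. lra.
Qed.

(** * Smoothed averages of the Hurwitz zeta function *)

(** Where Z exceeds lam, Z is at most Z ^ (n + 1) / lam ^ n. Used with s = sqrt t for the smoothing
    bounds, and with s = 1 and the constant kernel to bound the moments from below. *)
Lemma level_bound (Z k : R -> R) (lam s H : R) (n : nat) :
  0 < lam -> 0 < s ->
  (forall x, 0 <= x <= 1 -> continuous Z x) -> (forall x, 0 <= x <= 1 -> continuous k x) ->
  (forall x, 0 < x < 1 -> 0 <= Z x) -> (forall x, 0 < x < 1 -> 0 <= k x <= H) ->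
  s * RInt (fun x => Z x ^ S n) 0 1 <= lam ^ S n ->
  RInt (fun x => Z x * k x) 0 1 <= lam * (RInt k 0 1 + H / s).
Proof.
  intros Hl Hs CZ Ck HZ Hk HI.
  assert (Hln : 0 < lam ^ n) by now apply pow_lt.
  assert (CZn : forall x, 0 <= x <= 1 -> continuous (fun x => Z x ^ S n) x).
  { intros x Hx. apply (continuous_comp Z (fun y => y ^ S n)); [auto|].
    apply (@ex_derive_continuous R_AbsRing R_NormedModule (fun y => y ^ S n)). auto_derive. exact I. }
  assert (HH : 0 <= H) by (specialize (Hk (1 / 2) ltac:(lra)); lra).
  assert (E1 : ex_RInt (fun x => Z x ^ S n) 0 1) by (apply ex_RInt_continuous_le; [lra|assumption]).
  assert (E2 : ex_RInt k 0 1) by (apply ex_RInt_continuous_le; [lra|assumption]).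
  assert (E : RInt (fun x => lam * k x + H / lam ^ n * Z x ^ S n) 0 1
              = lam * RInt k 0 1 + H / lam ^ n * RInt (fun x => Z x ^ S n) 0 1).
  { apply is_RInt_unique.
    apply (is_RInt_plus (fun x => lam * k x) (fun x => H / lam ^ n * Z x ^ S n)).
    - apply (is_RInt_scal k 0 1 lam). now apply (@RInt_correct R_CompleteNormedModule).
    - apply (is_RInt_scal (fun x => Z x ^ S n) 0 1 (H / lam ^ n)). now apply (@RInt_correct R_CompleteNormedModule). }
  apply Rle_trans with (RInt (fun x => lam * k x + H / lam ^ n * Z x ^ S n) 0 1).
  - apply RInt_le; [lra| | |].
    + apply ex_RInt_continuous_le; [lra|]. intros x Hx. apply (continuous_mult Z k); auto.
    + apply ex_RInt_continuous_le; [lra|]. intros x Hx.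
      apply (continuous_plus (fun x => lam * k x) (fun x => H / lam ^ n * Z x ^ S n)).
      * apply (continuous_scal_r lam k). auto.
      * apply (continuous_scal_r (H / lam ^ n) (fun x => Z x ^ S n)). auto.
    + intros x Hx. specialize (HZ x Hx). specialize (Hk x Hx).
      assert (Hn : 0 <= Z x ^ S n) by now apply pow_le.
      assert (0 <= H / lam ^ n * Z x ^ S n).
      { apply Rmult_le_pos; [apply Rdiv_le_0_compat; assumption|assumption]. }
      destruct (Rle_lt_dec (Z x) lam) as [Hc|Hc].
      * assert (Z x * k x <= lam * k x) by (apply Rmult_le_compat_r; lra). lra.
      * assert (Z x <= Z x ^ S n / lam ^ n).
        { apply Rle_div_of_le; [assumption|]. simpl. apply Rmult_le_compat_l; [lra|].
          apply pow_incr. lra. }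
        assert (Z x * k x <= Z x ^ S n / lam ^ n * H) by (apply Rmult_le_compat; lra).
        replace (H / lam ^ n * Z x ^ S n) with (Z x ^ S n / lam ^ n * H) by (field; lra).
        assert (0 <= lam * k x) by (apply Rmult_le_pos; lra). lra.
  - rewrite E.
    assert (Hle : RInt (fun x => Z x ^ S n) 0 1 <= lam ^ S n / s) by (apply Rle_div_of_le; lra).
    assert (H / lam ^ n * RInt (fun x => Z x ^ S n) 0 1 <= H / lam ^ n * (lam ^ S n / s)).
    { apply Rmult_le_compat_l; [apply Rdiv_le_0_compat; assumption|assumption]. }
    replace (H / lam ^ n * (lam ^ S n / s)) with (lam * (H / s)) in * by (simpl; field; lra). lra.
Qed.

Lemma level_bound_perturbed (Z f k : R -> R) (lam s H c : R) (n : nat) :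
  0 < lam -> 0 < s ->
  (forall x, 0 <= x <= 1 -> continuous Z x) -> (forall x, 0 <= x <= 1 -> continuous k x) ->
  (forall x, 0 <= x <= 1 -> continuous f x) ->
  (forall x, 0 < x < 1 -> 0 <= Z x) -> (forall x, 0 < x < 1 -> 0 <= k x <= H) ->
  (forall x, 0 < x < 1 -> Rabs (f x) <= Z x + c) ->
  s * RInt (fun x => Z x ^ S n) 0 1 <= lam ^ S n ->
  Rabs (RInt (fun x => f x * k x) 0 1) <= lam * (RInt k 0 1 + H / s) + c * RInt k 0 1.
Proof.
  intros Hl Hs CZ Ck CS HZ Hk HS HI.
  pose proof (level_bound Z k lam s H n Hl Hs CZ Ck HZ Hk HI) as HB.
  assert (Ek : ex_RInt k 0 1) by (apply ex_RInt_continuous_le; [lra|assumption]).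
  assert (EZk : ex_RInt (fun x => Z x * k x) 0 1).
  { apply ex_RInt_continuous_le; [lra|]. intros x Hx. apply (continuous_mult Z k); auto. }
  assert (CSk : forall x, 0 <= x <= 1 -> continuous (fun x => f x * k x) x).
  { intros x Hx. apply (continuous_mult f k); auto. }
  assert (E : RInt (fun x => Z x * k x + c * k x) 0 1 = RInt (fun x => Z x * k x) 0 1 + c * RInt k 0 1).
  { apply is_RInt_unique. apply (is_RInt_plus (fun x => Z x * k x) (fun x => c * k x)).
    - now apply (@RInt_correct R_CompleteNormedModule).
    - apply (is_RInt_scal k 0 1 c). now apply (@RInt_correct R_CompleteNormedModule). }
  eapply Rle_trans; [apply abs_RInt_le; [lra|apply ex_RInt_continuous_le; [lra|assumption]]|].
  apply Rle_trans with (RInt (fun x => Z x * k x + c * k x) 0 1); [|lra].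
  apply RInt_le; [lra| | |].
  - apply ex_RInt_continuous_le; [lra|]. intros x Hx.
    apply (continuous_comp (fun x => f x * k x) Rabs); [auto|apply continuous_Rabs].
  - apply (ex_RInt_plus (fun x => Z x * k x) (fun x => c * k x)); [assumption|].
    now apply (ex_RInt_scal k).
  - intros x Hx. specialize (HS x Hx). specialize (Hk x Hx).
    rewrite Rabs_mult, (Rabs_pos_eq (k x)) by lra.
    rewrite <- Rmult_plus_distr_r. apply Rmult_le_compat_r; lra.
Qed.

(** The kernel and its height stay free so that both Fejer and Green kernels can be inserted; 9
    bounds the distance from the truncated sum to the rotated real part of Z(alpha). *)
Definition smoothing_bound (t lam b : R) (N : nat) : Prop :=
  forall (k : R -> R) (H : R),
    (forall x, 0 <= x <= 1 -> continuous k x) -> (forall x, 0 < x < 1 -> 0 <= k x <= H) ->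
    Rabs (RInt (fun a => psum (fun n => wave t b (INR n + a)) N * k a) 0 1)
    <= lam * (RInt k 0 1 + H / sqrt t) + 9 * RInt k 0 1.

(** * The part with c: Cesaro sums *)

Lemma psum_inv_sqrt (n : nat) : psum (fun m => / sqrt (INR m)) n <= 2 * sqrt (INR n).
Proof.
  induction n as [|n IH]; [cbn [psum]; simpl INR; rewrite sqrt_0; lra|].
  cbn [psum].
  pose proof (pos_INR n). rewrite S_INR in *. set (x := INR n) in *.
  assert (Hu : 0 < sqrt (x + 1)) by (apply sqrt_lt_R0; lra).
  pose proof (sqrt_sqrt (x + 1) ltac:(lra)) as Q1. pose proof (sqrt_sqrt x ltac:(lra)) as Q.
  pose proof (sqrt_pos x).
  assert (/ sqrt (x + 1) <= 2 * (sqrt (x + 1) - sqrt x)); [|lra].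
  rewrite <- (Rmult_1_l (/ _)). apply Rdiv_le_of_le; [assumption|]. nra.
Qed.

Lemma psum_const (c : R) (n : nat) : psum (fun _ => c) n = INR n * c.
Proof. induction n as [|n IH]; cbn [psum]; [simpl; ring|rewrite IH, S_INR; ring]. Qed.

(** The kernel [fejer n] has mass n + 1 and height at most (n + 1) ^ 2. Replacing Fourier
    coefficients by their main terms costs at most 40 per inner sum, since the errors 20 / sqrt (m
    t) add up to at most 40 sqrt (i / t). The constants 9, 3 and 40 are absorbed through 1 <= 400
    lam. *)
Lemma double_sum_stat_bound (t lam b : R) (N n : nat) :
  10 ^ 9 <= t -> t * t <= INR N + 1 <= 2 * (t * t) -> 1 / 400 <= lam ->
  smoothing_bound t lam b N -> 10 * INR n <= t ->
  Rabs (psum (fun i => psum (fun m =>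
      / sqrt (INR m) * RInt (stat_wave t (t * ln (INR m) - b)) 1 (INR N + 1)) i) n)
  <= 30000 * lam * (INR (S n) * (1 + INR (S n) / sqrt t)).
Proof.
  intros Ht HN Hlam HP Hn.
  set (X := INR N + 1) in *.
  pose proof (pos_INR n) as Hn0. pose proof (INR_S_ge_1 n) as HSn.
  assert (Hst : 0 < sqrt t) by (apply sqrt_lt_R0; lra).
  pose proof (RInt_wave_fejer t b N n) as E. fold X in E.
  pose proof (HP (fejer n) (INR (S n) * INR (S n)) (fun x _ => continuous_fejer n x)
    (fun x Hx => conj (fejer_nonneg n x Hx) (fejer_le n x))) as B1.
  rewrite RInt_fejer in B1.
  pose proof (RInt_wave_bound t b X ltac:(lra) ltac:(nra)) as B2.
  assert (HX : sqrt X <= 3 / 2 * t).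
  { rewrite <- (sqrt_square (3 / 2 * t)) by lra. apply sqrt_le_1_alt. nra. }
  assert (B2' : Rabs (RInt (wave t b) 1 X) <= 3).
  { eapply Rle_trans; [exact B2|]. apply Rdiv_le_of_le; lra. }
  set (bm := fun m => RInt (fun x => wave t b x * (2 * cos (2 * PI * INR m * x))) 1 X) in *.
  set (jm := fun m => / sqrt (INR m) * RInt (stat_wave t (t * ln (INR m) - b)) 1 X).
  assert (B3 : forall i, (i <= n)%nat -> Rabs (psum (fun m => bm m - jm m) i) <= 40).
  { intros i Hi.
    apply Rle_trans with (psum (fun m => 20 / sqrt t * / sqrt (INR m)) i).
    - apply psum_Rabs_le. intros m Hm.
      assert (INR m <= INR n) by (apply le_INR; lia).
      assert (1 <= INR m) by (apply (le_INR 1); lia).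
      eapply Rle_trans; [apply wave_fourier_coef; [lia|lra|lra]|].
      rewrite sqrt_mult by lra. right. field.
      split; apply Rgt_not_eq, sqrt_lt_R0; lra.
    - rewrite psum_scal. pose proof (psum_inv_sqrt i).
      assert (Hsi : sqrt (INR i) <= sqrt t).
      { apply sqrt_le_1_alt. assert (INR i <= INR n) by now apply le_INR. lra. }
      apply Rle_trans with (20 / sqrt t * (2 * sqrt t)); [|right; field; lra].
      apply Rmult_le_compat_l; [apply Rdiv_le_0_compat; lra|lra]. }
  assert (B4 : Rabs (psum (fun i => psum (fun m => bm m - jm m) i) n) <= INR n * 40).
  { rewrite <- psum_const. apply psum_Rabs_le. intros i Hi. apply B3. lia. }
  assert (E2 : psum (fun i => psum jm i) n =
    psum (fun i => psum bm i) n + -1 * psum (fun i => psum (fun m => bm m - jm m) i) n).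
  { rewrite <- psum_scal, <- psum_plus. apply psum_ext. intros i _.
    rewrite <- psum_scal, <- psum_plus. apply psum_ext. intros m _. ring. }
  fold jm. rewrite E2.
  set (P1 := psum (fun i => psum bm i) n) in *.
  set (P2 := psum (fun i => psum (fun m => bm m - jm m) i) n) in *.
  set (I0 := RInt (wave t b) 1 X) in *.
  rewrite E in B1. set (M := INR (S n)) in *.
  assert (HM : 0 <= M * M / sqrt t) by (apply Rdiv_le_0_compat; nra).
  assert (HMn : INR n <= M) by (unfold M; rewrite S_INR; lra).
  apply Rabs_le_between in B1. apply Rabs_le_between in B2'. apply Rabs_le_between in B4.
  replace (M * (1 + M / sqrt t)) with (M + M * M / sqrt t) by (field; lra).
  set (F := M * M / sqrt t) in *.
  assert (- (M * 3) <= M * I0 <= M * 3) by nra.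
  assert (M <= 400 * lam * M) by nra.
  assert (0 <= lam * F) by nra. assert (0 <= lam * M) by nra.
  apply Rabs_le. nra.
Qed.

(** With C = c1 + i c2, the previous bound for the rotations 0 and PI / 2 controls the real and
    imaginary parts of C (U + i V), where U + i V is the Cesaro sum of m ^ (s - 1). As |C| >= 1/60,
    U ^ 2 + V ^ 2 is at most 7200 g ^ 2, hence the factor 100. *)
Lemma double_sum_wave_bound (t lam b : R) (N n : nat) :
  10 ^ 9 <= t -> t * t <= INR N + 1 <= 2 * (t * t) -> 1 / 400 <= lam ->
  smoothing_bound t lam 0 N -> smoothing_bound t lam (PI / 2) N -> 10 * INR n <= t ->
  Rabs (psum (fun i => psum (fun m => wave t b (INR m)) i) n)
  <= 3000000 * lam * (INR (S n) * (1 + INR (S n) / sqrt t)).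
Proof.
  intros Ht HN Hlam HP0 HP1 Hn.
  pose proof (double_sum_stat_bound t lam 0 N n Ht HN Hlam HP0 Hn) as B0.
  pose proof (double_sum_stat_bound t lam (PI / 2) N n Ht HN Hlam HP1 Hn) as B1.
  set (X := INR N + 1) in *.
  assert (HX : 1 <= X) by nra.
  destruct (stat_integral_lower t X Ht ltac:(nra)) as [b0 Hb0].
  rewrite RInt_stat_wave_phase in Hb0 by assumption.
  set (c1 := RInt (stat_wave t 0) 1 X) in *. set (c2 := RInt (stat_wave t (- (PI / 2))) 1 X) in *.
  set (g := 30000 * lam * (INR (S n) * (1 + INR (S n) / sqrt t))) in *.
  set (U := psum (fun i => psum (fun m => cos (t * ln (INR m)) / sqrt (INR m)) i) n).
  set (V := psum (fun i => psum (fun m => sin (t * ln (INR m)) / sqrt (INR m)) i) n).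
  assert (Hlin : forall (p q : R) (f : nat -> R),
     (forall m, (1 <= m)%nat -> f m = p * (cos (t * ln (INR m)) / sqrt (INR m)) + q * (sin (t * ln (INR m)) / sqrt (INR m))) ->
     psum (fun i => psum f i) n = p * U + q * V).
  { intros p q f Hf. unfold U, V. rewrite <- !psum_scal, <- psum_plus. apply psum_ext. intros i _.
    rewrite <- !psum_scal, <- psum_plus. apply psum_ext. intros m Hm. apply Hf. lia. }
  rewrite (Hlin c1 (- c2)) in B0.
  2:{ intros m _. rewrite RInt_stat_wave_phase by assumption. fold c1 c2.
      rewrite Rminus_0_r. unfold Rdiv. ring. }
  rewrite (Hlin c2 c1) in B1.
  2:{ intros m _. rewrite RInt_stat_wave_phase by assumption. fold c1 c2.
      rewrite cos_minus, sin_minus, cos_PI2, sin_PI2. unfold Rdiv. ring. }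
  rewrite (Hlin (cos b) (- sin b)).
  2:{ intros m _. unfold wave. rewrite cos_plus. unfold Rdiv. ring. }
  assert (Hg : 0 <= g) by (eapply Rle_trans; [apply Rabs_pos|exact B0]).
  replace (3000000 * lam * (INR (S n) * (1 + INR (S n) / sqrt t))) with (100 * g) by (unfold g; ring).
  apply Rabs_le_between in B0. apply Rabs_le_between in B1.
  clearbody c1 c2 U V g. clear - Hb0 B0 B1 Hg.
  pose proof (sin2_cos2 b0) as E0. pose proof (sin2_cos2 b) as Eb. unfold Rsqr in E0, Eb.
  set (s0 := sin b0) in *. set (k0 := cos b0) in *. set (s := sin b) in *. set (k := cos b) in *.
  assert (Hc : 1 / 3600 <= c1 * c1 + c2 * c2).
  { pose proof (Rle_0_sqr (s0 * c1 + k0 * c2)) as Hs. unfold Rsqr in Hs.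
    assert (1 / 3600 <= (k0 * c1 - s0 * c2) * (k0 * c1 - s0 * c2)) by nra.
    replace (c1 * c1 + c2 * c2) with ((s0 * s0 + k0 * k0) * (c1 * c1 + c2 * c2)) by (rewrite E0; ring). nra. }
  assert (H2 : (c1 * c1 + c2 * c2) * (U * U + V * V) <= 2 * (g * g)).
  { replace ((c1 * c1 + c2 * c2) * (U * U + V * V))
      with ((c1 * U + - c2 * V) * (c1 * U + - c2 * V) + (c2 * U + c1 * V) * (c2 * U + c1 * V)) by ring. nra. }
  assert (HUV0 : 0 <= U * U + V * V) by nra.
  assert (HUV : U * U + V * V <= 7200 * (g * g)) by nra.
  assert (H3 : (k * U + - s * V) * (k * U + - s * V) <= U * U + V * V).
  { pose proof (Rle_0_sqr (s * U + k * V)) as Hs. unfold Rsqr in Hs.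
    replace (U * U + V * V) with ((s * s + k * k) * (U * U + V * V)) by (rewrite Eb; ring). nra. }
  apply Rabs_le. nra.
Qed.

(** The factor x (1 + x / sqrt t) is the size of the double sums that the second difference will
    meet. The product decays like the derivative of an arctangent, so its sum over x is bounded
    independently of t. *)
Lemma cut_second_difference (t x : R) :
  1 <= t -> 1 <= x ->
  Rabs (cut t (x - 1) - 2 * cut t x + cut t (x + 1)) * (x * (1 + x / sqrt t))
  <= 12 * (sqrt t / (t + (x - 1) * (x - 1))).
Proof.
  intros Ht Hx.
  assert (Hs : 1 <= sqrt t) by (rewrite <- sqrt_1; apply sqrt_le_1_alt; lra).
  pose proof (sqrt_sqrt t ltac:(lra)) as Q.
  set (p := t + (x - 1) * (x - 1)). set (q := t + x * x). set (r := t + (x + 1) * (x + 1)).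
  assert (Hp : 0 < p) by (unfold p; nra). assert (Hq : 0 < q) by (unfold q; nra).
  assert (Hr : 0 < r) by (unfold r; nra).
  assert (E : cut t (x - 1) - 2 * cut t x + cut t (x + 1) = t * (6 * (x * x) - 2 - 2 * t) / (p * q * r)).
  { unfold cut. fold p q r.
    assert (E1 : t / p - 2 * (t / q) + t / r = t * (q * r - 2 * (p * r) + p * q) / (p * q * r)) by (field; lra).
    rewrite E1. f_equal. f_equal. unfold p, q, r. ring. }
  rewrite E. unfold Rdiv at 1. rewrite Rabs_mult, (Rabs_pos_eq (/ _))
    by (apply Rlt_le, Rinv_0_lt_compat; repeat apply Rmult_lt_0_compat; assumption).
  assert (Hn : Rabs (t * (6 * (x * x) - 2 - 2 * t)) <= t * (6 * q)).
  { rewrite Rabs_mult, (Rabs_pos_eq t) by lra. apply Rmult_le_compat_l; [lra|].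
    apply Rabs_le. unfold q. nra. }
  set (k := sqrt t) in *.
  assert (Hxx : 0 < x * (1 + x / k)).
  { apply Rmult_lt_0_compat; [lra|]. assert (0 < x / k) by (apply Rdiv_lt_0_compat; lra). lra. }
  apply Rle_trans with (t * (6 * q) * / (p * q * r) * (x * (1 + x / k))).
  - apply Rmult_le_compat_r; [lra|]. apply Rmult_le_compat_r; [|assumption].
    apply Rlt_le, Rinv_0_lt_compat. repeat apply Rmult_lt_0_compat; assumption.
  - rewrite <- Q.
    replace (k * k * (6 * q) * / (p * q * r) * (x * (1 + x / k))) with (6 * (k / p) * (x * (k + x) / r))
      by (field; lra).
    assert (x * (k + x) / r <= 2) by (apply Rdiv_le_of_le; [assumption|unfold r; nra]).
    assert (0 < k / p) by (apply Rdiv_lt_0_compat; lra). nra.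
Qed.

(** Each term is at most the increment of arctan (y / sqrt t) over the unit interval on its left,
    whose derivative sqrt t / (t + y ^ 2) is decreasing. *)
Lemma psum_atan (t : R) (Y : nat) :
  1 <= t -> psum (fun n => sqrt t / (t + INR n * INR n)) Y <= atan (INR Y / sqrt t).
Proof.
  intros Ht. assert (Hs : 1 <= sqrt t) by (rewrite <- sqrt_1; apply sqrt_le_1_alt; lra).
  pose proof (sqrt_sqrt t ltac:(lra)) as Q. set (k := sqrt t) in *.
  induction Y as [|Y IH].
  - cbn [psum]. simpl INR. rewrite Rdiv_0_l, atan_0. lra.
  - cbn [psum]. pose proof (pos_INR Y). rewrite S_INR. set (x := INR Y) in *.
    destruct (MVT_gen (fun y => atan (y / k)) x (x + 1) (fun y => k / (t + y * y))) as [c [Hc E]].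
    + rewrite Rmin_left, Rmax_right by lra. intros y Hy. rewrite <- Q. auto_derive; [exact I|]. field.
      split; nra.
    + rewrite Rmin_left, Rmax_right by lra. intros y Hy. apply is_derive_continuity_pt with (k / (t + y * y)).
      rewrite <- Q. auto_derive; [exact I|]. field. split; nra.
    + rewrite Rmin_left, Rmax_right in Hc by lra.
      assert (k / (t + (x + 1) * (x + 1)) <= k / (t + c * c)).
      { apply Rmult_le_compat_l; [lra|]. apply Rinv_le_contravar; nra. }
      lra.
Qed.

(** Each term is at most t / n ^ 2 in absolute value, hence at most a telescoping difference. For Y
    of order t this makes the tail O(1). *)
Lemma cut_wave_tail (t b : R) (Y N : nat) :
  0 < t -> (1 <= Y <= N)%nat ->
  Rabs (psum (fun n => cut t (INR n) * wave t b (INR n)) N - psum (fun n => cut t (INR n) * wave t b (INR n)) Y)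
  <= t * (/ INR Y - / INR N).
Proof.
  intros Ht [HY HN]. induction HN as [|N HN IH].
  - rewrite !Rminus_diag, Rabs_R0. lra.
  - cbn [psum]. assert (HN1 : 1 <= INR N) by (apply (le_INR 1); lia).
    rewrite S_INR in *. set (x := INR N) in *.
    assert (Hu : 1 <= sqrt (x + 1)) by (rewrite <- sqrt_1 at 1; apply sqrt_le_1_alt; lra).
    assert (Hw : Rabs (wave t b (x + 1)) <= 1).
    { eapply Rle_trans; [apply wave_bound; lra|]. rewrite <- Rinv_1 at 2. apply Rinv_le_contravar; lra. }
    assert (Hc : 0 <= cut t (x + 1) <= t * (/ x - / (x + 1))).
    { unfold cut. split; [apply Rdiv_le_0_compat; nra|].
      replace (/ x - / (x + 1)) with (/ (x * (x + 1))) by (field; lra).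
      apply Rmult_le_compat_l; [lra|]. apply Rinv_le_contravar; nra. }
    match goal with |- Rabs (?a + ?c - ?d) <= _ => replace (a + c - d) with ((a - d) + c) by ring end.
    eapply Rle_trans; [apply Rabs_triang|].
    rewrite (Rabs_mult (cut t (x + 1))), (Rabs_pos_eq (cut t (x + 1))) by lra.
    pose proof (Rabs_pos (wave t b (x + 1))). nra.
Qed.

Lemma cut_sum_bound (t lam b : R) (N : nat) :
  10 ^ 9 <= t -> t * t <= INR N + 1 <= 2 * (t * t) -> 1 / 400 <= lam ->
  smoothing_bound t lam 0 N -> smoothing_bound t lam (PI / 2) N ->
  Rabs (psum (fun n => cut t (INR n) * wave t b (INR n)) N) <= 10 ^ 8 * lam.
Proof.
  intros Ht HN Hlam HP0 HP1.
  (* Y is the last index with 10 n <= t, the range of the Cesaro bound; beyond it the trivial tail t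
     / Y <= 11 suffices. *)
  destruct (nfloor_ex (t / 10) ltac:(apply Rdiv_le_0_compat; lra)) as [Y [HY1 HY2]].
  assert (HYt : 10 * INR Y <= t) by lra.
  assert (HYge : t / 11 <= INR Y) by lra.
  assert (HYpos : 0 < INR Y) by lra.
  assert (HY0 : (1 <= Y)%nat) by (destruct Y; [simpl in HYpos; lra|lia]).
  assert (HYN : (Y <= N)%nat) by (apply INR_le; nra).
  pose proof (cut_wave_tail t b Y N ltac:(lra) (conj HY0 HYN)) as Htail.
  assert (HiN : 0 < / INR N) by (apply Rinv_0_lt_compat; nra).
  assert (HtY : t * / INR Y <= 11) by (apply (Rdiv_le_of_le t); lra).
  assert (Htail2 : Rabs (psum (fun n => cut t (INR n) * wave t b (INR n)) N
     - psum (fun n => cut t (INR n) * wave t b (INR n)) Y) <= 11) by nra.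
  set (bb := fun n => wave t b (INR n)) in *.
  assert (Hbb : forall n, (1 <= n)%nat -> Rabs (bb n) <= 1).
  { intros n Hn. assert (1 <= INR n) by (apply (le_INR 1); assumption).
    assert (1 <= sqrt (INR n)) by (rewrite <- sqrt_1; apply sqrt_le_1_alt; lra).
    eapply Rle_trans; [apply wave_bound; lra|]. rewrite <- Rinv_1. apply Rinv_le_contravar; lra. }
  assert (HB : forall n, Rabs (psum bb n) <= INR n).
  { intros n. rewrite <- (Rmult_1_r (INR n)), <- psum_const. apply psum_Rabs_le. intros m Hm. apply Hbb. lia. }
  assert (HT : Rabs (psum (fun i => psum bb i) Y) <= INR Y * INR Y).
  { rewrite <- psum_const. apply psum_Rabs_le. intros i Hi. eapply Rle_trans; [apply HB|]. apply le_INR; lia. }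
  pose proof (double_abel (fun n => cut t (INR n)) bb Y) as EA. cbn beta in EA.
  set (y := INR Y) in *.
  assert (EY1 : INR (S Y) = y + 1) by (unfold y; apply S_INR).
  assert (EY2 : INR (S (S Y)) = y + 2) by (rewrite (S_INR (S Y)), EY1; ring).
  rewrite EY1, EY2 in EA.
  (* In the two boundary terms the trivial sizes Y and Y ^ 2 of the sums are enough, against [cut]
     of order t / Y ^ 2 and its first difference of order t / Y ^ 3. *)
  assert (T1 : Rabs (cut t (y + 1) * psum bb Y) <= 11).
  { rewrite Rabs_mult.
    assert (Hc : 0 <= cut t (y + 1) <= t / (y * y)).
    { unfold cut. split; [apply Rdiv_le_0_compat; nra|].
      apply Rmult_le_compat_l; [lra|]. apply Rinv_le_contravar; nra. }
    rewrite (Rabs_pos_eq (cut t (y + 1))) by lra.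
    apply Rle_trans with (t / (y * y) * y).
    - apply Rmult_le_compat; [lra|apply Rabs_pos|lra|apply HB].
    - replace (t / (y * y) * y) with (t * / y) by (field; lra). lra. }
  assert (T2 : Rabs ((cut t (y + 1) - cut t (y + 2)) * psum (fun i => psum bb i) Y) <= 33).
  { rewrite Rabs_mult.
    assert (Hc : 0 <= cut t (y + 1) - cut t (y + 2) <= 3 * t / (y * y * y)).
    { unfold cut.
      replace (t / (t + (y + 1) * (y + 1)) - t / (t + (y + 2) * (y + 2)))
        with (t * (2 * y + 3) / ((t + (y + 1) * (y + 1)) * (t + (y + 2) * (y + 2)))) by (field; nra).
      split; [apply Rdiv_le_0_compat; nra|].
      apply Rle_trans with (t * (3 * y) / ((y * y) * (y * y))).
      - unfold Rdiv. apply Rmult_le_compat; [nra| |nra|].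
        + apply Rlt_le, Rinv_0_lt_compat. apply Rmult_lt_0_compat; nra.
        + apply Rinv_le_contravar; [apply Rmult_lt_0_compat; nra|]. apply Rmult_le_compat; nra.
      - right. field. lra. }
    rewrite (Rabs_pos_eq (_ - _)) by lra.
    apply Rle_trans with (3 * t / (y * y * y) * (y * y)).
    - apply Rmult_le_compat; [lra|apply Rabs_pos|lra|exact HT].
    - replace (3 * t / (y * y * y) * (y * y)) with (3 * (t * / y)) by (field; lra). lra. }
  assert (T3 : Rabs (psum (fun n => (cut t (INR n) - 2 * cut t (INR (S n)) + cut t (INR (S (S n))))
            * psum (fun i => psum bb i) n) Y) <= 72000000 * lam).
  (* 36000000 is 12, from the second difference, times 3000000, from the Cesaro sums; the remaining
     sum is an arctangent, below 2. *)
  { apply Rle_trans with (psum (fun n => 36000000 * lam * (sqrt t / (t + INR n * INR n))) Y).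
    - apply psum_Rabs_le. intros n Hn.
      assert (Hny : INR n <= y) by (apply le_INR; lia).
      pose proof (double_sum_wave_bound t lam b N n Ht HN Hlam HP0 HP1 ltac:(lra)) as BD.
      fold bb in BD.
      pose proof (INR_S_ge_1 n) as Hn1.
      pose proof (cut_second_difference t (INR (S n)) ltac:(lra) Hn1) as BC.
      replace (INR (S n) - 1) with (INR n) in BC by (rewrite S_INR; ring).
      replace (INR (S n) + 1) with (INR (S (S n))) in BC by (rewrite (S_INR (S n)); ring).
      rewrite Rabs_mult. set (d := Rabs (cut t (INR n) - 2 * cut t (INR (S n)) + cut t (INR (S (S n))))) in *.
      assert (0 <= d) by apply Rabs_pos.
      apply Rle_trans with (d * (3000000 * lam * (INR (S n) * (1 + INR (S n) / sqrt t)))).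
      + apply Rmult_le_compat_l; assumption.
      + set (e := INR (S n) * (1 + INR (S n) / sqrt t)) in *.
        set (f := sqrt t / (t + INR n * INR n)) in *.
        replace (d * (3000000 * lam * e)) with (3000000 * lam * (d * e)) by ring.
        replace (36000000 * lam * f) with (3000000 * lam * (12 * f)) by ring.
        apply Rmult_le_compat_l; lra.
    - rewrite psum_scal. pose proof (psum_atan t Y ltac:(lra)) as HA.
      pose proof (atan_bound (INR Y / sqrt t)) as Hb. pose proof PI_4.
      apply Rle_trans with (36000000 * lam * 2); [|lra]. apply Rmult_le_compat_l; lra. }
  cbn beta in EA. fold bb in EA.
  change (fun n => cut t (INR n) * wave t b (INR n)) with (fun n => cut t (INR n) * bb n) in *.
  apply Rabs_le_between in T1. apply Rabs_le_between in T2. apply Rabs_le_between in T3.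
  apply Rabs_le_between in Htail2. apply Rabs_le. lra.
Qed.

(** * The part with 1 - c: the Green kernel *)

Lemma psum_inv_sq (n : nat) : (1 <= n)%nat -> psum (fun i => / (INR i * INR i)) n <= 2 - / INR n.
Proof.
  intros Hn. induction Hn as [|n Hn IH].
  - cbn [psum]. simpl INR. lra.
  - cbn [psum]. assert (1 <= INR n) by (apply (le_INR 1); assumption). rewrite S_INR.
    set (x := INR n) in *.
    assert (/ ((x + 1) * (x + 1)) <= / (x * (x + 1))) by (apply Rinv_le_contravar; nra).
    replace (/ (x * (x + 1))) with (/ x - / (x + 1)) in * by (field; lra). lra.
Qed.

(** Sums [green_identity] over c = 1, ..., N. Mass 1 and height 4 sqrt t give 5 lam + 9 in the
    smoothing bound; the operator error adds 15 times 2, the averaging of neighbouring values 1, and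
    the boundary terms of the derivative 4 times 8, which is 72 in all besides 5 lam. *)
Lemma high_sum_bound (t lam b : R) (N : nat) :
  10 ^ 9 <= t -> t * t <= INR N + 1 -> smoothing_bound t lam b N ->
  Rabs (psum (fun n => cut_wave t b (INR n)) N) <= 5 * lam + 80.
Proof.
  intros Ht HN HP.
  assert (Ht0 : 0 < t) by lra.
  assert (Hst : 1 <= sqrt t) by (rewrite <- sqrt_1; apply sqrt_le_1_alt; lra).
  pose proof (sqrt_sqrt t ltac:(lra)) as Q.
  pose proof (HP (green t) (4 * sqrt t) (fun x _ => continuous_green t x Ht0)
    (fun x Hx => green_bounds t x ltac:(lra) ltac:(lra))) as B1.
  rewrite RInt_green in B1 by assumption.
  replace (4 * sqrt t / sqrt t) with 4 in B1 by (field; lra).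
  assert (Cw : forall n x, 0 <= x <= 1 -> continuous (fun a => wave t b (INR (S n) + a)) x).
  { intros n x Hx. apply continuous_shift, continuous_wave. pose proof (INR_S_ge_1 n). lra. }
  assert (Hex : forall n, ex_RInt (fun a => wave t b (INR (S n) + a) * green t a) 0 1).
  { intros n. apply ex_RInt_continuous_le; [lra|]. intros x Hx.
    apply (continuous_mult (fun a => wave t b (INR (S n) + a)) (green t)); [now apply Cw|now apply continuous_green]. }
  assert (EI : RInt (fun a => psum (fun n => wave t b (INR n + a)) N * green t a) 0 1 =
    psum (fun n => RInt (fun a => wave t b (INR n + a) * green t a) 0 1) N).
  { destruct (RInt_psum (fun n a => wave t b (INR n + a) * green t a) 0 1 N Hex) as [_ E].
    rewrite <- E. apply RInt_ext. intros x _. as_R.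
    rewrite (Rmult_comm (psum _ _)), <- psum_scal. apply psum_ext. intros; apply Rmult_comm. }
  rewrite EI in B1. clear EI.
  set (K0 := green t 0 / t).
  assert (Hterm : forall n, (1 <= n <= N)%nat ->
    Rabs (RInt (fun a => wave t b (INR n + a) * green t a) 0 1
          - ((cut_wave t b (INR n) + cut_wave t b (INR n + 1)) / 2
             - K0 * (dcut_wave t b (INR n + 1) - dcut_wave t b (INR n))))
    <= 15 * / (INR n * INR n)).
  { intros n Hn. assert (Hn1 : 1 <= INR n) by (apply (le_INR 1); lia). set (x := INR n) in *.
    unfold K0. rewrite <- (green_identity (cut_wave t b) (dcut_wave t b) (ddcut_wave t b) t x Ht0);
      [|intros y Hy; apply is_derive_cut_wave; lra|intros y Hy; apply is_derive_dcut_wave; lra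
       |intros y Hy; apply continuous_ddcut_wave; lra].
    assert (C1 : forall y, 0 <= y <= 1 -> continuous (fun a => wave t b (x + a) * green t a) y).
    { intros y Hy. apply (continuous_mult (fun a => wave t b (x + a)) (green t)); [|now apply continuous_green].
      apply continuous_shift, continuous_wave. lra. }
    assert (C2 : forall y, 0 <= y <= 1 ->
       continuous (fun a => (cut_wave t b (x + a) - ddcut_wave t b (x + a) / t) * green t a) y).
    { intros y Hy. apply (continuous_mult (fun a => cut_wave t b (x + a) - ddcut_wave t b (x + a) / t) (green t));
        [|now apply continuous_green].
      apply (continuous_minus (fun a => cut_wave t b (x + a)) (fun a => ddcut_wave t b (x + a) / t)).
      - apply continuous_shift, continuous_cut_wave; lra.
      - apply (continuous_mult (fun a => ddcut_wave t b (x + a)) (fun _ => / t)); [|apply continuous_const].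
        apply continuous_shift, continuous_ddcut_wave; lra. }
    pose proof (RInt_minus (fun a => wave t b (x + a) * green t a)
       (fun a => (cut_wave t b (x + a) - ddcut_wave t b (x + a) / t) * green t a) 0 1
       (ex_RInt_continuous_le _ 0 1 Rle_0_1 C1) (ex_RInt_continuous_le _ 0 1 Rle_0_1 C2)) as EM.
    match type of EM with _ = ?r => change (Rabs r <= 15 * / (x * x)) end. rewrite <- EM. clear EM.
    assert (C3 : forall y, 0 <= y <= 1 -> continuous (fun a =>
        minus (wave t b (x + a) * green t a) ((cut_wave t b (x + a) - ddcut_wave t b (x + a) / t) * green t a)) y).
    { intros y Hy. apply (continuous_minus (fun a => wave t b (x + a) * green t a)); auto. }
    eapply Rle_trans; [apply abs_RInt_le; [lra|apply ex_RInt_continuous_le; [lra|exact C3]]|].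
    replace (15 * / (x * x)) with (15 / (x * x) * RInt (green t) 0 1) by (rewrite RInt_green by assumption; unfold Rdiv; ring).
    assert (EG : RInt (fun a => 15 / (x * x) * green t a) 0 1 = 15 / (x * x) * RInt (green t) 0 1).
    { apply (RInt_scal (green t) 0 1 (15 / (x * x))).
      apply ex_RInt_continuous_le; [lra|intros; now apply continuous_green]. }
    rewrite <- EG. clear EG.
    apply RInt_le; [lra| | |].
    - apply ex_RInt_continuous_le; [lra|]. intros y Hy.
      apply (continuous_comp (fun a => minus (wave t b (x + a) * green t a)
        ((cut_wave t b (x + a) - ddcut_wave t b (x + a) / t) * green t a)) Rabs); [now apply C3|apply continuous_Rabs].
    - apply (ex_RInt_scal (green t)), ex_RInt_continuous_le; [lra|intros; now apply continuous_green].
    - intros y Hy. pose proof (green_bounds t y ltac:(lra) ltac:(lra)) as Hg.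
      change (Rabs (wave t b (x + y) * green t y
          - (cut_wave t b (x + y) - ddcut_wave t b (x + y) / t) * green t y) <= 15 / (x * x) * green t y).
      replace (wave t b (x + y) * green t y - (cut_wave t b (x + y) - ddcut_wave t b (x + y) / t) * green t y)
        with (- (cut_wave t b (x + y) - ddcut_wave t b (x + y) / t - wave t b (x + y)) * green t y) by ring.
      rewrite Rabs_mult, Rabs_Ropp, (Rabs_pos_eq (green t y)) by lra.
      apply Rmult_le_compat_r; [lra|].
      eapply Rle_trans; [apply cut_wave_green_error; lra|].
      apply Rmult_le_compat_l; [lra|]. apply Rinv_le_contravar; nra. }
  assert (HN1 : (1 <= N)%nat).
  { destruct N; [|lia]. simpl in HN. nra. }
  apply psum_Rabs_le in Hterm.
  rewrite psum_scal in Hterm. pose proof (psum_inv_sq N HN1) as Hsq.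
  assert (0 < / INR N) by (apply Rinv_0_lt_compat, lt_0_INR; lia).
  assert (Etel : psum (fun n => RInt (fun a => wave t b (INR n + a) * green t a) 0 1
          - ((cut_wave t b (INR n) + cut_wave t b (INR n + 1)) / 2
             - K0 * (dcut_wave t b (INR n + 1) - dcut_wave t b (INR n)))) N =
     psum (fun n => RInt (fun a => wave t b (INR n + a) * green t a) 0 1) N
     - (psum (fun n => cut_wave t b (INR n)) N + (cut_wave t b (INR N + 1) - cut_wave t b 1) / 2
        - K0 * (dcut_wave t b (INR N + 1) - dcut_wave t b 1))).
  { clear. induction N as [|N IH].
    - cbn [psum]. simpl INR. rewrite !Rplus_0_l. field.
    - cbn [psum]. rewrite IH. replace (INR N + 1) with (INR (S N)) by apply S_INR. field. }
  rewrite Etel in Hterm.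
  assert (Hcw : forall x, 1 <= x -> Rabs (cut_wave t b x) <= 1).
  { intros x Hx. unfold cut_wave, cut. rewrite Rabs_mult.
    assert (Hsx : 1 <= sqrt x) by (rewrite <- sqrt_1; apply sqrt_le_1_alt; lra).
    assert (Rabs (wave t b x) <= 1).
    { eapply Rle_trans; [apply wave_bound; lra|]. rewrite <- Rinv_1. apply Rinv_le_contravar; lra. }
    assert (0 <= t / (t + x * x) <= 1) by (split; [apply Rdiv_le_0_compat; nra|apply Rdiv_le_of_le; nra]).
    rewrite Rabs_pos_eq by lra. pose proof (Rabs_pos (wave t b x)). nra. }
  pose proof (Hcw 1 ltac:(lra)) as W1. pose proof (Hcw (INR N + 1) ltac:(nra)) as W2.
  pose proof (dcut_wave_bound t b 1 ltac:(lra) ltac:(lra) ltac:(now left)) as D1.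
  pose proof (dcut_wave_bound t b (INR N + 1) ltac:(lra) ltac:(nra) ltac:(right; nra)) as D2.
  assert (HK0 : 0 <= K0 <= 4).
  { unfold K0. pose proof (green_bounds t 0 ltac:(lra) ltac:(lra)).
    split; [apply Rdiv_le_0_compat; lra|]. apply Rdiv_le_of_le; [lra|]. nra. }
  apply Rabs_le_between in W1. apply Rabs_le_between in W2.
  apply Rabs_le_between in D1. apply Rabs_le_between in D2.
  apply Rabs_le_between in B1. apply Rabs_le_between in Hterm.
  set (d := dcut_wave t b (INR N + 1) - dcut_wave t b 1) in *.
  assert (- 32 <= K0 * d <= 32) by (unfold d; nra).
  apply Rabs_le. lra.
Qed.

(** * Bounds for the full sum and for the moments *)

Lemma sum_bound (t lam b : R) (N : nat) :
  10 ^ 9 <= t -> t * t <= INR N + 1 <= 2 * (t * t) -> 1 / 400 <= lam ->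
  (forall b, smoothing_bound t lam b N) ->
  Rabs (psum (fun n => wave t b (INR n)) N) <= 10 ^ 9 * lam.
Proof.
  intros Ht HN Hlam HP.
  pose proof (cut_sum_bound t lam b N Ht HN Hlam (HP 0) (HP (PI / 2))) as B1.
  pose proof (high_sum_bound t lam b N Ht (proj1 HN) (HP b)) as B2.
  assert (E : psum (fun n => wave t b (INR n)) N =
    psum (fun n => cut t (INR n) * wave t b (INR n)) N + psum (fun n => cut_wave t b (INR n)) N).
  { rewrite <- psum_plus. apply psum_ext. intros n _. unfold cut_wave. ring. }
  rewrite E. eapply Rle_trans; [apply Rabs_triang|]. lra.
Qed.

(** The truncated sum is at most |Z| + 9: N + 1 >= t ^ 2 makes the Euler-Maclaurin tail at most 6,
    and N + 1 <= 2 t ^ 2 makes [em_rem] at most 3. *)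
Lemma smoothing_bound_hurwitz (zeta1 : C -> R -> C) (t lam b : R) (N n : nat) :
  is_modified_hurwitz_zeta zeta1 -> 10 ^ 9 <= t -> t * t <= INR N + 1 <= 2 * (t * t) -> 0 < lam ->
  sqrt t * RInt (fun a => Cmod (zeta1 (1 / 2, t) (Rabs a)) ^ S n) 0 1 <= lam ^ S n ->
  smoothing_bound t lam b N.
Proof.
  intros Hz Ht HN Hl HI k H Ck Hk.
  apply (level_bound_perturbed (fun a => Cmod (zeta1 (1 / 2, t) (Rabs a)))
    (fun a => psum (fun n => wave t b (INR n + a)) N) k lam (sqrt t) H 9 n).
  - assumption.
  - apply sqrt_lt_R0. lra.
  - intros x _. apply continuous_Cmod_half_line; [assumption|lra].
  - assumption.
  - intros x Hx. apply (continuous_psum (fun n a => wave t b (INR n + a))). intros i.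
    apply continuous_shift, continuous_wave. pose proof (INR_S_ge_1 i). lra.
  - intros x _. apply Cmod_ge_0.
  - assumption.
  - intros x Hx. rewrite (Rabs_pos_eq x) by lra.
    pose proof (half_line_estimate (fun s => zeta1 s x) t b x N ltac:(lra) ltac:(lra) (Hz x ltac:(lra))) as HE.
    cbn beta in HE.
    pose proof (rotated_re_le_Cmod b (zeta1 (1 / 2, t) x)) as HR.
    pose proof (em_rem_bound t b (INR N + 1 + x) ltac:(lra)) as HM.
    assert (Hs1 : t <= sqrt (INR N + 1)).
    { rewrite <- (sqrt_square t) at 1 by lra. apply sqrt_le_1_alt. lra. }
    assert (Hs2 : sqrt (INR N + 1 + x) <= 3 / 2 * t).
    { rewrite <- (sqrt_square (3 / 2 * t)) by lra. apply sqrt_le_1_alt. nra. }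
    assert (6 * t / sqrt (INR N + 1) <= 6) by (apply Rdiv_le_of_le; lra).
    assert (2 * sqrt (INR N + 1 + x) / t <= 3) by (apply Rdiv_le_of_le; lra).
    apply Rabs_le_between in HE. apply Rabs_le_between in HR. apply Rabs_le_between in HM.
    apply Rabs_le. lra.
  - assumption.
Qed.

(* Bound the mean below by the first Fourier coefficient; the constant [em_rem t b X] drops out. *)
Lemma hurwitz_mean_lower (zeta1 : C -> R -> C) (t : R) :
  is_modified_hurwitz_zeta zeta1 -> 10 ^ 9 <= t ->
  1 / 150 <= RInt (fun a => Cmod (zeta1 (1 / 2, t) (Rabs a))) 0 1.
Proof.
  intros Hz Ht.
  (* N is of size t ^ 4 here, and not t ^ 2: the Euler-Maclaurin error has to be small, and it
     becomes 6 / t. *)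
  destruct (nfloor_ex ((t * t) * (t * t)) ltac:(apply Rle_0_sqr)) as [N [_ HN]].
  set (X := INR N + 1) in *.
  assert (Htt : t <= t * t) by nra.
  assert (HtX : t * t <= X) by nra.
  destruct (stat_integral_lower t X Ht ltac:(nra)) as [b0 Hb0].
  set (b := - b0).
  pose proof (wave_fourier_coef t b X 1 ltac:(lia) ltac:(simpl; lra) HtX) as HF.
  change (INR 1) with 1 in HF.
  rewrite ln_1, Rmult_0_r, sqrt_1, Rinv_1, !Rmult_1_l in HF.
  replace (0 - b) with b0 in HF by (unfold b; ring).
  set (S0 := fun a => psum (fun n => wave t b (INR n + a)) N).
  set (k := fun a => 2 * cos (2 * PI * INR 1 * a)).
  set (F := fun a => rotated_re b (zeta1 (1 / 2, t) (Rabs a))).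
  set (Z := fun a => Cmod (zeta1 (1 / 2, t) (Rabs a))).
  set (c := em_rem t b X).
  assert (Ck : forall x, continuous k x) by (intros; apply continuous_cos_lin).
  assert (CF : forall x, continuous F x) by (intros; apply continuous_half_line; [assumption|lra]).
  assert (CZ : forall x, continuous Z x) by (intros; apply continuous_Cmod_half_line; [assumption|lra]).
  assert (CS : forall x, 0 <= x <= 1 -> continuous S0 x).
  { intros x Hx. apply (continuous_psum (fun n a => wave t b (INR n + a))). intros i.
    apply continuous_shift, continuous_wave. pose proof (INR_S_ge_1 i). lra. }
  assert (ES : RInt (fun a => S0 a * k a) 0 1 = RInt (fun x => wave t b x * (2 * cos (2 * PI * 1 * x))) 1 X).
  { apply (RInt_unfold (wave t b) k N).
    - intros x Hx. apply continuous_wave. lra.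
    - assumption.
    - intros n x. apply cos_period_shift. }
  assert (Hkb : forall x, Rabs (k x) <= 2).
  { intros x. unfold k. rewrite Rabs_mult, (Rabs_pos_eq 2) by lra.
    pose proof (Rabs_cos_le_1 (2 * PI * INR 1 * x)). lra. }
  assert (Hsq : t * t <= sqrt X).
  { rewrite <- (sqrt_square (t * t)) by nra. apply sqrt_le_1_alt. lra. }
  assert (Herr : forall x, 0 < x < 1 -> Rabs (S0 x + c) <= Z x + 7 / t).
  { intros x Hx. unfold F, Z, S0, c. rewrite (Rabs_pos_eq x) by lra.
    pose proof (half_line_estimate (fun s => zeta1 s x) t b x N ltac:(lra) ltac:(lra) (Hz x ltac:(lra))) as HE.
    cbn beta in HE. fold X in HE.
    pose proof (rotated_re_le_Cmod b (zeta1 (1 / 2, t) x)) as HR.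
    pose proof (em_rem_increment t b X x ltac:(nra) ltac:(lra)) as HM.
    assert (6 * t / sqrt X <= 6 / t).
    { apply Rdiv_le_of_le; [nra|]. replace (6 / t * sqrt X) with (6 * sqrt X / t) by (field; lra).
      apply Rle_div_of_le; nra. }
    assert (/ sqrt X <= 1 / t).
    { rewrite Rdiv_1_l. apply Rinv_le_contravar; nra. }
    apply Rabs_le_between in HE. apply Rabs_le_between in HR. apply Rabs_le_between in HM.
    replace (7 / t) with (6 / t + 1 / t) by (field; lra). apply Rabs_le. lra. }
  assert (Eint : RInt (fun a => (S0 a + c) * k a) 0 1 = RInt (fun a => S0 a * k a) 0 1).
  { assert (Ek : is_RInt (fun a => c * k a) 0 1 (c * 0)).
    { apply (is_RInt_scal k 0 1 c). apply RInt_cos_period. lia. }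
    assert (ESk : is_RInt (fun a => S0 a * k a) 0 1 (RInt (fun a => S0 a * k a) 0 1)).
    { apply (@RInt_correct R_CompleteNormedModule). apply ex_RInt_continuous_le; [lra|].
      intros x Hx. apply (continuous_mult S0 k); auto. }
    apply is_RInt_unique.
    apply is_RInt_ext with (fun a => plus (S0 a * k a) (c * k a)).
    - intros x _. unfold plus; simpl. as_R. ring.
    - evar_last; [apply (is_RInt_plus (fun a => S0 a * k a) (fun a => c * k a)); eassumption|].
      unfold plus; simpl. ring. }
  assert (Cg : forall x, 0 <= x <= 1 -> continuous (fun a => (S0 a + c) * k a) x).
  { intros x Hx. apply (continuous_mult (fun a => S0 a + c) k); [|auto].
    apply (continuous_plus S0 (fun _ => c)); [auto|apply continuous_const]. }
  assert (Hup : Rabs (RInt (fun a => (S0 a + c) * k a) 0 1) <= 2 * RInt Z 0 1 + 14 / t).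
  { eapply Rle_trans; [apply abs_RInt_le; [lra|apply ex_RInt_continuous_le; [lra|exact Cg]]|].
    assert (EZ : RInt (fun a => 2 * Z a + 14 / t) 0 1 = 2 * RInt Z 0 1 + 14 / t).
    { apply is_RInt_unique.
      evar_last.
      - apply (is_RInt_plus (fun a => 2 * Z a) (fun _ => 14 / t)).
        + apply (is_RInt_scal Z 0 1 2). apply (@RInt_correct R_CompleteNormedModule).
          apply ex_RInt_continuous_le; [lra|auto].
        + apply (@is_RInt_const R_NormedModule 0 1 (14 / t)).
      - unfold plus, scal; simpl; unfold mult; simpl. field. lra. }
    rewrite <- EZ. apply RInt_le; [lra| | |].
    - apply ex_RInt_continuous_le; [lra|]. intros x Hx.
      apply (continuous_comp (fun a => (S0 a + c) * k a) Rabs); [now apply Cg|apply continuous_Rabs].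
    - apply ex_RInt_continuous_le; [lra|]. intros x Hx.
      apply (continuous_plus (fun a => 2 * Z a) (fun _ => 14 / t)); [|apply continuous_const].
      apply (continuous_scal_r 2 Z). auto.
    - intros x Hx. specialize (Herr x Hx). specialize (Hkb x). rewrite Rabs_mult.
      pose proof (Rabs_pos (S0 x + c)). pose proof (Rabs_pos (k x)).
      replace (2 * Z x + 14 / t) with ((Z x + 7 / t) * 2) by (field; lra).
      apply Rmult_le_compat; assumption. }
  rewrite Eint, ES in Hup.
  assert (Hst : 10 ^ 4 <= sqrt t).
  { rewrite <- (sqrt_square (10 ^ 4)) by lra. apply sqrt_le_1_alt. lra. }
  assert (20 / sqrt t <= 2 / 1000) by (apply Rdiv_le_of_le; lra).
  assert (14 / t <= 1 / 10000) by (apply Rdiv_le_of_le; lra).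
  (* Half of 1/60 - 20 / sqrt t - 14 / t still exceeds 1/150. *)
  apply Rabs_le_between in HF. apply Rabs_le_between in Hup. lra.
Qed.

Lemma pow_le_reg (x y : R) (n : nat) : 0 < x -> 0 < y -> x ^ S n <= y ^ S n -> x <= y.
Proof.
  intros Hx Hy H. apply Rnot_lt_le. intros Hlt. apply (Rle_not_lt _ _ H).
  simpl. assert (y ^ n <= x ^ n) by (apply pow_incr; lra).
  assert (0 < y ^ n) by now apply pow_lt. nra.
Qed.

(** A smaller moment would, by [level_bound] with the constant kernel 1, force the mean of |Z| down
    to 2/400 = 1/200, against 1/150. The base 1/400 is the same for all n, so the root of the moment
    is bounded below uniformly in k. *)
Lemma hurwitz_moment_lower (zeta1 : C -> R -> C) (t : R) (n : nat) :
  is_modified_hurwitz_zeta zeta1 -> 10 ^ 9 <= t ->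
  (1 / 400) ^ S n <= RInt (fun a => Cmod (zeta1 (1 / 2, t) (Rabs a)) ^ S n) 0 1.
Proof.
  intros Hz Ht. apply Rnot_lt_le. intros Hlt.
  pose proof (hurwitz_mean_lower zeta1 t Hz Ht) as HM.
  pose proof (level_bound (fun a => Cmod (zeta1 (1 / 2, t) (Rabs a))) (fun _ => 1) (1 / 400) 1 1 n
    ltac:(lra) ltac:(lra)
    (fun x _ => continuous_Cmod_half_line zeta1 t x Hz ltac:(lra))
    (fun x _ => continuous_const 1 x) (fun x _ => Cmod_ge_0 _) ltac:(intros; lra) ltac:(lra)) as HL.
  rewrite (RInt_ext _ (fun a => Cmod (zeta1 (1 / 2, t) (Rabs a)))) in HL.
  2:{ intros x _. as_R. apply Rmult_1_r. }
  rewrite (RInt_const 0 1 1) in HL. unfold scal in HL; simpl in HL; unfold mult in HL; simpl in HL. lra.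
Qed.

Theorem theorem1 :
  forall (zeta : C -> C) (zeta1 : C -> R -> C),
    is_riemann_zeta zeta ->
    is_modified_hurwitz_zeta zeta1 ->
    exists C0 t0 : R, 0 < C0 /\ 0 < t0 /\
      forall (k : nat) (t : R), (1 <= k)%nat -> t0 <= t ->
        Cmod (zeta (1 / 2, t)) <=
          C0 * Rpower t (1 / (4 * INR k))
             * Rpower (hurwitz_moment zeta1 k t) (1 / (2 * INR k)).
Proof.
  (* 10 ^ 9 lam for the sum, plus 9 for its distance to the rotated real part of zeta, stays below 2
     times 10 ^ 9 lam; the rotations 0 and PI / 2 double this. *)
  intros zeta zeta1 Hzeta Hz. exists (4 * 10 ^ 9), (10 ^ 9).
  split; [lra|]. split; [lra|]. intros k t Hk Ht.
  assert (Hk1 : 1 <= INR k) by (apply (le_INR 1); assumption).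
  (* The exponent 2 k is written as a successor because [level_bound] splits off one factor of Z. *)
  destruct (2 * k)%nat as [|n] eqn:En; [lia|].
  set (I := RInt (fun a => Cmod (zeta1 (1 / 2, t) (Rabs a)) ^ S n) 0 1).
  assert (EI : hurwitz_moment zeta1 k t = I).
  { unfold hurwitz_moment, I. rewrite En. apply RInt_ext.
    rewrite Rmin_left, Rmax_right by lra. intros x Hx. now rewrite Rabs_pos_eq by lra. }
  rewrite EI.
  pose proof (hurwitz_moment_lower zeta1 t n Hz Ht) as HIlow. fold I in HIlow.
  assert (Hmu : 0 < (1 / 400) ^ S n) by (apply pow_lt; lra).
  assert (HI : 0 < I) by lra.
  set (lam := Rpower t (1 / (4 * INR k)) * Rpower I (1 / (2 * INR k))).
  assert (Hlam : 0 < lam) by (apply Rmult_lt_0_compat; apply exp_pos).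
  assert (HSn : INR (S n) = 2 * INR k) by (rewrite <- En, mult_INR; reflexivity).
  assert (Hpow : lam ^ S n = sqrt t * I).
  { unfold lam. rewrite Rpow_mult_distr, <- !Rpower_pow by apply exp_pos.
    rewrite !Rpower_mult, HSn.
    replace (1 / (4 * INR k) * (2 * INR k)) with (/ 2) by (field; lra).
    replace (1 / (2 * INR k) * (2 * INR k)) with 1 by (field; lra).
    rewrite Rpower_sqrt, Rpower_1 by lra. reflexivity. }
  assert (Hst : 1 <= sqrt t) by (rewrite <- sqrt_1; apply sqrt_le_1_alt; lra).
  (* lam ^ (2 k) is sqrt t times the moment and sqrt t >= 1, so the lower bound for the moment
     passes to lam. *)
  assert (Hlow : 1 / 400 <= lam).
  { apply pow_le_reg with n; [lra|assumption|]. rewrite Hpow. nra. }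
  destruct (nfloor_ex (t * t) ltac:(apply Rle_0_sqr)) as [N [HN1 HN2]].
  assert (HN : t * t <= INR N + 1 <= 2 * (t * t)) by nra.
  assert (HP : forall b, smoothing_bound t lam b N).
  { intros b. apply (smoothing_bound_hurwitz zeta1 t lam b N n); try assumption.
    rewrite Hpow. apply Rle_refl. }
  (* The half-line estimate is applied to [zeta] itself, as the continuation of the series with
     alpha = 0; [zeta1] enters through the smoothing bound. *)
  assert (Hzeta0 : is_continuation_of_series (fun n s => cpow_opp (INR (S n) + 0) s) zeta).
  { destruct Hzeta as [H1 H2]. split; [|exact H2]. intros s Hs.
    refine (is_series_ext _ _ _ _ (H1 s Hs)). intros i. now rewrite Rplus_0_r. }
  assert (Hrot : forall b, Rabs (rotated_re b (zeta (1 / 2, t))) <= 2 * 10 ^ 9 * lam).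
  { intros b.
    pose proof (half_line_estimate zeta t b 0 N (Rle_refl 0) ltac:(lra) Hzeta0) as HE.
    rewrite (psum_ext _ (fun n => wave t b (INR n))) in HE by (intros; now rewrite Rplus_0_r).
    rewrite Rplus_0_r in HE.
    pose proof (sum_bound t lam b N Ht HN Hlow HP) as HS.
    pose proof (em_rem_bound t b (INR N + 1) ltac:(lra)) as HM.
    assert (Hs1 : t <= sqrt (INR N + 1)).
    { rewrite <- (sqrt_square t) at 1 by lra. apply sqrt_le_1_alt. lra. }
    assert (Hs2 : sqrt (INR N + 1) <= 3 / 2 * t).
    { rewrite <- (sqrt_square (3 / 2 * t)) by lra. apply sqrt_le_1_alt. nra. }
    assert (6 * t / sqrt (INR N + 1) <= 6) by (apply Rdiv_le_of_le; lra).
    assert (2 * sqrt (INR N + 1) / t <= 3) by (apply Rdiv_le_of_le; lra).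
    apply Rabs_le_between in HE. apply Rabs_le_between in HS. apply Rabs_le_between in HM.
    apply Rabs_le. lra. }
  rewrite Rmult_assoc. fold lam.
  eapply Rle_trans; [apply Cmod_le_rotated_re|].
  pose proof (Hrot 0). pose proof (Hrot (PI / 2)). lra.
Qed.
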